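(* Let $\phi:\mathbb{D}^2\to\mathbb{D}$ be holomorphic with model $(\mathcal{M},u)$, let $\tau^1\in\mathbb{T}$, and assume $\phi\neq\pi^1$. The following assertions are equivalent: (i) there exists $\sigma\in\mathrm{cl}(\mathbb{D})$ such that $(\tau^1,\sigma)$ is a left Type I DW point for $\phi$; (ii) every point in $\{\tau^1\}\times\mathrm{cl}(\mathbb{D})$ is a left Type I DW point for $\phi$; (iii) $\phi$ is a left Type I function and the common Denjoy-Wolff point of all slice functions $\phi_\mu$ ($\mu\in\mathbb{D}$) is $\tau^1$; (iv) there exists $\sigma\in\mathrm{cl}(\mathbb{D})$ such that $(\tau^1,\sigma)$ is a B-point for $\phi$, $\phi(\tau^1,\sigma)=\tau^1$ and $$\frac{D_{-(\tau^1,\sigma M)}\phi(\tau^1,\sigma)}{-\tau^1}\le 1\quad\text{for all } M>0;$$ (v) for every $\sigma\in\mathrm{cl}(\mathbb{D})$, $(\tau^1,\sigma)$ is a B-point for $\phi$, $\phi(\tau^1,\sigma)=\tau^1$ and $$\frac{D_{-(\tau^1,\sigma M)}\phi(\tau^1,\sigma)}{-\tau^1}\le 1\quad\text{for all } M>0.$$ Moreover, if any of these assertions holds and $\phi_\mu'(\tau^1)$ denotes the angular derivative of $\phi_\mu$ at $\tau^1$, then $$\lim_{M\to\infty}D_{-(\tau^1,\sigma M)}\phi(\tau^1,\sigma)=-\tau^1\phi_\mu'(\tau^1)$$ for all $\mu\in\mathbb{D}$ and all $|\sigma|\le 1$. The analogous statement holds for right Type I DW points: let $\tau^2\in\mathbb{T}$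 and assume $\phi\neq\pi^2$ (instead of $\phi\ne\pi^1$). The following are equivalent: (i') some $(\sigma,\tau^2)$ with $\sigma\in\mathrm{cl}(\mathbb{D})$ is a right Type I DW point for $\phi$; (ii') every point of $\mathrm{cl}(\mathbb{D})\times\{\tau^2\}$ is a right Type I DW point for $\phi$; (iii') $\phi$ is a right Type I function and $\tau^2$ is the common Denjoy-Wolff point of all maps $\phi(\lambda,\cdot)$, $\lambda\in\mathbb{D}$; (iv') for some $\sigma\in\mathrm{cl}(\mathbb{D})$, $(\sigma,\tau^2)$ is a B-point for $\phi$, $\phi(\sigma,\tau^2)=\tau^2$ and $D_{-(\sigma M,\tau^2)}\phi(\sigma,\tau^2)/(-\tau^2)\le 1$ for all $M>0$; (v') the conditions in (iv') hold for every $\sigma\in\mathrm{cl}(\mathbb{D})$. If any of these holds, then $\lim_{M\to\infty}D_{-(\sigma M,\tau^2)}\phi(\sigma,\tau^2)$ equals $-\tau^2$ times the angular derivative of $\phi(\lambda,\cdot)$ at $\tau^2$, for all $\lambda\in\mathbb{D}$ and all $|\sigma|\le1$.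
   Context: Notation. $\mathbb{D}$ is the open unit disk, $\mathbb{T}=\partial\mathbb{D}$, $\mathbb{H}=\{z\in\mathbb{C}:\Re z>0\}$, $\mathrm{cl}$ denotes closure. Superscripts $1,2$ are coordinate indices: $\lambda=(\lambda^1,\lambda^2)$. $\|(\lambda^1,\lambda^2)\|=\max\{|\lambda^1|,|\lambda^2|\}$. $\pi^i(\lambda)=\lambda^i$ are the coordinate projections on $\mathbb{D}^2$. $\partial\mathbb{D}^2$ is the topological boundary of $\mathbb{D}^2$. $\mathcal{S}_2$ is the set of holomorphic functions on $\mathbb{D}^2$ bounded by $1$ in modulus. For $\phi\in\mathcal{S}_2$, $\phi_\mu(\lambda)=\phi(\lambda,\mu)$ and $\widetilde\phi(\lambda^1,\lambda^2)=\phi(\lambda^2,\lambda^1)$. Models. A model $(\mathcal{M},u)$ for $\phi\in\mathcal{S}_2$ consists of a separable Hilbert space with orthogonal decomposition $\mathcal{M}=\mathcal{M}^1\oplus\mathcal{M}^2$ and a holomorphic map $u:\mathbb{D}^2\to\mathcal{M}$, $\lambda\mapsto u_\lambda$, such that for all $\lambda,\mu\in\mathbb{D}^2$, $1-\phi(\lambda)\overline{\phi(\mu)}=(1-\lambda^1\overline{\mu^1})\langle u^1_\lambda,u^1_\mu\rangle+(1-\lambda^2\overline{\mu^2})\langle u^2_\lambda,u^2_\mu\rangle$, where $v^j$ is the orthogonal projection of $v\in\mathcal{M}$ onto $\mathcal{M}^j$. Every $\phi\in\mathcal{S}_2$ has a model. Boundary points. A set $S\subset\mathbb{D}^2$ approaches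 $\tau\in\partial\mathbb{D}^2$ nontangentially if $\tau\in\mathrm{cl}(S)$ and there is $c>0$ with $\|\tau-\lambda\|\le c(1-\|\lambda\|)$ for all $\lambda\in S$. $\tau\in\partial\mathbb{D}^2$ is a B-point for $\phi$ if $\liminf_{\lambda\to\tau}\frac{1-|\phi(\lambda)|}{1-\|\lambda\|}<\infty$; then the nontangential limit of $\phi$ at $\tau$ exists and is denoted $\phi(\tau)$. For a B-point $\tau$, $Y_\tau$ (the cluster set of the model at $\tau$) is the set of weak limits in $\mathcal{M}$ of weakly convergent sequences $\{u_{\lambda_n}\}$, over sequences $\lambda_n\to\tau$ in $\mathbb{D}^2$ for which $\frac{1-|\phi(\lambda_n)|}{1-\|\lambda_n\|}$ stays bounded. Let $\mathbb{H}(\tau)$ be $\tau^1\mathbb{H}\times\tau^2\mathbb{H}$ if $\tau\in\mathbb{T}^2$, $\tau^1\mathbb{H}\times\mathbb{C}$ if $\tau\in\mathbb{T}\times\mathbb{D}$, and $\mathbb{C}\times\tau^2\mathbb{H}$ if $\tau\in\mathbb{D}\times\mathbb{T}$. For a B-point $\tau$ and $\delta\in\mathbb{H}(\tau)$ the directional derivative $D_{-\delta}\phi(\tau)=\lim_{t\to0+}\frac{\phi(\tau-t\delta)-\phi(\tau)}{t}$ exists. Types of functions. $\phi$ is a left Type I function if $\phi\ne\pi^1$ and there is $\tau^1\in\mathbb{T}$ that is the Denjoy-Wolff point of $\phi_\mu:\mathbb{D}\to\mathbb{D}$ for every $\mu\in\mathbb{D}$; it is a right Type I function if $\widetilde\phi$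 is a left Type I function. (For a holomorphic $f:\mathbb{D}\to\mathbb{D}$ without fixed points, its Denjoy-Wolff point is the point of $\mathbb{T}$ to which the iterates of $f$ converge.) DW points. Let $\phi\in\mathcal{S}_2$, $\phi\ne\pi^1$, with model $(\mathcal{M},u)$. A point $(\tau^1,\sigma)\in\mathbb{T}\times\mathrm{cl}(\mathbb{D})$ is a left Type I DW point for $\phi$ if it is a B-point, $\phi(\tau^1,\sigma)=\tau^1$, and there exists $v\in Y_{(\tau^1,\sigma)}$ with $\|v^1\|\le1$ and $v^2=0$. If $\phi\neq\pi^2$, a point $(\sigma,\tau^2)\in\mathrm{cl}(\mathbb{D})\times\mathbb{T}$ is a right Type I DW point for $\phi$ if $(\tau^2,\sigma)$ is a left Type I DW point for $\widetilde\phi$. *)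

(* Defs.v *)
From HB Require Import structures.
From mathcomp Require Import all_boot all_order all_algebra.
From mathcomp Require Import sesquilinear complex.
From mathcomp Require Import all_classical all_reals all_analysis.

Set Implicit Arguments.
Unset Strict Implicit.
Unset Printing Implicit Defensive.

Import Order.TTheory GRing.Theory Num.Theory.
Import numFieldNormedType.Exports.

Local Open Scope classical_set_scope.
Local Open Scope ring_scope.

(* The complex numbers as a normed module over themselves. *)
Notation Cplx R := ((R[i])^o) (only parsing).

Section Geometry.
Context {R : realType}.

(* Norms over R[i] take values in R[i] (on its nonnegative real axis);
   rnorm is the same norm with values in R. *)
Definition rnorm (V : normedModType R[i]) (v : V) : R := complex.Re `|v|.

(* Products carry the max norm, so that the unit ball of C * C is the bidisk. *)
Definition unit_ball {V : normedModType R[i]} : set V := [set v | `|v| < 1].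

Definition approaches_nt (V : normedModType R[i]) (S : set V) (tau : V) : Prop :=
  [/\ S `<=` unit_ball, closure S tau &
      exists2 c : R, 0 < c &
        forall v, S v -> rnorm (tau - v) <= c * (1 - rnorm v)].

Definition nt_limit (V W : normedModType R[i]) (f : V -> W) (tau : V) (l : W)
    : Prop :=
  forall S : set V, approaches_nt S tau -> f @ within S (nbhs tau) --> l.

Definition holomorphic_on (V W : normedModType R[i]) (D : set V) (f : V -> W)
    : Prop :=
  forall v, D v -> differentiable f v.

(* Functions on the disk or bidisk are represented by total functions, whose
   values outside of the (bi)disk are never used. *)

Definition denjoy_wolff_point (f : Cplx R -> Cplx R) (tau : Cplx R) : Prop :=
  [/\ forall z, unit_ball z -> f z <> z,
      `|tau| = 1 &
      forall z, unit_ball z -> iter n f z @[n --> \oo] --> tau].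

Definition is_angular_derivative (f : Cplx R -> Cplx R) (tau a : Cplx R)
    : Prop :=
  exists w : Cplx R, [/\ `|w| = 1, nt_limit f tau w &
    nt_limit (fun z : Cplx R => (f z - w) / (z - tau) : Cplx R) tau a].

Definition tilde (T : Type) (f : Cplx R * Cplx R -> T) (l : Cplx R * Cplx R) : T :=
  f (l.2, l.1).

Definition bidisk_boundary : set (Cplx R * Cplx R) :=
  closure unit_ball `\` interior unit_ball.

Section BidiskFunction.
Variable phi : Cplx R * Cplx R -> Cplx R.
Implicit Types (tau delta : Cplx R * Cplx R).

Definition julia_quotient (l : Cplx R * Cplx R) : R :=
  (1 - rnorm (phi l)) / (1 - rnorm l).

Definition B_point tau : Prop :=
  bidisk_boundary tau /\
  (limf_einf (fun l => (julia_quotient l)%:E)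
             (within unit_ball (nbhs tau)) < +oo)%E.

(* d is the directional derivative D_{-delta} phi(tau), where phi(tau) stands
   for the nontangential limit of phi at tau *)
Definition is_dirderiv tau delta (d : Cplx R) : Prop :=
  exists2 l : Cplx R, nt_limit phi tau l &
    (t%:C%C)^-1 *: (phi (tau - t%:C%C *: delta) - l) @[t --> (0 : R)^'+] --> d.

Definition left_typeI : Prop :=
  ~ {in unit_ball, phi =1 fst} /\
  exists tau1 : Cplx R, forall mu : Cplx R, unit_ball mu ->
    denjoy_wolff_point (fun z => phi (z, mu)) tau1.

End BidiskFunction.

Definition right_typeI (phi : Cplx R * Cplx R -> Cplx R) : Prop :=
  left_typeI (tilde phi).

End Geometry.

Section Models.
Context {R : realType} {M : completeNormedModType R[i]}.
Variable ip : {dot M for Num.conj}.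

(* M is a separable Hilbert space with inner product ip (linear in the first
   variable). *)
Definition separable_hilbert : Prop :=
  (forall v : M, `|v| ^+ 2 = ip v v) /\
  exists2 A : set M, countable A & dense A.

Definition closed_subspace (N : set M) : Prop :=
  [/\ N 0, forall (a : R[i]) (v w : M), N v -> N w -> N (a *: v + w) & closed N].

Definition orthogonal_decomposition (M1 M2 : set M) : Prop :=
  [/\ closed_subspace M1, closed_subspace M2,
      forall v w, M1 v -> M2 w -> ip v w = 0 &
      forall v, exists v1 v2, [/\ M1 v1, M2 v2 & v = v1 + v2]].

(* orthogonal projection onto the closed subspace N *)
Definition oproj (N : set M) (v : M) : M :=
  xget 0 [set w | N w /\ forall x, N x -> ip (v - w) x = 0].

Definition is_model (phi : Cplx R * Cplx R -> Cplx R) (M1 M2 : set M)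
    (u : Cplx R * Cplx R -> M) : Prop :=
  [/\ separable_hilbert, orthogonal_decomposition M1 M2,
      holomorphic_on unit_ball u &
      forall l m : Cplx R * Cplx R, unit_ball l -> unit_ball m ->
        1 - phi l * (phi m)^* =
          (1 - l.1 * (m.1)^*) * ip (oproj M1 (u l)) (oproj M1 (u m)) +
          (1 - l.2 * (m.2)^*) * ip (oproj M2 (u l)) (oproj M2 (u m)) :> R[i]].

Definition weakly_cvg (x : nat -> M) (v : M) : Prop :=
  forall w : M, (ip (x n) w : Cplx R) @[n --> \oo] --> (ip v w : Cplx R).

Definition cluster_set (phi : Cplx R * Cplx R -> Cplx R)
    (u : Cplx R * Cplx R -> M) (tau : Cplx R * Cplx R) : set M :=
  [set v | exists l : nat -> Cplx R * Cplx R,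
    [/\ forall n, unit_ball (l n), l n @[n --> \oo] --> tau,
        exists K : R, forall n, julia_quotient phi (l n) <= K &
        weakly_cvg (fun n => u (l n)) v]].

Definition left_typeI_DW_point (phi : Cplx R * Cplx R -> Cplx R)
    (M1 M2 : set M) (u : Cplx R * Cplx R -> M) (tau : Cplx R * Cplx R)
    : Prop :=
  [/\ `|tau.1| = 1, `|tau.2| <= 1, B_point phi tau, nt_limit phi tau tau.1 &
      exists2 v, cluster_set phi u tau v &
        `|oproj M1 v| <= 1 /\ oproj M2 v = 0].

(* The model of tilde phi is the one induced by the model (M, u) of phi:
   the two summands are exchanged along with the two variables. *)
Definition right_typeI_DW_point (phi : Cplx R * Cplx R -> Cplx R)
    (M1 M2 : set M) (u : Cplx R * Cplx R -> M) (tau : Cplx R * Cplx R)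
    : Prop :=
  left_typeI_DW_point (tilde phi) M2 M1 (tilde u) (tau.2, tau.1).

End Models.

(* Main.v *)
Require Import Defs.
From HB Require Import structures.
From mathcomp Require Import all_boot all_order all_algebra.
From mathcomp Require Import sesquilinear complex.
From mathcomp Require Import all_classical all_reals all_analysis.
From mathcomp Require Import ring lra.
Set Implicit Arguments.
Unset Strict Implicit.
Unset Printing Implicit Defensive.
Import Order.TTheory GRing.Theory Num.Theory.
Import numFieldNormedType.Exports.
Local Open Scope classical_set_scope.
Local Open Scope ring_scope.

(** Write [p] and [q] for the two components of the map [u] of the model. All
    five conditions at the unimodular point [tau] say the same thing: there is
    a vector [x] of norm at most [1] which represents the value [tau] on the
    face over [tau], in the sense that, for all [l] in the bidisk,

      [1 - phi l * tau^* = (1 - l.1 * tau^* ) * ip (p l) x].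

    This single identity is the model identity with its second argument sent to
    the face, and everything follows from it by Cauchy-Schwarz inequalities.

    - From a DW point to [x]: along the sequence that defines the cluster
      vector [v], the model identity passes to the weak limit. Since [v] has no
      second component, its first component represents the limit of [phi]
      ([weak_limit_represents]); a represented value is a nontangential limit,
      so it is [tau] ([represents_nt_limit], [DW_point_represents]).

    - From [x] to every DW point: at points close to the radius of the face, [x]
      bounds [p] by almost [1] and makes [q] small, provided that the second
      coordinate approaches the boundary more slowly than the first
      ([radial_bounds], [represents_DW_point]). Weak compactness of bounded
      sequences then supplies the cluster vector.

    - From [x] to the Denjoy-Wolff point: Cauchy-Schwarz gives Wolff's lemma,
      the invariance of horodisks at [tau] ([wolff_horodisk]). The horodisks keep
      an orbit away from the rest of the circle, and it cannot accumulate inside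
      the disk if the inequality is strict on the slice. If
      equality holds at one point, [phi] is a translation of the first variable
      in the half-plane coordinate [1 / (1 - z * tau^* )], by a nonzero number
      since [phi] is not the first projection, and the orbits are explicit.

    - From the Denjoy-Wolff point to a DW point: an orbit of the slice at [0]
      tends to the circle, so infinitely many of its steps do not decrease the
      modulus, and the model identity on the diagonal bounds [p] and [q] there
      ([denjoy_wolff_DW_point]).

    - From [x] to the directional derivatives: the derivative along a path
      ending on the face is [- tau] times the limit of [ip (p l) x]. This limit
      exists and is a positive number at most [1] by the inequality of Schwarz and Pick,
      a Cauchy-Schwarz inequality for the model ([path_limit]). Conversely, on
      paths whose second coordinate moves fast the bound on the derivative
      makes [q] small and [p] at most about [1] ([dirderiv_DW_point]).

    For the limit of the derivatives, the representing vector [y] is chosen as a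
    weak limit along the radius; then [rnorm y ^+ 2] is the limit of
    [ip (p l) y] on the radius ([sharp_representation]). Subtracting from [p] its
    component along [y] leaves a positive kernel which almost vanishes at points
    of the radius; its own two-point inequality forces [ip (p l) y] to tend to
    [rnorm y ^+ 2] on every slice and on paths of large slope ([cara_limit]).

    The statements for the second variable are those for the first one, applied
    to [tilde phi] and the model with exchanged components. *)

(** * Norms with real values and inner products *)

Section ComplexNorm.
Context {R : realType}.
Local Notation C := (Cplx R).
Implicit Types (z w : C) (a b : R).

Section NormedModule.
Variable V : normedModType R[i].
Implicit Types (x y : V).

Lemma rnormE x : `|x| = (rnorm x)%:C%C.
Proof. by rewrite /rnorm RRe_real // normr_real. Qed.

Lemma rnorm_ge0 x : 0 <= rnorm x.
Proof. by rewrite -ler0c -rnormE normr_ge0. Qed.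

Lemma ltr_rnorm x a : (`|x| < a%:C%C) = (rnorm x < a).
Proof. by rewrite rnormE ltcR. Qed.

Lemma unit_ballE x : unit_ball x <-> rnorm x < 1.
Proof. by rewrite /unit_ball /= -ltr_rnorm. Qed.

Lemma rnorm0 : rnorm (0 : V) = 0.
Proof. by apply: complexI; rewrite -rnormE normr0. Qed.

Lemma rnorm0_eq0 x : rnorm x = 0 -> x = 0.
Proof. by move=> h; apply/normr0_eq0; rewrite rnormE h. Qed.

Lemma rnormN x : rnorm (- x) = rnorm x.
Proof. by rewrite /rnorm normrN. Qed.

Lemma rnormC x y : rnorm (x - y) = rnorm (y - x).
Proof. by rewrite /rnorm distrC. Qed.

Lemma rnormD x y : rnorm (x + y) <= rnorm x + rnorm y.
Proof. by rewrite -lecR rmorphD /= -!rnormE ler_normD. Qed.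

Lemma rnormB x y : rnorm (x - y) <= rnorm x + rnorm y.
Proof. by rewrite -(rnormN y) rnormD. Qed.

Lemma rnormBB x y : rnorm x - rnorm y <= rnorm (x - y).
Proof. by rewrite lerBlDr -{1}(subrK y x) rnormD. Qed.

Lemma rnormZ (c : C) x : rnorm (c *: x) = rnorm c * rnorm x.
Proof. by apply: complexI; rewrite rmorphM /= -!rnormE normrZ. Qed.

End NormedModule.

Local Notation n := (@rnorm R C).

Lemma rnorm1 : n 1 = 1.
Proof. by apply: complexI; rewrite -rnormE normr1. Qed.

Lemma rnormM z w : n (z * w) = n z * n w.
Proof. by apply: complexI; rewrite rmorphM /= -!rnormE normrM. Qed.

Lemma rnormV z : n z^-1 = (n z)^-1.
Proof. by apply: complexI; rewrite fmorphV /= -!rnormE normfV. Qed.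

Lemma rnorm_conj z : n (z^* : R[i]) = n z.
Proof. by apply: complexI; rewrite -!rnormE norm_conjC. Qed.

Lemma rnorm_real a : n a%:C%C = `|a|.
Proof.
by rewrite /rnorm normc_def /= expr0n addr0 sqrtr_sqr.
Qed.

Lemma mul_conjE z : z * (z^* : R[i]) = ((n z) ^+ 2)%:C%C.
Proof. by rewrite rmorphXn /= -rnormE normCK. Qed.

Lemma rnorm_sqr z : n z ^+ 2 = complex.Re z ^+ 2 + complex.Im z ^+ 2.
Proof. by apply: complexI; rewrite add_Re2_Im2 rmorphXn /= -rnormE. Qed.

Lemma Re_le_rnorm z : complex.Re z <= n z.
Proof.
rewrite -[n z]ger0_norm ?rnorm_ge0 //; apply: (le_trans (ler_norm _)).
by rewrite -ler_sqr ?nnegrE // !real_normK ?num_real // rnorm_sqr lerDl sqr_ge0.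
Qed.

Lemma rnorm_le_ReIm z : n z <= `|complex.Re z| + `|complex.Im z|.
Proof.
rewrite -ler_sqr ?nnegrE ?rnorm_ge0 // rnorm_sqr.
rewrite -[complex.Re z ^+ 2]real_normK ?num_real //.
rewrite -[complex.Im z ^+ 2]real_normK ?num_real //.
have := normr_ge0 (complex.Re z); have := normr_ge0 (complex.Im z).
move: (`|_|) (`|_|) => a b; nra.
Qed.

Lemma rnormMn z k : n (z *+ k) = k%:R * n z.
Proof.
rewrite -(mulr_natl z k) rnormM; congr (_ * _).
by rewrite -(rmorph_nat (real_complex R)) rnorm_real normr_nat.
Qed.

(** A unimodular number is inverted by conjugation, so that moving by it
    measures distances to it. *)
Lemma rnorm_1Bconj z w : n z = 1 -> n (1 - w * (z^* : R[i])) = n (z - w).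
Proof.
move=> z1; have zz : z * (z^* : R[i]) = 1 by rewrite mul_conjE z1 expr1n.
by rewrite -zz -mulrBl rnormM rnorm_conj z1 mulr1.
Qed.

Lemma rnorm_pair (z w : C) : rnorm (z, w) = Num.max (n z) (n w).
Proof.
apply: complexI; rewrite -rnormE prod_normE /= !rnormE /Num.max ltcR.
by rewrite /Order.max; case: ifP.
Qed.

Lemma bidiskP (l : C * C) : unit_ball l <-> n l.1 < 1 /\ n l.2 < 1.
Proof.
case: l => z w; rewrite unit_ballE rnorm_pair gt_max /=.
by split => [/andP[]|[-> ->]].
Qed.

End ComplexNorm.

Section InnerProduct.
Context {R : realType} {M : completeNormedModType R[i]}.
Variable ip : {dot M for Num.conj}.
Hypothesis ip_norm : forall v : M, `|v| ^+ 2 = ip v v.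
Local Notation C := (Cplx R).
Local Notation n := (@rnorm R C).
Implicit Types (x y : M).

Lemma ipC x y : ip x y = (ip y x)^*.
Proof. by rewrite hermC expr0 mul1r. Qed.

Lemma ipDl x y z : ip (x + y) z = ip x z + ip y z.
Proof. by rewrite linearDl. Qed.

Lemma ipBl x y z : ip (x - y) z = ip x z - ip y z.
Proof. by rewrite linearBl. Qed.

Lemma ipZl (a : R[i]) x y : ip (a *: x) y = a * ip x y.
Proof. by rewrite linearZl_LR. Qed.

Lemma ip0l y : ip 0 y = 0.
Proof. by rewrite linear0l. Qed.

Lemma ipDr x y z : ip z (x + y) = ip z x + ip z y.
Proof. by rewrite ipC ipDl rmorphD /= -!ipC. Qed.

Lemma ipBr x y z : ip z (x - y) = ip z x - ip z y.
Proof. by rewrite ipC ipBl rmorphB /= -!ipC. Qed.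

Lemma ipZr (a : R[i]) x y : ip x (a *: y) = a^* * ip x y.
Proof. by rewrite ipC ipZl rmorphM /= -ipC. Qed.

Lemma ip0r y : ip y 0 = 0.
Proof. by rewrite ipC ip0l rmorph0. Qed.

Lemma ip_sqr x : ip x x = ((rnorm x) ^+ 2)%:C%C.
Proof. by rewrite -ip_norm rmorphXn /= -rnormE. Qed.

Lemma cauchy_schwarz x y : n (ip x y) <= rnorm x * rnorm y.
Proof.
have [y0|y0] := eqVneq (rnorm y) 0.
  by rewrite (rnorm0_eq0 y0) ip0r !rnorm0 mulr0.
set d : C := ip x y; set k := rnorm y ^+ 2.
have k0 : 0 < k by rewrite exprn_gt0 // lt_def y0 rnorm_ge0.
have e : rnorm (k%:C%C *: x - d *: y) ^+ 2 =
    k * (rnorm x ^+ 2 * rnorm y ^+ 2 - n d ^+ 2).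
  apply: complexI; rewrite -ip_sqr !(ipBl, ipBr, ipZl, ipZr) !ip_sqr -/k.
  rewrite (ipC y x) -/d (_ : (k%:C%C)^* = k%:C%C :> R[i]); last first.
    by apply: conj_Creal; apply/complex_realP; exists k.
  have -> : (k * (rnorm x ^+ 2 * k - n d ^+ 2))%:C%C =
      k%:C%C * ((rnorm x ^+ 2)%:C%C * k%:C%C - d * (d^* : R[i])) :> R[i].
    by rewrite mul_conjE -!(rmorphM, rmorphB).
  by ring.
rewrite -ler_sqr ?nnegrE ?mulr_ge0 ?rnorm_ge0 // exprMn -subr_ge0.
by rewrite -(pmulr_rge0 _ k0) -e sqr_ge0.
Qed.

End InnerProduct.

(** * Two-point inequalities and boundary representations *)

Section Kernel.
Context {R : realType} {M : completeNormedModType R[i]}.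
Variable ip : {dot M for Num.conj}.
Hypothesis ip_norm : forall v : M, `|v| ^+ 2 = ip v v.
Local Notation C := (Cplx R).
Implicit Types (l : C * C).
Local Notation n := (@rnorm R C).

Lemma weighted_cauchy_schwarz_real (m A A' B B' al be x x' y y' : R) :
    0 <= m -> 0 <= A -> 0 <= A' -> 0 <= B -> 0 <= B' -> 0 <= al -> 0 <= be ->
    0 <= x -> 0 <= x' -> 0 <= y -> 0 <= y' ->
    al ^+ 2 <= m * (A * A') -> be ^+ 2 <= m * (B * B') ->
  (al * (x * x') + be * (y * y')) ^+ 2 <=
  m * ((A * x ^+ 2 + B * y ^+ 2) * (A' * x' ^+ 2 + B' * y' ^+ 2)).
Proof.
move=> m0 A0 A'0 B0 B'0 al0 be0 x0 x'0 y0 y'0 hal hbe.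
set U := m * (A * B') * (x * y') ^+ 2; set V := m * (A' * B) * (x' * y) ^+ 2.
have U0 : 0 <= U by rewrite !mulr_ge0 ?sqr_ge0.
have V0 : 0 <= V by rewrite !mulr_ge0 ?sqr_ge0.
have h : (al * be * (x * x' * (y * y'))) ^+ 2 <= U * V.
  have -> : U * V = m * (A * A') * (m * (B * B')) * (x * x' * (y * y')) ^+ 2.
    by rewrite /U /V; ring.
  rewrite exprMn; apply: ler_wpM2r; first exact: sqr_ge0.
  by rewrite exprMn; apply: ler_pM; rewrite ?sqr_ge0.
have h2 : 2 * (al * be * (x * x' * (y * y'))) <= U + V.
  rewrite -ler_sqr ?nnegrE ?addr_ge0 ?mulr_ge0 // exprMn.
  by have := sqr_ge0 (U - V); nra.
have h3 : al ^+ 2 * (x * x') ^+ 2 <= m * (A * A') * (x * x') ^+ 2.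
  by apply: ler_wpM2r; rewrite ?sqr_ge0.
have h4 : be ^+ 2 * (y * y') ^+ 2 <= m * (B * B') * (y * y') ^+ 2.
  by apply: ler_wpM2r; rewrite ?sqr_ge0.
move: h2 h3 h4; rewrite /U /V; lra.
Qed.

(** The source of all two-point inequalities below: a sum of two positive
    kernels, weighted by [al] and [be], is controlled by its diagonal values as
    soon as each weight is. *)
Lemma weighted_cauchy_schwarz (m A A' B B' : R) (al be : C) (x x' y y' : M) :
    0 <= m -> 0 <= A -> 0 <= A' -> 0 <= B -> 0 <= B' ->
    n al ^+ 2 <= m * (A * A') -> n be ^+ 2 <= m * (B * B') ->
  n (al * ip x x' + be * ip y y') ^+ 2 <=
  m * ((A * rnorm x ^+ 2 + B * rnorm y ^+ 2) *
       (A' * rnorm x' ^+ 2 + B' * rnorm y' ^+ 2)).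
Proof.
move=> m0 A0 A'0 B0 B'0 hal hbe.
apply: le_trans (weighted_cauchy_schwarz_real _ _ _ _ _ _ _ _ _ _ _ hal hbe);
  rewrite ?rnorm_ge0 //.
rewrite ler_sqr ?nnegrE ?addr_ge0 ?mulr_ge0 ?rnorm_ge0 //.
apply: (le_trans (rnormD _ _)); rewrite !rnormM; apply: lerD.
  by apply: ler_wpM2l; rewrite ?rnorm_ge0 ?cauchy_schwarz.
by apply: ler_wpM2l; rewrite ?rnorm_ge0 ?cauchy_schwarz.
Qed.

Variables (phi : C * C -> C) (p q : C * C -> M).
Hypothesis phi_disk : forall l, unit_ball l -> unit_ball (phi l).
Hypothesis model : forall l m : C * C, unit_ball l -> unit_ball m ->
  1 - phi l * (phi m)^* =
    (1 - l.1 * (m.1)^*) * ip (p l) (p m) +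
    (1 - l.2 * (m.2)^*) * ip (q l) (q m) :> R[i].

Lemma phi_lt1 l : unit_ball l -> n (phi l) < 1.
Proof. by move=> /phi_disk; rewrite unit_ballE. Qed.

Lemma model_diag l : unit_ball l ->
  1 - n (phi l) ^+ 2 =
    (1 - n l.1 ^+ 2) * rnorm (p l) ^+ 2 + (1 - n l.2 ^+ 2) * rnorm (q l) ^+ 2.
Proof.
move=> hl; apply: complexI; have := model hl hl.
rewrite !mul_conjE !(ip_sqr ip_norm) => h.
move: h; rewrite -(rmorph1 (real_complex R)) -!(rmorphB (real_complex R)).
rewrite -!(rmorphM (real_complex R)) -(rmorphD (real_complex R)).
exact: id.
Qed.

Lemma disk_sqr_lt1 (z : C) : n z < 1 -> 0 < 1 - n z ^+ 2.
Proof. by move=> z1; have := rnorm_ge0 z; nra. Qed.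

(** The inequality of Schwarz and Pick on the bidisk: a bound [m] for the
    reciprocals of [1] minus the squared pseudohyperbolic distance in both
    coordinates is passed on to the values. *)
Lemma schwarz_pick (m : R) (l l' : C * C) : unit_ball l -> unit_ball l' -> 0 <= m ->
    n (1 - l.1 * (l'.1)^*) ^+ 2 <= m * ((1 - n l.1 ^+ 2) * (1 - n l'.1 ^+ 2)) ->
    n (1 - l.2 * (l'.2)^*) ^+ 2 <= m * ((1 - n l.2 ^+ 2) * (1 - n l'.2 ^+ 2)) ->
  n (1 - phi l * (phi l')^*) ^+ 2 <=
    m * ((1 - n (phi l) ^+ 2) * (1 - n (phi l') ^+ 2)).
Proof.
move=> hl hl' m0 h1 h2.
have [/disk_sqr_lt1/ltW ? /disk_sqr_lt1/ltW ?] := (bidiskP l).1 hl.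
have [/disk_sqr_lt1/ltW ? /disk_sqr_lt1/ltW ?] := (bidiskP l').1 hl'.
rewrite (model hl hl') (model_diag hl) (model_diag hl').
exact: weighted_cauchy_schwarz.
Qed.

(** With [t'] the conjugate of a boundary value [t], this writes the kernel in
    terms of the two defects at [t], which a representing vector controls. *)
Lemma one_sub_mul_unimodular (t t' z w : R[i]) : t * t' = 1 ->
  1 - z * w = 1 - z * t' + (1 - w * t) - (1 - z * t') * (1 - w * t).
Proof.
move=> tt; have -> : 1 - z * t' + (1 - w * t) - (1 - z * t') * (1 - w * t) =
    1 - z * w * (t * t') by ring.
by rewrite tt mulr1.
Qed.

Section Caratheodory.
Variables (tau : C) (x : M).
Hypothesis tau1 : n tau = 1.
Hypothesis cara : forall l : C * C, unit_ball l ->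
  1 - phi l * (tau : R[i])^* = (1 - l.1 * (tau : R[i])^*) * ip (p l) x :> R[i].

Local Notation b l := (1 - phi l * (tau : R[i])^* : C).
Local Notation ell l := (1 - l.1 * (tau : R[i])^* : C).
Local Notation a l := (ip (p l) x : C).

Lemma rnorm_1Bconj_gt0 (z : C) : n z < 1 -> 0 < n (1 - z * (tau : R[i])^*).
Proof.
move=> z1; rewrite (rnorm_1Bconj _ tau1); apply: lt_le_trans (rnormBB _ _).
by rewrite tau1 subr_gt0.
Qed.

Lemma sqr_defect_le (z : C) : n z < 1 ->
  1 - n z ^+ 2 <= 2 * n (1 - z * (tau : R[i])^*).
Proof.
move=> z1; rewrite (rnorm_1Bconj _ tau1).
have := rnormBB tau z; rewrite tau1; have := rnorm_ge0 z; nra.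
Qed.

Lemma cara_neq0 (z : C) : n z < 1 -> 1 - z * (tau : R[i])^* != 0.
Proof.
move=> /rnorm_1Bconj_gt0 h; apply/eqP => e.
by move: h; rewrite e rnorm0 ltxx.
Qed.

Lemma cara_norm l : unit_ball l -> n (b l) = n (ell l) * n (a l).
Proof. by move=> hl; rewrite (cara hl) rnormM. Qed.

Lemma cara_le l : n (a l) <= rnorm (p l) * rnorm x.
Proof. exact: cauchy_schwarz. Qed.

Lemma cara_gt0 l : unit_ball l -> 0 < n (a l).
Proof.
move=> hl; have := rnorm_1Bconj_gt0 (phi_lt1 hl).
rewrite (cara_norm hl) pmulr_rgt0 //.
by apply: rnorm_1Bconj_gt0; case: ((bidiskP l).1 hl).
Qed.

Lemma component_defect l : unit_ball l ->
  (1 - n l.1 ^+ 2) * rnorm (p l) ^+ 2 <= 1 - n (phi l) ^+ 2.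
Proof.
move=> hl; rewrite (model_diag hl) lerDl mulr_ge0 ?sqr_ge0 //.
by apply/ltW/disk_sqr_lt1; case: ((bidiskP l).1 hl).
Qed.

(** Wolff's lemma, the invariance of horodisks at [tau]: the representation
    bounds the defect of [phi l] at [tau] by that of [l.1] times [|p l|], and
    [|p l|^2] is controlled by the model on the diagonal. *)
Lemma wolff_horodisk l : rnorm x <= 1 -> unit_ball l ->
  n (b l) ^+ 2 * (1 - n l.1 ^+ 2) <= n (ell l) ^+ 2 * (1 - n (phi l) ^+ 2).
Proof.
move=> x1 hl; rewrite (cara_norm hl) exprMn -mulrA.
apply: ler_wpM2l; first exact: sqr_ge0.
apply: le_trans (component_defect hl); rewrite mulrC.
have [/disk_sqr_lt1/ltW ? _] := (bidiskP l).1 hl.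
apply: ler_wpM2l => //; rewrite ler_sqr ?nnegrE ?rnorm_ge0 //.
apply: (le_trans (cara_le l)).
by rewrite -[leRHS]mulr1 ler_wpM2l ?rnorm_ge0.
Qed.

(** On a nontangential region the model identity bounds [1 - |phi|^2] from below
    by a multiple of [(1 - |l.1|) |p|^2], and the representation bounds it from
    above by a multiple of [(1 - |l.1|) |p|]; one factor [|p|] cancels. *)
Lemma nontangential_bound c l : unit_ball l -> n (ell l) <= c * (1 - n l.1) ->
  rnorm (p l) <= 2 * c * rnorm x.
Proof.
move=> hl hc; have [l1 _] := (bidiskP l).1 hl.
have := component_defect hl; have := sqr_defect_le (phi_lt1 hl).
rewrite (cara_norm hl).
have := cara_le l; move: (rnorm_ge0 (p l)) (rnorm_ge0 x) (rnorm_ge0 (a l)).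
have := rnorm_ge0 (ell l); have := rnorm_ge0 l.1; move: hc l1.
move: (n l.1) (n (ell l)) (n (a l)) (n (phi l)) (rnorm (p l)) (rnorm x).
move=> z e al f P X hc z1 z0 e0 P0 X0 al0 h1 h2 h3.
have [->|P1] := eqVneq P 0; first by rewrite !mulr_ge0 //; nra.
have {}P1 : 0 < P by rewrite lt_def P1.
have h4 : (1 - z) * P * P <= (1 - z) * P * (2 * c * X).
  have h5 : e * al <= c * (1 - z) * (P * X) by apply: ler_pM.
  have : (1 - z) * P ^+ 2 <= (1 - z ^+ 2) * P ^+ 2.
    by apply: ler_wpM2r; [exact: sqr_ge0|nra].
  lra.
by rewrite ler_pM2l in h4 => //; rewrite mulr_gt0 // subr_gt0.
Qed.

Lemma nontangential_cara_bound c l : unit_ball l ->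
  n (ell l) <= c * (1 - n l.1) -> n (a l) <= 2 * c * rnorm x ^+ 2.
Proof.
move=> hl hc; apply: (le_trans (cara_le l)).
rewrite [_ ^+ 2]expr2 mulrA; apply: ler_wpM2r; first exact: rnorm_ge0.
exact: nontangential_bound.
Qed.

Lemma nontangential_value_bound c l : unit_ball l ->
  n (ell l) <= c * (1 - n l.1) ->
  n (b l) <= n (ell l) * (2 * c * rnorm x ^+ 2).
Proof.
move=> hl hc; rewrite (cara_norm hl); apply: ler_wpM2l; first exact: rnorm_ge0.
exact: nontangential_cara_bound.
Qed.

(** On the radius, where the nontangential constant is [1], the comparison is
    sharp: [(1 - r ^+ 2) |p|^2] is at most [2 (1 - r) |p|]. The second coordinate
    is free, which leaves room to choose how fast it approaches the boundary. *)
Lemma radial_bounds (r : R) l : rnorm x <= 1 -> unit_ball l ->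
    0 <= r -> n l.1 = r -> n (ell l) = 1 - r ->
  [/\ (1 + r) * rnorm (p l) <= 2, n (b l) <= 2 * (1 - r) &
      (1 - n l.2 ^+ 2) * rnorm (q l) ^+ 2 <= 4 * (1 - r)].
Proof.
move=> x1 hl r0 l1 le; have [r1 l2] := (bidiskP l).1 hl.
have := model_diag hl; have := rnormBB tau (phi l); rewrite -(rnorm_1Bconj _ tau1) tau1.
have := cara_norm hl; rewrite le l1.
have := cara_le l; move: (rnorm_ge0 (p l)) (rnorm_ge0 x) (rnorm_ge0 (a l)).
have := disk_sqr_lt1 l2; have := sqr_ge0 (rnorm (q l)).
have := phi_lt1 hl; have := rnorm_ge0 (phi l); rewrite l1 in r1.
move: (n (b l)) (n (a l)) (n (phi l)) (rnorm (p l)) (rnorm x) x1 r1 r0.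
move: (rnorm (q l) ^+ 2) (1 - n l.2 ^+ 2).
move=> Q w b' al f P X x1 r1 r0 f0 f1 Q0 w0 P0 X0 al0 haP hb hbf hd.
have alP : al <= P by nra.
have hP : (1 - r) * (1 + r) * P ^+ 2 <= 2 * ((1 - r) * P).
  have h0 : 0 <= w * Q by rewrite mulr_ge0 // ltW.
  have : (1 - f) * (1 + f) <= (1 - r) * P * 2.
    have := ler_wpM2l (_ : 0 <= 1 - r) alP; rewrite subr_ge0 (ltW r1) => /(_ isT).
    have : (1 - f) * (1 + f) <= (1 - f) * 2 by apply: ler_wpM2l; lra.
    lra.
  nra.
have hP2 : (1 + r) * P <= 2.
  have [->|P1] := eqVneq P 0; first by rewrite mulr0.
  have {}P1 : 0 < (1 - r) * P by rewrite mulr_gt0 ?lt_def ?P1 // subr_eq0; lra.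
  by rewrite -(ler_pM2l P1); lra.
have P2 : P <= 2 by nra.
have al2 : al <= 2 by lra.
have b2 : b' <= 2 * (1 - r) by rewrite hb; nra.
split => //.
have : 0 <= (1 - r ^+ 2) * P ^+ 2 by rewrite mulr_ge0 ?sqr_ge0 //; nra.
nra.
Qed.

(** The equality case of Wolff's lemma: equality throughout forces [q l0] to
    vanish and [p l0] to be a multiple of [x], so the model identity against [l0]
    only involves the represented values; in the half-plane coordinate
    [1 / (1 - z * tau^* )] it says that the function [phi] is a translation of the
    first variable. *)
Lemma horodisk_equality_translation l0 : rnorm x <= 1 -> unit_ball l0 ->
    n (b l0) ^+ 2 * (1 - n l0.1 ^+ 2) = n (ell l0) ^+ 2 * (1 - n (phi l0) ^+ 2) ->
  forall l, unit_ball l ->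
  (b l)^-1 = (ell l)^-1 + (((ell l0)^* : R[i])^-1 - ((b l0)^* : R[i])^-1) :> R[i].
Proof.
move=> x1 hl0; have [l01 l02] := (bidiskP l0).1 hl0.
have e0 := rnorm_1Bconj_gt0 l01; have a0 := cara_gt0 hl0.
rewrite (cara_norm hl0) exprMn -mulrA => /(mulfI _).
rewrite expf_neq0 ?gt_eqF // => /(_ isT) heq.
have w1 := disk_sqr_lt1 l01; have w2 := disk_sqr_lt1 l02.
have ap : n (a l0) <= rnorm (p l0).
  by apply: (le_trans (cara_le l0)); rewrite -[leRHS]mulr1 ler_wpM2l ?rnorm_ge0.
have ap2 : n (a l0) ^+ 2 <= rnorm (p l0) ^+ 2.
  by rewrite ler_sqr ?nnegrE ?rnorm_ge0.
have hd := model_diag hl0.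
have ap3 : (1 - n l0.1 ^+ 2) * n (a l0) ^+ 2 <= (1 - n l0.1 ^+ 2) * rnorm (p l0) ^+ 2.
  by rewrite ler_pM2l.
have Q0 : q l0 = 0.
  apply: rnorm0_eq0; apply/eqP; rewrite -sqrf_eq0 eq_le sqr_ge0 andbT.
  rewrite -(pmulr_rle0 _ w2); lra.
rewrite Q0 rnorm0 expr0n mulr0 addr0 in hd.
have Pa : rnorm (p l0) ^+ 2 = n (a l0) ^+ 2.
  by apply: (mulfI (lt0r_neq0 w1)); rewrite -hd -heq mulrC.
(* The equality case of Cauchy-Schwarz, by expanding the square. *)
have P0 : p l0 = a l0 *: x.
  apply/eqP; rewrite -subr_eq0; apply/eqP/rnorm0_eq0/eqP.
  rewrite -sqrf_eq0 eq_le sqr_ge0 andbT.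
  have -> : rnorm (p l0 - a l0 *: x) ^+ 2 = n (a l0) ^+ 2 * (rnorm x ^+ 2 - 1).
    apply: complexI; rewrite -(ip_sqr ip_norm) !(ipBl, ipBr, ipZl, ipZr) !(ip_sqr ip_norm).
    have -> : (n (a l0) ^+ 2 * (rnorm x ^+ 2 - 1))%:C%C =
        a l0 * (a l0)^* * ((rnorm x ^+ 2)%:C%C - 1) :> R[i].
      by rewrite mul_conjE rmorphM rmorphB rmorph1.
    by rewrite Pa (ipC ip x) -mul_conjE; ring.
  rewrite pmulr_rle0 ?exprn_gt0 // subr_le0 expr_le1 ?rnorm_ge0 //.
move=> l hl; have [l1 l2] := (bidiskP l).1 hl.
have tt : tau * (tau : R[i])^* = 1 by rewrite mul_conjE tau1 expr1n.
have := model hl hl0; rewrite P0 Q0 ip0r mulr0 addr0 ipZr.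
have := cara hl; have := cara hl0.
have := cara_neq0 l1; have := cara_neq0 l01.
have := cara_neq0 (phi_lt1 hl); have := cara_neq0 (phi_lt1 hl0).
rewrite -(conjC_eq0 (1 - l0.1 * _)) -(conjC_eq0 (1 - phi l0 * _)).
have hb0 : (b l0)^* = 1 - (phi l0)^* * tau :> R[i].
  by rewrite rmorphB rmorph1 rmorphM /= conjCK.
have he0 : (ell l0)^* = 1 - (l0.1)^* * tau :> R[i].
  by rewrite rmorphB rmorph1 rmorphM /= conjCK.
move=> nb0 nb ne0 ne hb0' hb.
have {}hb0' : (b l0)^* = (ell l0)^* * (a l0)^* :> R[i] by rewrite hb0' rmorphM.
have -> : 1 - phi l * (phi l0)^* =
    b l + (b l0)^* - b l * (b l0)^* :> R[i].
  by rewrite hb0; exact: one_sub_mul_unimodular.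
have -> : 1 - l.1 * (l0.1)^* =
    ell l + (ell l0)^* - ell l * (ell l0)^* :> R[i].
  by rewrite he0; exact: one_sub_mul_unimodular.
move: nb0 nb ne0 ne; rewrite hb0' hb.
move: (ell l) ((ell l0)^*) (ip (p l) x) ((ip (p l0) x)^*) => e e0' al al0'.
rewrite !mulf_eq0 !negb_or => /andP[nb0 na0] /andP[nb na] _ _ h.
apply/eqP; rewrite -subr_eq0; apply/eqP.
have -> : (e * al)^-1 - (e^-1 + (e0'^-1 - (e0' * al0')^-1)) =
  (e * al + e0' * al0' - e * al * (e0' * al0') - (e + e0' - e * e0') * (al0' * al))
   / (e * al * (e0' * al0')) :> R[i].
  by field; rewrite na0 nb0 na nb.
by rewrite h subrr mul0r.
Qed.

(** The arithmetic of the next limit theorem. Here [e] is the distance from [l]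
    to the face, [s] that of the fixed point of the radius, [W], [V] and [d]
    are the values [1 - |z|^2] for the two coordinates of [l] and for the fixed
    point, and [rho], [rho0] are the residuals at the two points. *)
Lemma residual_estimate (e s A c eta d W V rho rho0 k : R) :
    0 < e -> 0 < A -> 0 < c -> 0 < eta -> 0 < d -> d <= 1 -> 0 < W -> 0 < V ->
    e <= s -> e <= c * W -> e <= s ^+ 2 * V ->
    rho <= 2 * (e * A) -> 0 <= rho0 -> rho0 <= eta * d ->
    eta * (2 * A * (4 * c + 1)) = k ^+ 2 ->
  ((e + s) ^+ 2 / (W * d) + V^-1) * (rho * rho0) <= (s * k) ^+ 2.
Proof.
move=> e0 A0 c0 eta0 d0 d1 W0 V0 es eW eV hrho rho00 hrho0 hk.
set m := _ + _; have s0 : 0 < s by lra.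
have m0 : 0 <= m.
  by rewrite addr_ge0 ?divr_ge0 ?sqr_ge0 ?invr_ge0 ?(ltW V0) // mulr_ge0 // ltW.
have me : m * e <= 4 * c * s ^+ 2 / d + s ^+ 2.
  rewrite /m mulrDl; apply: lerD; last by rewrite mulrC ler_pdivrMr.
  rewrite mulrAC ler_pdivrMr ?mulr_gt0 //.
  have -> : 4 * c * s ^+ 2 / d * (W * d) = 4 * s ^+ 2 * (c * W).
    by field; rewrite gt_eqF.
  by apply: ler_pM => //; rewrite ?sqr_ge0 ?(ltW e0) //; nra.
have B0 : 0 <= 4 * c * s ^+ 2 / d + s ^+ 2.
  by apply: le_trans me; rewrite mulr_ge0 // ltW.
have mrho : m * rho <= 2 * A * (4 * c * s ^+ 2 / d + s ^+ 2).
  apply: (@le_trans _ _ (m * (2 * (e * A)))); first by rewrite ler_wpM2l.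
  have -> : m * (2 * (e * A)) = 2 * A * (m * e) by ring.
  by rewrite ler_wpM2l // mulr_ge0 // ltW.
rewrite mulrA.
apply: (@le_trans _ _ (2 * A * (4 * c * s ^+ 2 / d + s ^+ 2) * (eta * d))).
  apply: (le_trans (ler_wpM2r rho00 mrho)).
  by rewrite ler_wpM2l // mulr_ge0 // mulr_ge0 // ltW.
have -> : 2 * A * (4 * c * s ^+ 2 / d + s ^+ 2) * (eta * d) =
    eta * (2 * A * (4 * c + d)) * s ^+ 2 by field; rewrite gt_eqF.
rewrite exprMn mulrC ler_wpM2l ?sqr_ge0 // -hk.
by rewrite ler_wpM2l ?(ltW eta0) // ler_wpM2l ?mulr_ge0 ?(ltW A0) // lerD2l.
Qed.

Section Residual.
Hypothesis x0 : 0 < rnorm x.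
Local Notation Y := (rnorm x ^+ 2).
Local Notation residual l := (1 - n (phi l) ^+ 2 - (1 - n l.1 ^+ 2) * (n (a l) ^+ 2 / Y)).

(** Removing the component of [p] along [x] leaves a positive kernel: it has
    a two-point inequality of its own. *)
Lemma residual_schwarz_pick (m : R) (l l' : C * C) :
    unit_ball l -> unit_ball l' -> 0 <= m ->
    n (1 - l.1 * (l'.1)^*) ^+ 2 <= m * ((1 - n l.1 ^+ 2) * (1 - n l'.1 ^+ 2)) ->
    n (1 - l.2 * (l'.2)^*) ^+ 2 <= m * ((1 - n l.2 ^+ 2) * (1 - n l'.2 ^+ 2)) ->
  n (1 - phi l * (phi l')^* -
     (1 - l.1 * (l'.1)^*) * (a l * (a l')^* / Y%:C%C)) ^+ 2 <=
    m * (residual l * residual l').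
Proof.
move=> hl hl' m0 h1 h2.
have Y0 : Y%:C%C != 0 :> R[i].
  by rewrite (inj_eq (@complexI _) _ 0) expf_neq0 ?gt_eqF.
pose r (k : C * C) := p k - (a k / Y%:C%C) *: x.
have rr (k k' : C * C) : ip (r k) (r k') = ip (p k) (p k') - a k * (a k')^* / Y%:C%C.
  rewrite /r !(ipBl, ipBr, ipZl, ipZr) (ip_sqr ip_norm) (ipC ip x (p k')).
  rewrite rmorphM /= fmorphV /= (_ : Y%:C%C^* = Y%:C%C); last first.
    by apply: conj_Creal; apply/complex_realP; exists Y.
  by rewrite divfK //; ring.
have rE k : rnorm (r k) ^+ 2 = rnorm (p k) ^+ 2 - n (a k) ^+ 2 / Y.
  apply: complexI; rewrite -(ip_sqr ip_norm) rr (ip_sqr ip_norm) mul_conjE.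
  by rewrite -(fmorphV (real_complex R)) -(rmorphM (real_complex R)) -(rmorphB (real_complex R)).
have dE k : unit_ball k -> residual k =
    (1 - n k.1 ^+ 2) * rnorm (r k) ^+ 2 + (1 - n k.2 ^+ 2) * rnorm (q k) ^+ 2.
  by move=> hk; rewrite rE (model_diag hk); ring.
have [/disk_sqr_lt1/ltW ? /disk_sqr_lt1/ltW ?] := (bidiskP l).1 hl.
have [/disk_sqr_lt1/ltW ? /disk_sqr_lt1/ltW ?] := (bidiskP l').1 hl'.
rewrite (dE l hl) (dE l' hl').
rewrite (_ : _ - _ = (1 - l.1 * (l'.1)^*) * ip (r l) (r l') +
    (1 - l.2 * (l'.2)^*) * ip (q l) (q l')).
  exact: weighted_cauchy_schwarz.
by rewrite (model hl hl') rr; ring.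
Qed.

Lemma residual_ge0 l : unit_ball l -> 0 <= residual l.
Proof.
move=> hl; rewrite subr_ge0; apply: le_trans (component_defect hl).
have [/disk_sqr_lt1/ltW ? _] := (bidiskP l).1 hl.
apply: ler_wpM2l => //; rewrite ler_pdivrMr ?exprn_gt0 // -exprMn.
by rewrite ler_sqr ?nnegrE ?mulr_ge0 ?rnorm_ge0 ?cara_le.
Qed.

(** Near [tau], the function [a] is pinned down by its values at points of the
    radius of the face: the residual kernel between such a point, where it
    is almost zero on the diagonal, and [l] must be small, and at [l] close to
    [tau] this kernel measures the distance from [a l] to [rnorm x ^+ 2]. *)
Lemma cara_limit (eps A c : R) : 0 < eps -> 0 < A -> 0 < c ->
    (forall eta : R, 0 < eta -> exists r : R,
      [/\ 0 <= r, r < 1, residual (r%:C%C * tau, 0 : C) <= eta * (1 - r ^+ 2) &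
          Y <= 2 * n (a (r%:C%C * tau, 0 : C))]) ->
  exists delta kappa : R, [/\ 0 < delta, 0 < kappa &
    forall l, unit_ball l -> n (ell l) <= delta -> n (a l) <= A ->
      n (ell l) <= c * (1 - n l.1 ^+ 2) ->
      n (ell l) <= kappa * (1 - n l.2 ^+ 2) ->
      n (a l - Y%:C%C) <= eps].
Proof.
move=> e0 A0 c0 radial; have Y0 : 0 < Y by rewrite exprn_gt0.
pose eta := (eps / 4) ^+ 2 / (2 * A * (4 * c + 1)).
have den0 : 0 < 2 * A * (4 * c + 1) by rewrite !mulr_gt0 // addr_gt0 ?mulr_gt0.
have eta0 : 0 < eta by rewrite divr_gt0 // exprn_gt0 // divr_gt0.
have [r [r0 r1 hr ha0]] := radial _ eta0.
set l0 := (r%:C%C * tau, 0) : C * C; rewrite -/l0 in hr ha0.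
have nl01 : n l0.1 = r by rewrite /l0 /= rnormM tau1 mulr1 rnorm_real ger0_norm.
have nl02 : n l0.2 = 0 by rewrite /l0 /= rnorm0.
have hl0 : unit_ball l0 by apply/bidiskP; rewrite nl01 nl02.
have tt : tau * (tau : R[i])^* = 1 by rewrite mul_conjE tau1 expr1n.
pose s := 1 - r; have s0 : 0 < s by rewrite subr_gt0.
(* [k0] collects the terms that carry the factor [ell l], see [idH] below. *)
pose k0 : C := 1 - s%:C%C * (a l0)^* - (a l0)^* * (1 - s%:C%C) / Y%:C%C.
pose delta := Num.min s (s * (eps / 4) / (A * (n k0 + 1))).
have k00 := rnorm_ge0 k0.
have dd0 : 0 < A * (n k0 + 1) by rewrite mulr_gt0 // ltr_wpDl.
have delta0 : 0 < delta.
  by rewrite lt_min s0 /= divr_gt0 // mulr_gt0 // divr_gt0.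
exists delta, (s ^+ 2); split=> //; first by rewrite exprn_gt0.
move=> l hl; rewrite /delta le_min => /andP[es ek] haA hc hk.
have [l1 l2] := (bidiskP l).1 hl.
have w1 := disk_sqr_lt1 l1; have w2 := disk_sqr_lt1 l2.
have e0' := rnorm_1Bconj_gt0 l1.
set e := n (ell l) in es ek hc hk e0'.
have rr0 : 0 < 1 - r ^+ 2 by rewrite -nl01 disk_sqr_lt1 ?nl01.
pose m := (e + s) ^+ 2 / ((1 - n l.1 ^+ 2) * (1 - r ^+ 2)) + (1 - n l.2 ^+ 2)^-1.
have m1 : 0 <= (e + s) ^+ 2 / ((1 - n l.1 ^+ 2) * (1 - r ^+ 2)).
  by rewrite divr_ge0 ?sqr_ge0 // ltW // mulr_gt0.
have m2 : 0 <= (1 - n l.2 ^+ 2)^-1 by rewrite invr_ge0 ltW.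
have c1 : n (1 - l.1 * (l0.1)^*) <= e + s.
  have -> : 1 - l.1 * (l0.1)^* = s%:C%C + r%:C%C * ell l :> R[i].
    rewrite /l0 /= rmorphM /= (_ : r%:C%C^* = r%:C%C); last first.
      by apply: conj_Creal; apply/complex_realP; exists r.
    by rewrite /s rmorphB rmorph1; ring.
  apply: (le_trans (rnormD _ _)); rewrite rnormM !rnorm_real.
  rewrite (ger0_norm r0) (gtr0_norm s0) -/e addrC lerD2r.
  by rewrite -[leRHS]mul1r ler_wpM2r // ltW.
have hH : n (1 - phi l * (phi l0)^* -
     (1 - l.1 * (l0.1)^*) * (a l * (a l0)^* / Y%:C%C)) ^+ 2 <=
    m * (residual l * residual l0).
  apply: residual_schwarz_pick => //; rewrite ?addr_ge0 ?nl01 ?nl02 //.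
    apply: (@le_trans _ _ ((e + s) ^+ 2)).
      have es0 : 0 <= e + s by rewrite addr_ge0 // ltW.
      by rewrite ler_sqr ?nnegrE ?rnorm_ge0.
    rewrite /m mulrDl divfK ?lerDl ?gt_eqF ?mulr_gt0 //.
    by rewrite mulr_ge0 // ltW // mulr_gt0.
  rewrite conjC0 mulr0 subr0 rnorm1 expr1n expr0n subr0 mulr1 /m mulrDl.
  by rewrite mulVf ?gt_eqF // lerDr mulr_ge0 // ltW.
have res_le : residual l <= 2 * (e * A).
  apply: (@le_trans _ _ (1 - n (phi l) ^+ 2)).
    by rewrite gerBl mulr_ge0 ?divr_ge0 ?sqr_ge0 // ltW.
  apply: (le_trans (sqr_defect_le (phi_lt1 hl))).
  by rewrite (cara_norm hl) -/e ler_pM2l // ler_pM2l.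
have mres : m * (residual l * residual l0) <= (s * (eps / 4)) ^+ 2.
  apply: (@residual_estimate e s A c eta (1 - r ^+ 2)) => //.
  - by rewrite gerBl sqr_ge0.
  - exact: residual_ge0.
  - by rewrite /eta divfK ?gt_eqF.
have {}hH := le_trans hH mres.
have se0 : 0 <= s * (eps / 4) by rewrite mulr_ge0 ?divr_ge0 // ltW.
rewrite ler_sqr ?nnegrE ?rnorm_ge0 // in hH.
have YC : Y%:C%C != 0 :> R[i] by rewrite (inj_eq (@complexI _) _ 0) gt_eqF.
have idH : 1 - phi l * (phi l0)^* -
    (1 - l.1 * (l0.1)^*) * (a l * (a l0)^* / Y%:C%C) =
    s%:C%C * ((a l0)^* * (1 - a l / Y%:C%C)) + ell l * a l * k0 :> R[i].
  have sE : ell l0 = s%:C%C :> R[i].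
    by rewrite /l0 /= -mulrA tt mulr1 /s rmorphB rmorph1.
  have b0 : (b l0)^* = s%:C%C * (a l0)^* :> R[i].
    rewrite (cara hl0) rmorphM /= sE; congr (_ * _).
    by apply: conj_Creal; apply/complex_realP; exists s.
  have -> : 1 - phi l * (phi l0)^* = b l + (b l0)^* - b l * (b l0)^* :> R[i].
    rewrite rmorphB rmorph1 rmorphM /= conjCK.
    exact: one_sub_mul_unimodular.
  have -> : 1 - l.1 * (l0.1)^* = s%:C%C + (1 - s%:C%C) * ell l :> R[i].
    rewrite /l0 /= rmorphM /= (_ : r%:C%C^* = r%:C%C); last first.
      by apply: conj_Creal; apply/complex_realP; exists r.
    by rewrite /s rmorphB rmorph1; ring.
  by rewrite b0 (cara hl) /k0; ring.
have h5 : s * (n (a l0) * n (1 - a l / Y%:C%C)) <= s * (eps / 4) + s * (eps / 4).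
  have -> : s * (n (a l0) * n (1 - a l / Y%:C%C)) =
      n (s%:C%C * ((a l0)^* * (1 - a l / Y%:C%C))).
    by rewrite rnormM rnorm_real gtr0_norm // rnormM rnorm_conj.
  have -> : s%:C%C * ((a l0)^* * (1 - a l / Y%:C%C)) =
      (1 - phi l * (phi l0)^* -
       (1 - l.1 * (l0.1)^*) * (a l * (a l0)^* / Y%:C%C)) - ell l * a l * k0 :> R[i].
    by rewrite idH addrK.
  apply: (le_trans (rnormB _ _)); apply: lerD => //.
  rewrite !rnormM -/e; move: ek; rewrite ler_pdivlMr // => ek.
  apply: le_trans ek; rewrite -mulrA ler_wpM2l ?(ltW e0') //.
  by apply: ler_pM; rewrite ?rnorm_ge0 // lerDl.
rewrite -mulrDr ler_pM2l // in h5.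
have -> : n (a l - Y%:C%C) = Y * n (1 - a l / Y%:C%C).
  rewrite rnormC -[in LHS](divfK YC (a l)) -{1}[Y%:C%C]mul1r -mulrBl rnormM.
  by rewrite rnorm_real gtr0_norm // mulrC.
have h6 : Y * n (1 - a l / Y%:C%C) <= 2 * n (a l0) * n (1 - a l / Y%:C%C).
  by rewrite ler_wpM2r ?rnorm_ge0.
apply: (le_trans h6); rewrite -mulrA.
apply: (le_trans (ler_wpM2l _ h5)) => //.
by rewrite le_eqVlt; apply/orP; left; apply/eqP; field.
Qed.
End Residual.

End Caratheodory.
End Kernel.

(** * Limits along ultrafilters and weak compactness *)

Section Limits.
Context {R : realType}.
Local Notation C := (Cplx R).
Local Notation n := (@rnorm R C).

Lemma gt0_real_complex (e : R[i]) : 0 < e -> exists2 d : R, 0 < d & e = d%:C%C.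
Proof.
move=> e0; have er : e = (complex.Re e)%:C%C by rewrite RRe_real // gtr0_real.
by exists (complex.Re e); rewrite // -ltcR -er.
Qed.

Lemma cvg_rnormP (V : normedModType R[i]) (T : Type) (F : set_system T)
    {FF : Filter F} (f : T -> V) (l : V) :
  f @ F --> l <-> forall e : R, 0 < e -> \forall x \near F, rnorm (l - f x) < e.
Proof.
split=> [/cvgrPdist_lt h e e0|h].
  have e0' : 0 < e%:C%C :> R[i] by rewrite ltcR.
  by apply: filterS (h _ e0') => x; rewrite ltr_rnorm.
apply/cvgrPdist_lt => _ /gt0_real_complex[d d0 ->].
by apply: filterS (h _ d0) => x; rewrite ltr_rnorm.
Qed.

Lemma nbhs_rnormP (V : normedModType R[i]) (x : V) (P : set V) :
  nbhs x P <-> exists2 e : R, 0 < e & forall y, rnorm (x - y) < e -> P y.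
Proof.
split=> [/nbhs_normP[e /gt0_real_complex[d d0 ->] h]|[e e0 h]].
  by exists d => // y; rewrite -ltr_rnorm; exact: h.
by apply/nbhs_normP; exists e%:C%C; rewrite /= ?ltcR // => y /=; rewrite ltr_rnorm; exact: h.
Qed.

Lemma closure_rnormP (V : normedModType R[i]) (S : set V) (x : V) :
  closure S x <-> forall e : R, 0 < e -> exists2 y, S y & rnorm (x - y) < e.
Proof.
split=> [h e e0|h B /nbhs_rnormP[e e0 he]].
  have [|y [Sy ye]] := h (fun y => rnorm (x - y) < e); last by exists y.
  by apply/nbhs_rnormP; exists e.
by have [y Sy ye] := h _ e0; exists y; split=> //; exact: he.
Qed.

Lemma ex_nat_gt (x : R) : exists N : nat, x < N%:R.
Proof.
exists (Num.bound `|x|); apply: le_lt_trans (ler_norm _) _.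
exact: archi_boundP.
Qed.

Lemma near_ex2 (T : Type) (F : set_system T) {PF : ProperFilter F} (P Q : T -> Prop) :
  (\forall x \near F, P x) -> (\forall x \near F, Q x) -> exists x, P x /\ Q x.
Proof. by move=> hP hQ; exact: filter_ex (filterI hP hQ). Qed.

Lemma near_ex3 (T : Type) (F : set_system T) {PF : ProperFilter F} (P Q S : T -> Prop) :
  (\forall x \near F, P x) -> (\forall x \near F, Q x) -> (\forall x \near F, S x) ->
  exists x, [/\ P x, Q x & S x].
Proof.
by move=> hP hQ hS; have [x [? [? ?]]] := near_ex2 hP (filterI hQ hS); exists x.
Qed.

Lemma eq_rnorm_lt (V : normedModType R[i]) (x y : V) :
  (forall e : R, 0 < e -> rnorm (x - y) <= e) -> x = y.
Proof.
move=> h; apply/eqP; rewrite -subr_eq0; apply/eqP/rnorm0_eq0/eqP.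
rewrite eq_le rnorm_ge0 andbT; apply/ler_addgt0Pl => e e0.
by rewrite addr0 h.
Qed.

Section Ultrafilter.
Variables (T : Type) (U : set_system T).
Hypothesis UU : UltraFilter U.

Lemma ultra_real_limit (f : T -> R) (K : R) : (forall t, `|f t| <= K) ->
  exists l : R, forall e : R, 0 < e -> \forall t \near U, `|l - f t| < e.
Proof.
move=> fK; have := @segment_compact R (- K) K.
move=> /(_ (f @ U) (fmap_proper_filter _ _)).
case=> [|l [_ hl]].
  by apply: (@filterS _ U _ setT); [move=> t _ /=; rewrite in_itv /= -ler_norml|exact: filterT].
exists l => e e0; have [//|hn] := in_ultra_setVsetC [set t | `|l - f t| < e] UU.
have nb : nbhs l [set y | `|l - y| < e].
  by apply/nbhs_normP; exists e.
have hn' : (f @ U) [set y | ~ `|l - y| < e] by exact: hn.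
by have [y []] := hl _ _ hn' nb.
Qed.

Lemma ultra_complex_limit (f : T -> C) (K : R) : (forall t, n (f t) <= K) ->
  exists l : C, forall e : R, 0 < e -> \forall t \near U, n (l - f t) < e.
Proof.
move=> fK.
have reK t : `|complex.Re (f t)| <= K.
  apply: le_trans (fK t); rewrite -ler_sqr ?nnegrE ?rnorm_ge0 //.
  by rewrite real_normK ?num_real // rnorm_sqr lerDl sqr_ge0.
have imK t : `|complex.Im (f t)| <= K.
  apply: le_trans (fK t); rewrite -ler_sqr ?nnegrE ?rnorm_ge0 //.
  by rewrite real_normK ?num_real // rnorm_sqr lerDr sqr_ge0.
have [a ha] := ultra_real_limit reK; have [b hb] := ultra_real_limit imK.
exists (Complex a b) => e e0; have e20 : 0 < e / 2 by rewrite divr_gt0.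
near=> t; apply: (le_lt_trans (rnorm_le_ReIm _)).
have -> : complex.Re ((Complex a b : C) - f t) = a - complex.Re (f t).
  by case: (f t).
have -> : complex.Im ((Complex a b : C) - f t) = b - complex.Im (f t).
  by case: (f t).
rewrite (splitr e); apply: ltrD.
  by near: t; exact: ha.
by near: t; exact: hb.
Unshelve. all: by end_near.
Qed.

End Ultrafilter.
End Limits.

Section Riesz.
Context {R : realType} {M : completeNormedModType R[i]}.
Variable ip : {dot M for Num.conj}.
Hypothesis ip_norm : forall v : M, `|v| ^+ 2 = ip v v.
Local Notation C := (Cplx R).
Local Notation n := (@rnorm R C).
Implicit Types (v w : M).

Lemma rnorm_sqrD v w :
  rnorm (v + w) ^+ 2 = rnorm v ^+ 2 + rnorm w ^+ 2 + 2 * complex.Re (ip v w).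
Proof.
have h (z : C) : (2 * complex.Re z)%:C%C = z + (z^* : R[i]).
  by rewrite rmorphM /= rmorph_nat; exact/esym/addcJ.
apply: complexI; rewrite -(ip_sqr ip_norm) !(ipDl, ipDr) !(ip_sqr ip_norm).
rewrite (ipC ip w v); have shuffle (a b z y : R[i]) : a + z + (y + b) = a + b + (z + y).
  by ring.
by rewrite shuffle -h -!(rmorphD (real_complex R)).
Qed.

(** A quadratic polynomial which is almost nonnegative has a small linear
    coefficient. *)
Lemma small_linear_coefficient (a b e : R) : 0 <= a ->
  (forall t : R, - e <= a * t ^+ 2 + 2 * b * t) -> b ^+ 2 <= e * a.
Proof.
rewrite le_eqVlt => /orP[/eqP<-|a0] h.
  rewrite mulr0; suff -> : b = 0 by rewrite expr0n.
  apply/eqP/negPn/negP => b0.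
  have := h (- (e + 1) / (2 * b)).
  rewrite mul0r add0r [leRHS]mulrC divfK ?mulf_neq0 //; lra.
have := h (- b / a).
have -> : a * (- b / a) ^+ 2 + 2 * b * (- b / a) = - (b ^+ 2 / a).
  by field; rewrite gt_eqF.
by rewrite lerN2 ler_pdivrMr.
Qed.

(** The representing vector minimizes [|v|^2 - 2 Re (L v)]; the parallelogram
    law makes minimizing sequences converge. The functional is antilinear to
    match the second argument of [ip]. *)
Lemma riesz_representation (L : M -> C) (K : R) :
    (forall v w, L (v + w) = L v + L w) ->
    (forall (a : R[i]) v, L (a *: v) = a^* * L v) ->
    (forall v, n (L v) <= K * rnorm v) ->
  exists v, forall w, L w = ip v w.
Proof.
move=> LD LZ LK; pose J v := rnorm v ^+ 2 - 2 * complex.Re (L v).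
have K0 v : complex.Re (L v) <= K * rnorm v by apply: le_trans (LK v); exact: Re_le_rnorm.
have Jge v : - K ^+ 2 <= J v.
  by rewrite /J; have := K0 v; have := sqr_ge0 (K - rnorm v); lra.
have Jinf : has_inf (range J).
  by split; [exists (J 0), 0|exists (- K ^+ 2) => _ [v _ <-]].
set d := inf (range J).
have Jd v : d <= J v by apply: ge_inf; [case: Jinf|exists v].
have JD v (t : R) w : J (v + t%:C%C *: w) =
    J v + rnorm w ^+ 2 * t ^+ 2 + 2 * complex.Re (ip v w - L w) * t.
  rewrite /J rnorm_sqrD rnormZ rnorm_real exprMn real_normK ?num_real // LD LZ ipZr.
  have -> : (t%:C%C)^* = t%:C%C :> R[i].
    by apply: conj_Creal; apply/complex_realP; exists t.
  have ReM (a : R) (z : C) : complex.Re (a%:C%C * z) = a * complex.Re z.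
    by case: z => x y /=; rewrite mul0r subr0.
  have ReD (y z : C) : complex.Re (y + z) = complex.Re y + complex.Re z.
    by case: y; case: z.
  have ReB (y z : C) : complex.Re (y - z) = complex.Re y - complex.Re z.
    by case: y; case: z.
  by rewrite ReD ReB !ReM; ring.
have approx (k : nat) : exists v, J v < d + k.+1%:R^-1.
  have [|_ [v _ <-] hv] := @inf_adherent _ (range J) (k.+1%:R^-1) _ Jinf.
    by rewrite invr_gt0.
  by exists v.
have [x hx] := choice approx.
(* Almost minimizers almost satisfy the equation that characterizes the
   representing vector. *)
have coef v w : complex.Re (ip v w - L w) ^+ 2 <= (J v - d) * rnorm w ^+ 2.
  apply: small_linear_coefficient; first exact: sqr_ge0.
  by move=> t; have := Jd (v + t%:C%C *: w); rewrite JD; lra.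
have parallelogram v w : rnorm (v - w) ^+ 2 <= 2 * (J v - d) + 2 * (J w - d).
  have e1 : v = w + 1%:C%C *: (v - w) by rewrite scale1r addrC subrK.
  have e2 : J (w + (2^-1)%:C%C *: (v - w)) >= d by [].
  have e3 : J v = J w + rnorm (v - w) ^+ 2 + 2 * complex.Re (ip w (v - w) - L (v - w)).
    by rewrite {1}e1 JD expr1n !mulr1.
  by move: e2; rewrite JD; lra.
have xc : cvg (x @ \oo).
  apply/cauchy_cvgP/cauchy_exP => e /gt0_real_complex[b b0 ->].
  have [N hN] : exists N : nat, 4 / b ^+ 2 < N%:R.
    exact: ex_nat_gt.
  exists (x N); exists N => // m /= Nm; rewrite -ball_normE /= ltr_rnorm.
  rewrite -ltr_sqr ?nnegrE ?rnorm_ge0 ?(ltW b0) //.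
  apply: (le_lt_trans (parallelogram _ _)).
  have hm : m.+1%:R^-1 <= N.+1%:R^-1 :> R.
    by rewrite lef_pV2 ?posrE // ler_nat ltnS.
  have h4 : 4 * N.+1%:R^-1 < b ^+ 2.
    rewrite ltr_pdivrMr // mulrC -ltr_pdivrMr ?exprn_gt0 //.
    by apply: (lt_trans hN); rewrite ltr_nat.
  move: hm h4 (hx N) (hx m); move: (J (x N)) (J (x m)) (m.+1%:R^-1) (N.+1%:R^-1).
  by move=> ? ? ? ?; lra.
exists (lim (x @ \oo)) => w; set v := lim _.
have Re0 u : complex.Re (ip v u - L u) = 0.
  apply/eqP; rewrite -normr_eq0 eq_le normr_ge0 andbT; apply/ler_addgt0Pl => e e0; rewrite addr0.
  have hb : 0 < e / (2 * (rnorm u + 1)).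
    by rewrite divr_gt0 // mulr_gt0 // ltr_wpDl // rnorm_ge0.
  have h1 : \forall k \near \oo, rnorm (v - x k) < e / (2 * (rnorm u + 1)).
    exact: (cvg_rnormP x v).1 xc _ hb.
  have [N hN] : exists N : nat, (2 * (rnorm u + 1) / e) ^+ 2 < N%:R.
    exact: ex_nat_gt.
  have [k [hk Nk]] := near_ex2 h1 (nbhs_infty_ge N).
  have -> : ip v u - L u = ip (v - x k) u + (ip (x k) u - L u).
    by rewrite ipBl; ring.
  have ReD (y z : C) : complex.Re (y + z) = complex.Re y + complex.Re z.
    by case: y; case: z.
  have u1 : 0 < rnorm u + 1 by rewrite ltr_wpDl // rnorm_ge0.
  have ru : rnorm u <= rnorm u + 1 by rewrite lerDl.
  rewrite ReD (splitr e); apply: (le_trans (ler_normD _ _)); apply: lerD.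
    have hRe (z : C) : `|complex.Re z| <= n z.
      rewrite -ler_sqr ?nnegrE ?rnorm_ge0 // real_normK ?num_real //.
      by rewrite rnorm_sqr lerDl sqr_ge0.
    apply: (le_trans (hRe _)); apply: (le_trans (cauchy_schwarz ip_norm _ _)).
    have -> : e / 2 = e / (2 * (rnorm u + 1)) * (rnorm u + 1).
      by field; rewrite gt_eqF.
    by apply: ler_pM => //; rewrite ?rnorm_ge0 // ltW.
  rewrite -ler_sqr ?nnegrE ?divr_ge0 ?(ltW e0) // real_normK ?num_real //.
  apply: (le_trans (coef _ _)).
  have hk1 : J (x k) - d <= k.+1%:R^-1 by rewrite lerBlDl ltW.
  apply: (@le_trans _ _ (k.+1%:R^-1 * (rnorm u + 1) ^+ 2)).
    apply: ler_pM => //; rewrite ?subr_ge0 ?sqr_ge0 //.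
    by rewrite ler_sqr ?nnegrE ?rnorm_ge0 // ltW.
  rewrite mulrC ler_pdivrMr // mulrC -ler_pdivrMr ?exprn_gt0 ?divr_gt0 //.
  have -> : (rnorm u + 1) ^+ 2 / (e / 2) ^+ 2 = (2 * (rnorm u + 1) / e) ^+ 2.
    by field; rewrite gt_eqF.
  by apply: (le_trans (ltW hN)); rewrite ler_nat (leq_trans Nk).
apply/eqP; rewrite eq_sym -subr_eq0; apply/eqP.
have Im0 : complex.Im (ip v w - L w) = 0.
  have := Re0 ('i *: w); rewrite ipZr LZ -mulrBr.
  rewrite (_ : ('i : R[i])^* = - 'i) ?conjCi //.
  by case: (ip v w - L w) => a b; rewrite -complexiE /=; lra.
by move: (Re0 w) Im0; case: (ip v w - L w) => a b /= -> ->.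
Qed.

(** Bounded sequences have weakly convergent subsequences: the limits along an
    ultrafilter form a bounded antilinear functional, hence a vector, and
    separability allows to extract a subsequence. *)
Lemma weak_sequential_compactness (x : nat -> M) (K : R) :
    (exists2 A : set M, countable A & dense A) -> (forall k, rnorm (x k) <= K) ->
  exists k : nat -> nat, (forall m, (m <= k m)%N) /\
    exists v, weakly_cvg ip (fun m => x (k m)) v.
Proof.
move=> [A cA dA] xK.
have [U [UU sU]] := ultraFilterLemma (@eventually_filter).
have lim_ex w : exists l : C, forall e : R, 0 < e ->
    \forall m \near U, n (l - ip (x m) w) < e.
  apply: (@ultra_complex_limit _ _ _ _ (fun m => ip (x m) w) (K * rnorm w)) => m.
  apply: (le_trans (cauchy_schwarz ip_norm _ _)).
  by rewrite ler_wpM2r ?rnorm_ge0.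
have [L hL] := choice lim_ex.
have LD v w : L (v + w) = L v + L w.
  apply: (@eq_rnorm_lt _ C) => e e0; have e3 : 0 < e / 3 by rewrite divr_gt0.
  have [m [h1 h2 h3]] := near_ex3 (hL (v + w) _ e3) (hL v _ e3) (hL w _ e3).
  have -> : L (v + w) - (L v + L w) = (L (v + w) - ip (x m) (v + w)) -
      (L v - ip (x m) v) - (L w - ip (x m) w) :> C by rewrite ipDr; ring.
  apply: (le_trans (rnormB _ _)).
  have := rnormB (L (v + w) - ip (x m) (v + w) : C) (L v - ip (x m) v).
  lra.
have LZ (a : R[i]) v : L (a *: v) = a^* * L v.
  apply: (@eq_rnorm_lt _ C) => e e0.
  have a1 : 0 < n a + 1 by rewrite ltr_wpDl ?rnorm_ge0.
  have e2 : 0 < e / 2 by rewrite divr_gt0.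
  have e3 : 0 < e / 2 / (n a + 1) by rewrite divr_gt0.
  have [m [h1 h2]] := near_ex2 (hL (a *: v) _ e2) (hL v _ e3).
  have -> : L (a *: v) - a^* * L v = (L (a *: v) - ip (x m) (a *: v)) -
      a^* * (L v - ip (x m) v) :> C by rewrite ipZr; ring.
  apply: (le_trans (rnormB _ _)); rewrite (splitr e); apply: lerD; first exact: ltW.
  rewrite rnormM rnorm_conj; move: h2; rewrite ltr_pdivlMr // => /ltW; apply: le_trans.
  by rewrite mulrC ler_wpM2l ?rnorm_ge0 // lerDl.
have LK v : n (L v) <= K * rnorm v.
  apply/ler_addgt0Pl => e e0; have [m [hm _]] := near_ex2 (hL v _ e0) (hL v _ e0).
  have := cauchy_schwarz ip_norm (x m) v.
  have : rnorm (x m) * rnorm v <= K * rnorm v by rewrite ler_wpM2r ?rnorm_ge0.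
  have := rnormBB (L v) (ip (x m) v : C); lra.
have [v hv] := riesz_representation LD LZ LK.
have [g gI] := countable_injP _ cA.
(* [g] enumerates the dense set; only finitely many of its elements have an
   index below [j], so the ultrafilter handles them simultaneously. *)
have finite_cond (j : nat) (e : R) : 0 < e ->
    \forall m \near U, forall w, A w -> (g w < j)%N -> n (ip v w - ip (x m) w) < e.
  move=> e0; elim: j => [|j IH]; first by apply: filterE.
  have [[w0 [Aw0 gw0]]|none] := pselect (exists w, A w /\ g w = j).
    have := hL w0 _ e0; rewrite hv => h0.
    apply: filterS (filterI IH h0) => m [h1 h2] w Aw; rewrite ltnS leq_eqVlt.
    move=> /orP[/eqP gw|]; last exact: h1.
    by rewrite (gI w w0) ?inE // gw0.
  apply: filterS IH => m h1 w Aw; rewrite ltnS leq_eqVlt => /orP[/eqP gw|].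
    by case: none; exists w.
  exact: h1.
have pick (m : nat) : exists k : nat, (m <= k)%N /\
    forall w, A w -> (g w < m)%N -> n (ip v w - ip (x k) w) < m.+1%:R^-1.
  have m0 : 0 < m.+1%:R^-1 :> R by rewrite invr_gt0.
  have h1 : \forall k \near U, (m <= k)%N by apply: sU; exact: nbhs_infty_ge.
  exact: near_ex2 h1 (finite_cond m _ m0).
have [k hk] := choice pick.
exists k; split; first by move=> m; case: (hk m).
exists v => w; apply/cvg_rnormP => e e0.
have K0 : 0 <= K by apply: le_trans (xK 0%N); exact: rnorm_ge0.
pose B := rnorm v + K + 1; have B0 : 0 < B.
  by rewrite /B ltr_wpDl // addr_ge0 ?rnorm_ge0.
have eB : 0 < e / 2 / B by rewrite !divr_gt0.
have [a [wa Aa]] : ball w (e / 2 / B)%:C%C `&` A !=set0.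
  have wb : nbhs w (ball w (e / 2 / B)%:C%C) by apply: nbhsx_ballx; rewrite ltcR.
  have [a [Aa hwa]] : [set a | (ball w (e / 2 / B)%:C%C)^° a] `&` A !=set0.
    by apply: dA; [exists w|exact: open_interior].
  by exists a; split => //; apply: interior_subset.
rewrite -ball_normE /= ltr_rnorm in wa.
have [N hN] := ex_nat_gt (2 / e).
near=> m.
have -> : ip v w - ip (x (k m)) w =
    ip (v - x (k m)) (w - a) + (ip v a - ip (x (k m)) a) :> C.
  by rewrite !(ipBl, ipBr); ring.
apply: (le_lt_trans (rnormD _ _)); rewrite (splitr e); apply: ltr_leD.
  apply: (le_lt_trans (cauchy_schwarz ip_norm _ _)).
  move: wa; rewrite ltr_pdivlMr // => wa; apply: le_lt_trans wa; rewrite mulrC.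
  rewrite ler_wpM2l ?rnorm_ge0 //; apply: (le_trans (rnormB _ _)).
  by rewrite /B -addrA lerD2l (le_trans (xK _)) // lerDl.
have [_ hm] := hk m.
have gm : (g a < m)%N by near: m; exact: nbhs_infty_gt.
apply: (le_trans (ltW (hm a Aa gm))).
have Nm : (N <= m)%N by near: m; exact: nbhs_infty_ge.
rewrite -[leRHS]invrK lef_pV2 ?posrE ?invr_gt0 ?divr_gt0 // invf_div.
by apply: (le_trans (ltW hN)); rewrite ler_nat (leq_trans Nm).
Unshelve. all: by end_near.
Qed.

End Riesz.

(** * Nontangential limits, B-points and orthogonal projections *)

Section Boundary.
Context {R : realType}.
Local Notation C := (Cplx R).
Local Notation n := (@rnorm R C).
Implicit Types (tau l : C * C).

Lemma cvg_conj (T : Type) (F : set_system T) {FF : Filter F} (f : T -> C) (z : C) :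
  f @ F --> z -> ((f t)^* : C) @[t --> F] --> (z^* : C).
Proof.
move=> /cvg_rnormP h; apply/cvg_rnormP => e e0.
apply: filterS (h e e0) => t.
by rewrite -(rnorm_conj (z - f t)) rmorphB.
Qed.

Lemma cvg_pairP (T : Type) (F : set_system T) {FF : Filter F} (f : T -> C * C) l :
  f @ F --> l <->
  ((f t).1 : C) @[t --> F] --> l.1 /\ ((f t).2 : C) @[t --> F] --> l.2.
Proof.
split=> [/cvg_rnormP h|[/cvg_rnormP h1 /cvg_rnormP h2]].
  by split; apply/cvg_rnormP => e e0; apply: filterS (h e e0) => t;
    rewrite [l - f t]surjective_pairing rnorm_pair gt_max => /andP[].
apply/cvg_rnormP => e e0; apply: filterS (filterI (h1 e e0) (h2 e e0)) => t [H1 H2].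
by rewrite [l - f t]surjective_pairing rnorm_pair gt_max H1 H2.
Qed.

Lemma cvg_rnorm (V : normedModType R[i]) (T : Type) (F : set_system T)
    {FF : Filter F} (f : T -> V) (v : V) :
  f @ F --> v -> rnorm (f t) @[t --> F] --> rnorm v.
Proof.
move=> /cvg_rnormP h; apply/cvgrPdist_lt => e e0; apply: filterS (h e e0) => t.
apply: le_lt_trans; rewrite ler_norml rnormBB andbT lerNl opprB rnormC.
exact: rnormBB.
Qed.

Lemma rnorm_ge_fst l : n l.1 <= rnorm l.
Proof. by case: l => a b; rewrite rnorm_pair le_max lexx. Qed.

(** The radius is a nontangential region; without one, every vector would be a
    nontangential limit. *)
Lemma nt_limit_radial tau : rnorm tau = 1 ->
  approaches_nt [set v | exists2 t : R, 0 < t < 1 & v = (1 - t)%:C%C *: tau] tau.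
Proof.
move=> tau1.
have nt (t : R) : t < 1 -> rnorm ((1 - t)%:C%C *: tau) = 1 - t.
  by move=> t1; rewrite rnormZ tau1 mulr1 rnorm_real gtr0_norm // subr_gt0.
have nd (t : R) : 0 < t -> rnorm (tau - (1 - t)%:C%C *: tau) = t.
  move=> t0; rewrite -{1}[tau]scale1r -scalerBl rnormZ tau1 mulr1.
  by rewrite -(rmorph1 (real_complex R)) -rmorphB rnorm_real opprB addrCA subrr addr0 gtr0_norm.
split.
- by move=> _ [t /andP[t0 t1] ->]; apply/unit_ballE; rewrite nt //; lra.
- apply/closure_rnormP => e e0; pose t := Num.min (e / 2) 2^-1.
  have t0 : 0 < t by rewrite lt_min divr_gt0 //= invr_gt0.
  have [te t1] : t <= e / 2 /\ t <= 2^-1 by split; rewrite ge_min lexx ?orbT.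
  exists ((1 - t)%:C%C *: tau); first by exists t => //; rewrite t0 /=; lra.
  by rewrite nd //; lra.
- exists 1 => // _ [t /andP[t0 t1] ->].
  by rewrite nt // nd // mul1r opprB addrCA subrr addr0.
Qed.

Lemma nt_limit_unique (W : normedModType R[i]) (f : C * C -> W) tau (a b : W) :
  rnorm tau = 1 -> nt_limit f tau a -> nt_limit f tau b -> a = b.
Proof.
move=> tau1 ha hb; have S := nt_limit_radial tau1; have [_ hS _] := S.
have FF := within_nbhs_proper hS.
exact: (cvg_unique (@norm_hausdorff _ W) (ha _ S) (hb _ S)).
Qed.

Section Phi.
Variable phi : C * C -> C.

Lemma julia_quotient_le l (K : R) : rnorm l < 1 ->
  (julia_quotient phi l <= K) = (1 - n (phi l) <= K * (1 - rnorm l)).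
Proof. by move=> l1; rewrite /julia_quotient ler_pdivrMr // subr_gt0. Qed.

Lemma B_point_of_sequence tau (l : nat -> C * C) (K : R) : rnorm tau = 1 ->
  (forall k, unit_ball (l k)) -> l k @[k --> \oo] --> tau ->
  (forall k, julia_quotient phi (l k) <= K) -> B_point phi tau.
Proof.
move=> tau1 lb lt lK; split.
  split.
    apply/closure_rnormP => e e0.
    have h : \forall k \near \oo, rnorm (tau - l k) < e.
      exact: (cvg_rnormP _ _).1 lt e e0.
    by have [k [hk _]] := near_ex2 h h; exists (l k).
  by move=> /interior_subset/unit_ballE; rewrite tau1 ltxx.
apply: (@le_lt_trans _ _ K%:E); last exact: ltry.
rewrite limf_einfE; apply: ge_ereal_sup => _ [V hV <-].
have hV' : \forall k \near \oo, V (l k).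
  have h : \forall k \near \oo, unit_ball (l k) -> V (l k) by exact: lt _ hV.
  by apply: filterS h => k /(_ (lb k)).
have [k [hk _]] := near_ex2 hV' hV'.
apply: (@le_trans _ _ (julia_quotient phi (l k))%:E); last by rewrite lee_fin.
by apply: ereal_inf_lbound; exists (l k).
Qed.

End Phi.
End Boundary.

Section Projections.
Context {R : realType} {M : completeNormedModType R[i]}.
Variable ip : {dot M for Num.conj}.
Hypothesis ip_norm : forall v : M, `|v| ^+ 2 = ip v v.
Local Notation C := (Cplx R).
Local Notation n := (@rnorm R C).
Implicit Types (v w : M).

Lemma orthogonal_decomposition_sym (M1 M2 : set M) :
  orthogonal_decomposition ip M1 M2 -> orthogonal_decomposition ip M2 M1.
Proof.
case=> c1 c2 orth dec; split=> // [v w hv hw|v].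
  by rewrite ipC orth ?rmorph0.
by have [v1 [v2 [h1 h2 ->]]] := dec v; exists v2, v1; split; rewrite // addrC.
Qed.

Lemma oproj_spec (M1 M2 : set M) v : orthogonal_decomposition ip M1 M2 ->
  M1 (oproj ip M1 v) /\ forall x, M1 x -> ip (v - oproj ip M1 v) x = 0.
Proof.
case=> c1 c2 orth dec; have [v1 [v2 [h1 h2 ->]]] := dec v.
apply: (@xgetPex _ 0 [set w | M1 w /\ forall x, M1 x -> ip (v1 + v2 - w) x = 0]).
exists v1; split=> // x hx; rewrite addrAC subrr add0r ipC orth ?rmorph0 //.
Qed.

Lemma closed_subspaceB (N : set M) v w : closed_subspace N -> N v -> N w -> N (v - w).
Proof. by case=> _ h _ hv hw; rewrite addrC -scaleN1r; exact: h. Qed.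

Lemma oproj_eq (M1 M2 : set M) v w : orthogonal_decomposition ip M1 M2 ->
  M1 w -> (forall x, M1 x -> ip (v - w) x = 0) -> oproj ip M1 v = w.
Proof.
move=> dec hw hvw; have [hp hvp] := oproj_spec v dec; have [c1 _ _ _] := dec.
have d := closed_subspaceB c1 hp hw.
apply/eqP; rewrite -subr_eq0; apply/eqP/rnorm0_eq0/eqP.
rewrite -sqrf_eq0; apply/eqP/complexI; rewrite -(ip_sqr ip_norm).
have {1}-> : oproj ip M1 v - w = (v - w) - (v - oproj ip M1 v).
  by rewrite opprB [RHS]addrC addrA subrK.
by rewrite ipBl hvw // hvp // subrr.
Qed.

Lemma oprojD (M1 M2 : set M) v : orthogonal_decomposition ip M1 M2 ->
  oproj ip M1 v + oproj ip M2 v = v.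
Proof.
move=> dec; have dec' := orthogonal_decomposition_sym dec.
have [_ _ orth ex] := dec; have [v1 [v2 [h1 h2 e]]] := ex v.
rewrite (@oproj_eq M1 M2 v v1 dec h1) => [|x hx].
  rewrite (@oproj_eq M2 M1 v v2 dec' h2) // => x hx.
  by rewrite e addrK orth.
by rewrite e addrAC subrr add0r ipC orth ?rmorph0.
Qed.

Lemma ip_oproj (M1 M2 : set M) v w : orthogonal_decomposition ip M1 M2 ->
  ip (oproj ip M1 v) (oproj ip M1 w) = ip (oproj ip M1 v) w.
Proof.
move=> dec; have [h1 _] := oproj_spec v dec; have [_ h] := oproj_spec w dec.
apply/esym/eqP; rewrite -subr_eq0 -ipBr ipC.
by rewrite h // rmorph0.
Qed.

Lemma rnorm_oproj (M1 M2 : set M) v : orthogonal_decomposition ip M1 M2 ->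
  rnorm v ^+ 2 = rnorm (oproj ip M1 v) ^+ 2 + rnorm (oproj ip M2 v) ^+ 2.
Proof.
move=> dec; have [_ _ orth _] := dec; have dec' := orthogonal_decomposition_sym dec.
rewrite -{1}(oprojD v dec) (rnorm_sqrD ip_norm) orth ?mulr0 ?addr0 //.
  by case: (oproj_spec v dec).
by case: (oproj_spec v dec').
Qed.

(** Semicontinuity of the norm under weak limits: the inner product with the
    projected limit itself recovers its squared norm. *)
Lemma weak_limit_oproj (M1 M2 : set M) (x : nat -> M) v (B : R) :
    orthogonal_decomposition ip M1 M2 -> weakly_cvg ip x v -> 0 <= B ->
    (forall e : R, 0 < e -> \forall k \near \oo, rnorm (oproj ip M1 (x k)) <= B + e) ->
  rnorm (oproj ip M1 v) <= B.
Proof.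
move=> dec xv B0 xB; set w := oproj ip M1 v.
have [->|w0] := eqVneq (rnorm w) 0; first by [].
have {}w0 : 0 < rnorm w by rewrite lt_def w0 rnorm_ge0.
rewrite -(ler_pM2l w0); apply/ler_addgt0Pl => e e0.
have w1 : 0 < 1 + rnorm w by rewrite addr_gt0.
have e1 : 0 < e / (1 + rnorm w) by rewrite divr_gt0.
have h1 : \forall k \near \oo, n (ip v w - ip (x k) w) < e / (1 + rnorm w).
  exact: (cvg_rnormP _ _).1 (xv w) _ e1.
have [k [hk1 hk2]] := near_ex2 h1 (xB _ e1).
have vw : ip v w = (rnorm w ^+ 2)%:C%C.
  rewrite ipC -(ip_oproj v v dec) -/w (ip_sqr ip_norm).
  by apply: conj_Creal; apply/complex_realP; exists (rnorm w ^+ 2).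
have xw : ip (x k) w = ip (oproj ip M1 (x k)) w.
  by rewrite ipC -(ip_oproj v (x k) dec) -ipC.
have h : rnorm w ^+ 2 <= e / (1 + rnorm w) + (B + e / (1 + rnorm w)) * rnorm w.
  rewrite -[leLHS]ger0_norm ?sqr_ge0 // -(rnorm_real (rnorm w ^+ 2)) -vw.
  rewrite -(subrK (ip (x k) w) (ip v w)); apply: (le_trans (rnormD _ _)).
  apply: lerD; first exact: ltW.
  rewrite xw; apply: (le_trans (cauchy_schwarz ip_norm _ _)).
  by rewrite ler_wpM2r // ltW.
rewrite -expr2 (le_trans h) //.
have -> : e / (1 + rnorm w) + (B + e / (1 + rnorm w)) * rnorm w =
   e / (1 + rnorm w) * (1 + rnorm w) + rnorm w * B by ring.
by rewrite divfK // gt_eqF.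
Qed.

End Projections.

(** * Exchange of the two coordinates *)

Local Opaque rnorm unit_ball.

Section Swap.
Context {R : realType}.
Local Notation C := (Cplx R).
Local Notation n := (@rnorm R C).
Implicit Types (tau l : C * C).

Definition swap l : C * C := (l.2, l.1).

Lemma rnorm_swap l : rnorm (swap l) = rnorm l.
Proof. by rewrite [in RHS](surjective_pairing l) !rnorm_pair maxC. Qed.

Lemma swap_unit_ball l : unit_ball (swap l) <-> unit_ball l.
Proof. by rewrite !unit_ballE rnorm_swap. Qed.

Lemma swapK l : swap (swap l) = l.
Proof. by rewrite /swap -surjective_pairing. Qed.

Lemma swapB l l' : swap (l - l') = swap l - swap l'.
Proof. by []. Qed.

Lemma nbhs_swap tau (P : set (C * C)) : nbhs tau P -> nbhs (swap tau) (P \o swap).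
Proof.
move=> /nbhs_rnormP[e e0 h]; apply/nbhs_rnormP; exists e; first exact: e0.
move=> l hl; apply: h; move: hl.
by rewrite -(rnorm_swap (swap tau - l)) swapB swapK.
Qed.

Lemma approaches_nt_swap (S : set (C * C)) tau :
  approaches_nt S tau -> approaches_nt (S \o swap) (swap tau).
Proof.
case=> [Sb Scl [c c0 Sc]]; split.
- by move=> l /Sb/swap_unit_ball.
- apply/closure_rnormP => e e0; have [l Sl le] := (closure_rnormP _ _).1 Scl e e0.
  exists (swap l); first by rewrite /= swapK.
  by rewrite -swapB rnorm_swap.
- exists c; first exact: c0.
  move=> l Sl; have := Sc _ Sl.
  by rewrite -(rnorm_swap (tau - _)) swapB swapK rnorm_swap.
Qed.

Lemma nt_limit_swap (W : normedModType R[i]) (f : C * C -> W) tau (w : W) :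
  nt_limit f tau w -> nt_limit (f \o swap) (swap tau) w.
Proof.
move=> h S hS A hA; have := approaches_nt_swap hS; rewrite swapK => hS'.
have hn := nbhs_swap (h _ hS' A hA).
apply: filterS hn => l hl Sl; apply: hl.
by rewrite /= swapK.
Qed.

Lemma julia_quotient_swap (phi : C * C -> C) l :
  julia_quotient (phi \o swap) l = julia_quotient phi (swap l).
Proof. by rewrite /julia_quotient rnorm_swap. Qed.

Lemma bidisk_boundary_swap tau : bidisk_boundary tau -> bidisk_boundary (swap tau).
Proof.
case=> Scl nint; split.
  apply/closure_rnormP => e e0; have [l Sl le] := (closure_rnormP _ _).1 Scl e e0.
  by exists (swap l); [apply/swap_unit_ball|rewrite -swapB rnorm_swap].
move=> /nbhs_swap hn; apply: nint; rewrite swapK in hn.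
by apply: filterS hn => l /swap_unit_ball.
Qed.

Lemma B_point_swap (phi : C * C -> C) tau :
  B_point phi tau -> B_point (phi \o swap) (swap tau).
Proof.
case=> bd liminf; split; first exact: bidisk_boundary_swap.
apply: le_lt_trans liminf; rewrite !limf_einfE; apply: le_ereal_sup => _ [V hV <-].
exists (V \o swap).
  have := nbhs_swap hV; rewrite swapK => hn.
  by apply: filterS hn => l /= h /swap_unit_ball.
congr ereal_inf; apply/seteqP; split=> [_ [l Vl <-]|_ [l Vl <-]].
  exists (swap l); [exact: Vl|by rewrite julia_quotient_swap swapK].
exists (swap l); [by rewrite /= swapK|by rewrite julia_quotient_swap].
Qed.

Lemma is_dirderiv_swap (phi : C * C -> C) tau delta (d : C) :
  is_dirderiv phi tau delta d -> is_dirderiv (phi \o swap) (swap tau) (swap delta) d.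
Proof.
by case=> l nl cv; exists l; [exact: nt_limit_swap|exact: cv].
Qed.

End Swap.

(** * Vectors representing a value on a face *)

Local Opaque julia_quotient.

Section Face.
Context {R : realType} {M : completeNormedModType R[i]}.
Variables (ip : {dot M for Num.conj}) (M1 M2 : set M).
Local Notation C := (Cplx R).
Local Notation n := (@rnorm R C).
Variables (u : C * C -> M) (phi : C * C -> C).
Hypothesis hilbert : separable_hilbert ip.
Hypothesis dec : orthogonal_decomposition ip M1 M2.
Hypothesis phi_disk : forall l, unit_ball l -> unit_ball (phi l).
Local Notation p l := (oproj ip M1 (u l)).
Local Notation q l := (oproj ip M2 (u l)).
Hypothesis model : forall l m : C * C, unit_ball l -> unit_ball m ->
  1 - phi l * (phi m)^* =
    (1 - l.1 * (m.1)^*) * ip (p l) (p m) +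
    (1 - l.2 * (m.2)^*) * ip (q l) (q m) :> R[i].

Let ip_norm : forall v : M, `|v| ^+ 2 = ip v v := hilbert.1.
Let dec' := orthogonal_decomposition_sym dec.

(** The model identity with its second argument moved to the face over [tau]: the
    second summand has disappeared, and [x] plays the role of the first component
    of [u] at the boundary. *)
Definition represents (tau omega : C) (x : M) : Prop :=
  forall l : C * C, unit_ball l ->
  1 - phi l * (omega : R[i])^* = (1 - l.1 * (tau : R[i])^*) * ip (p l) x :> R[i].

Lemma cvg_subsequence (T : topologicalType) (f : nat -> T) (a : T) (k : nat -> nat) :
  (forall m, (m <= k m)%N) -> f @ \oo --> a -> f (k m) @[m --> \oo] --> a.
Proof.
move=> hk fa; apply: cvg_comp fa; apply/cvgnyPge => N.
exists N => // m /= Nm; exact: leq_trans (hk m).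
Qed.

(** The model identity between a fixed point and [l t] passes to the limit,
    because its terms are inner products with [u (l t)]; the second summand
    vanishes with the second component of [v]. *)
Lemma weak_limit_represents (T : Type) (F : set_system T) {PF : ProperFilter F}
    (l : T -> C * C) (tau : C * C) (omega : C) (v : M) :
    (forall t, unit_ball (l t)) -> l @ F --> tau -> phi (l t) @[t --> F] --> omega ->
    (forall w : M, (ip (u (l t)) w : C) @[t --> F] --> (ip v w : C)) ->
    oproj ip M2 v = 0 ->
  represents tau.1 omega (oproj ip M1 v).
Proof.
move=> lb /cvg_pairP[lt1 lt2] lo lv v2 m hm.
have weakr (N N' : set M) : orthogonal_decomposition ip N N' ->
    (ip (oproj ip N (u m)) (oproj ip N (u (l t))) : C) @[t --> F] -->
    (ip (oproj ip N (u m)) (oproj ip N v) : C).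
  move=> d; rewrite (ip_oproj _ v d) ipC.
  under eq_fun do rewrite (ip_oproj _ _ d) ipC.
  by apply: cvg_conj; exact: lv.
have c1 : (1 - phi m * (phi (l t))^* : C) @[t --> F] --> (1 - phi m * (omega^* : R[i]) : C).
  by apply: cvgB; [exact: cvg_cst|apply: cvgM; [exact: cvg_cst|exact: cvg_conj]].
have ck (z s : C) (f : T -> C) : f @ F --> s ->
    (1 - z * (f t)^* : C) @[t --> F] --> (1 - z * (s : R[i])^* : C).
  by move=> fs; apply: cvgB; [exact: cvg_cst|apply: cvgM; [exact: cvg_cst|exact: cvg_conj]].
have c2 : (1 - phi m * (phi (l t))^* : C) @[t --> F] -->
    ((1 - m.1 * (tau.1 : R[i])^*) * ip (p m) (oproj ip M1 v) : C).
  rewrite (_ : (fun t => 1 - phi m * (phi (l t))^* : C) =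
    (fun t => (1 - m.1 * ((l t).1)^*) * ip (p m) (p (l t)) +
    (1 - m.2 * ((l t).2)^*) * ip (q m) (q (l t)) : C)); last first.
    by apply/funext => t; exact: (model hm (lb t)).
  rewrite -[X in _ --> X]addr0 -(mulr0 (1 - m.2 * (tau.2 : R[i])^*)).
  rewrite -(ip0r ip (q m)) -v2; apply: cvgD; apply: cvgM; first exact: ck.
  - exact: weakr dec.
  - exact: ck.
  - exact: weakr dec'.
exact: (cvg_unique (@norm_hausdorff _ C) c1 c2).
Qed.

(** A represented value is a nontangential limit, because the component [p]
    stays bounded on nontangential approach regions. *)
Lemma represents_nt_limit (tau s omega : C) (x : M) :
  n tau = 1 -> n omega = 1 -> represents tau omega x ->
  nt_limit phi (tau, s) omega.
Proof.
move=> tau1 om1 hx S [Sb Scl [c c0 Sc]].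
have FF := within_nbhs_proper Scl.
(* A rotation of the values moves [omega] to [tau]. *)
have [phi' phi'E] : exists f : C * C -> C,
    forall l, f l = phi l * ((omega : R[i])^* * tau).
  by exists (fun l => phi l * ((omega : R[i])^* * tau)).
have tt : tau * (tau : R[i])^* = 1 by rewrite mul_conjE tau1 expr1n.
have oo : omega * (omega : R[i])^* = 1 by rewrite mul_conjE om1 expr1n.
have e' l : phi' l * (tau : R[i])^* = phi l * (omega : R[i])^* :> R[i].
  by rewrite phi'E -!mulrA tt mulr1.
have model' (l m : C * C) : unit_ball l -> unit_ball m ->
    1 - phi' l * (phi' m)^* =
    (1 - l.1 * (m.1)^*) * ip (p l) (p m) +
    (1 - l.2 * (m.2)^*) * ip (q l) (q m) :> R[i].
  move=> hl hm; rewrite -model // !phi'E !rmorphM /= conjCK.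
  have -> : phi l * (omega^* * tau) * ((phi m)^* * (omega * tau^*)) =
    phi l * (phi m)^* * (omega * omega^*) * (tau * tau^*) :> R[i] by ring.
  by rewrite tt oo !mulr1.
have disk' l : unit_ball l -> unit_ball (phi' l).
  move=> /phi_disk; rewrite !unit_ballE phi'E !rnormM rnorm_conj om1 tau1.
  by rewrite !mulr1.
have cara' (l : C * C) : unit_ball l ->
    1 - phi' l * (tau : R[i])^* = (1 - l.1 * (tau : R[i])^*) * ip (p l) x :> R[i].
  by move=> hl; rewrite e'; exact: hx.
have bound l : S l -> n (omega - phi l) <= rnorm ((tau, s) - l) * (2 * c * rnorm x ^+ 2).
  move=> Sl; have hl := Sb _ Sl.
  have ell : n (1 - l.1 * (tau : R[i])^*) <= rnorm ((tau, s) - l).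
    by rewrite rnorm_1Bconj //; exact: (rnorm_ge_fst ((tau, s) - l)).
  have hc : n (1 - l.1 * (tau : R[i])^*) <= c * (1 - n l.1).
    apply: (le_trans ell); apply: (le_trans (Sc _ Sl)).
    by rewrite (ler_pM2l c0) lerD2l lerN2; exact: rnorm_ge_fst.
  have := nontangential_value_bound ip_norm disk' model' tau1 cara' hl hc.
  rewrite e' rnorm_1Bconj // => h; apply: (le_trans h).
  apply: ler_wpM2r ell; apply: mulr_ge0 (sqr_ge0 _).
  by rewrite mulr_ge0 // ltW.
apply/cvg_rnormP => e e0.
pose K := 2 * c * rnorm x ^+ 2 + 1.
have K0 : 0 < K.
  by rewrite ltr_wpDl //; apply: mulr_ge0 (sqr_ge0 _); rewrite mulr_ge0 // ltW.
have near_tau : \forall l \near nbhs (tau, s), rnorm ((tau, s) - l) < e / K.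
  by apply/nbhs_rnormP; exists (e / K); rewrite ?divr_gt0.
apply: filterS near_tau => l hl Sl; apply: (le_lt_trans (bound _ Sl)).
move: hl; rewrite ltr_pdivlMr // => hl; apply: le_lt_trans hl.
by rewrite ler_wpM2l ?rnorm_ge0 // lerDl.
Qed.

(** Asymptotic bounds on the two components survive in a weak limit, which exists
    by compactness. *)
Lemma face_sequence_weak_limit (l : nat -> C * C) (B : R) :
    (forall k, rnorm (p (l k)) <= B) -> (forall k, rnorm (q (l k)) <= B) ->
    (forall e : R, 0 < e -> \forall k \near \oo, rnorm (p (l k)) <= 1 + e) ->
    (forall e : R, 0 < e -> \forall k \near \oo, rnorm (q (l k)) <= e) ->
  exists k : nat -> nat, (forall m, (m <= k m)%N) /\ exists v,
    [/\ weakly_cvg ip (fun m => u (l (k m))) v,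
        rnorm (oproj ip M1 v) <= 1 & oproj ip M2 v = 0].
Proof.
move=> pB qB p1 q0; have [_ sep] := hilbert.
have B0 : 0 <= B by apply: le_trans (pB 0%N); exact: rnorm_ge0.
have uB k : rnorm (u (l k)) <= 2 * B.
  rewrite -ler_sqr ?nnegrE ?rnorm_ge0 ?mulr_ge0 // (rnorm_oproj ip_norm _ dec).
  have h (x : R) : 0 <= x -> x <= B -> x ^+ 2 <= B ^+ 2.
    by move=> x0 xB; rewrite ler_sqr ?nnegrE.
  have := h _ (rnorm_ge0 _) (pB k); have := h _ (rnorm_ge0 _) (qB k).
  have := sqr_ge0 B; rewrite exprMn; lra.
have [k [hk [v hv]]] := weak_sequential_compactness ip_norm sep uB.
have sub (P : nat -> Prop) : (\forall j \near \oo, P j) -> \forall m \near \oo, P (k m).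
  move=> [N _ hN]; exists N => // m /= Nm; apply: hN => /=.
  exact: leq_trans (hk m).
exists k; split=> //; exists v; split=> //.
  by apply: (weak_limit_oproj ip_norm dec hv) => // e e0; exact: sub (p1 e e0).
apply/rnorm0_eq0/eqP; rewrite eq_le rnorm_ge0 andbT.
apply: (weak_limit_oproj ip_norm dec' hv) => // e e0.
by rewrite add0r; exact: sub (q0 e e0).
Qed.

(** Reduces the construction of a DW point to estimates of [phi], [p] and [q]
    along one sequence. The value at the point comes for free, as a represented
    value is a nontangential limit. *)
Lemma DW_point_of_sequence (tau s : C) (l : nat -> C * C) (B K : R) :
    n tau = 1 -> n s <= 1 ->
    (forall k, unit_ball (l k)) -> l k @[k --> \oo] --> (tau, s) ->
    (forall k, julia_quotient phi (l k) <= K) ->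
    phi (l k) @[k --> \oo] --> tau ->
    (forall k, rnorm (p (l k)) <= B) -> (forall k, rnorm (q (l k)) <= B) ->
    (forall e : R, 0 < e -> \forall k \near \oo, rnorm (p (l k)) <= 1 + e) ->
    (forall e : R, 0 < e -> \forall k \near \oo, rnorm (q (l k)) <= e) ->
  left_typeI_DW_point ip phi M1 M2 u (tau, s).
Proof.
move=> tau1 s1 lb lt lK lphi pB qB p1 q0.
have [k [hk [v [hv v1 v2]]]] := face_sequence_weak_limit pB qB p1 q0.
have taus : rnorm ((tau, s) : C * C) = 1 by rewrite rnorm_pair tau1; apply/max_idPl.
have lt' := cvg_subsequence hk lt; have lphi' := cvg_subsequence hk lphi.
have x : represents tau tau (oproj ip M1 v).
  exact: weak_limit_represents (fun m => lb (k m)) lt' lphi' hv v2.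
split=> /=.
- by rewrite rnormE tau1.
- by rewrite rnormE -(rmorph1 (real_complex R)) lecR.
- exact: (B_point_of_sequence taus lb lt lK).
- exact: (represents_nt_limit tau1 tau1 x).
- exists v.
    exists (fun m => l (k m)); split; [by move=> m; exact: lb|exact: lt'| |exact: hv].
    by exists K => m; exact: lK.
  by rewrite rnormE -(rmorph1 (real_complex R)) lecR.
Qed.

(** The values of [phi] along the defining sequence need not converge a priori,
    but their limit along an ultrafilter is unimodular, by the bound on the Julia
    quotient, and it is a represented value; hence it is the nontangential limit
    [tau]. *)
Lemma DW_point_represents (tau s : C) :
  left_typeI_DW_point ip phi M1 M2 u (tau, s) ->
  exists2 x, rnorm x <= 1 & represents tau tau x.
Proof.
case=> /= tau1 s1 _ nt [v [l [lb lt [K hK] hv]] [v1 v2]].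
have {}tau1 : n tau = 1 by apply: complexI; rewrite -rnormE tau1.
have {}s1 : n s <= 1 by rewrite -lecR -rnormE.
have {}v1 : rnorm (oproj ip M1 v) <= 1 by rewrite -lecR -rnormE.
have taus : rnorm ((tau, s) : C * C) = 1 by rewrite rnorm_pair tau1; apply/max_idPl.
have [U [UU sU]] := ultraFilterLemma (@eventually_filter).
have [omega homega] : exists omega : C, forall e : R, 0 < e ->
    \forall k \near U, n (omega - phi (l k)) < e.
  apply: (@ultra_complex_limit _ _ _ _ _ 1) => k; apply: ltW.
  by apply/unit_ballE/phi_disk.
have {}lt : l @ U --> (tau, s) by move=> A /lt; exact: sU.
have om1 : n omega = 1.
  have K1 : 0 < `|K| + 2 by rewrite ltr_wpDl.
  apply/eqP; rewrite eq_le; apply/andP; split; apply/ler_addgt0Pl => e e0.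
    have [k [hk _]] := near_ex2 (homega _ e0) (homega _ e0).
    have f1 : n (phi (l k)) < 1 by apply/unit_ballE/phi_disk.
    have := rnormBB omega (phi (l k)); rewrite lerBlDr => h.
    by apply: (le_trans h); apply: lerD; exact: ltW.
  have [a a0 ea] : exists2 a : R, 0 < a & e = `|K| * a + 2 * a.
    by exists (e / (`|K| + 2)); rewrite ?divr_gt0 // -mulrDl mulrC divfK // gt_eqF.
  have h1 : \forall k \near U, rnorm ((tau, s) - l k) < a.
    exact: (cvg_rnormP _ _).1 lt _ a0.
  have [k [hk1 hk2]] := near_ex2 (homega _ a0) h1.
  have lk1 : rnorm (l k) < 1 by apply/unit_ballE.
  have := hK k; rewrite julia_quotient_le // => hj.
  have := rnormBB ((tau, s) : C * C) (l k); rewrite taus => h2.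
  have h3 : K * (1 - rnorm (l k)) <= `|K| * a.
    apply: (@le_trans _ _ (`|K| * (1 - rnorm (l k)))).
      by rewrite ler_wpM2r ?ler_norm // subr_ge0 ltW.
    by rewrite ler_wpM2l // (le_trans h2) // ltW.
  have h4 : n (phi (l k)) <= a + n omega.
    rewrite -lerBlDr; apply: (le_trans (rnormBB _ _)).
    by rewrite rnormC ltW.
  rewrite ea; have := le_trans hj h3; rewrite lerBlDr => h5.
  apply: (le_trans h5); rewrite -addrA lerD2l; apply: (le_trans h4).
  by rewrite lerD2r -[leLHS]mul1r ler_pM2r // ler1n.
have lphi : phi (l k) @[k --> U] --> omega by apply/cvg_rnormP.
have x : represents tau omega (oproj ip M1 v).
  apply: (weak_limit_represents lb lt lphi _ v2) => w A /hv; exact: sU.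
have om : omega = tau.
  exact: (nt_limit_unique taus (represents_nt_limit tau1 om1 x) nt).
by rewrite om in x; exists (oproj ip M1 v).
Qed.

Lemma inv_nat_small (e : R) : 0 < e -> \forall k \near \oo, k.+2%:R^-1 < e :> R.
Proof.
move=> e0; have [N hN] := ex_nat_gt (e^-1); exists N => // k /= Nk.
rewrite invf_plt ?posrE //; apply: (lt_trans hN); rewrite ltr_nat.
by rewrite (leq_ltn_trans Nk) // ltnW.
Qed.

(** The defect of the second coordinate is made to be at least [d k], much larger
    than the defect [d k ^+ 2] of the first one, so that the component [q] tends
    to zero even when [s] is unimodular. *)
Lemma represents_DW_point (tau s : C) (x : M) :
  n tau = 1 -> n s <= 1 -> rnorm x <= 1 -> represents tau tau x ->
  left_typeI_DW_point ip phi M1 M2 u (tau, s).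
Proof.
move=> tau1 s1 x1 hx; pose d (k : nat) : R := k.+2%:R^-1.
have d0 k : 0 < d k by rewrite invr_gt0.
have d12 k : d k <= 2^-1 by rewrite lef_pV2 ?posrE // ler_nat.
pose l k : C * C := ((1 - d k ^+ 2)%:C%C * tau, (1 - d k)%:C%C * s).
have tt : tau * (tau : R[i])^* = 1 by rewrite mul_conjE tau1 expr1n.
have dd k : 0 < d k ^+ 2 <= d k / 2.
  rewrite exprn_gt0 //= expr2 ler_wpM2l // ltW //.
have r1 k : 0 <= 1 - d k ^+ 2 by have := dd k; have := d12 k; lra.
have nl1 k : n (l k).1 = 1 - d k ^+ 2.
  by rewrite /l /= rnormM tau1 mulr1 rnorm_real ger0_norm.
have nl2 k : n (l k).2 = (1 - d k) * n s.
  by rewrite /l /= rnormM rnorm_real ger0_norm //; have := d12 k; lra.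
have nl2le k : n (l k).2 <= 1 - d k.
  by rewrite nl2 -[leRHS]mulr1 ler_wpM2l //; have := d12 k; lra.
have lb k : unit_ball (l k).
  apply/bidiskP; rewrite nl1; split; first by have := dd k; lra.
  by apply: (le_lt_trans (nl2le k)); have := d0 k; lra.
have nl k : rnorm (l k) = 1 - d k ^+ 2.
  rewrite [l k]surjective_pairing rnorm_pair -/(l k) nl1; apply/max_idPl.
  by apply: (le_trans (nl2le k)); have := dd k; lra.
have ell k : n (1 - (l k).1 * (tau : R[i])^*) = 1 - (1 - d k ^+ 2).
  rewrite /l /= -mulrA tt mulr1 -(rmorph1 (real_complex R)) -rmorphB rnorm_real.
  by rewrite ger0_norm //; have := dd k; lra.
have bounds k := radial_bounds ip_norm phi_disk model tau1 hx x1 (lb k) (r1 k) (nl1 k) (ell k).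
have ple k : rnorm (p (l k)) <= 1 + d k.
  have [h _ _] := bounds k; have := dd k; have := d12 k.
  have := rnorm_ge0 (p (l k)); move: h; rewrite -/(l k); clear.
  by move: (rnorm (p (l k))) (d k) => P e; nra.
have q2le k : rnorm (q (l k)) ^+ 2 <= 4 * d k.
  have [_ _ h] := bounds k.
  have h1 : d k <= 1 - n (l k).2 ^+ 2.
    have := nl2le k; have := rnorm_ge0 (l k).2; have := d12 k; have := d0 k.
    by move: (n (l k).2) (d k) => a e; nra.
  rewrite -(ler_pM2l (d0 k)); apply: (@le_trans _ _ ((1 - n (l k).2 ^+ 2) * rnorm (q (l k)) ^+ 2)).
    by rewrite ler_wpM2r ?sqr_ge0.
  apply: (le_trans h); move: (d k) => e; lra.
have qle k (e : R) : 0 < e -> 4 * d k <= e ^+ 2 -> rnorm (q (l k)) <= e.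
  move=> e0 he; rewrite -ler_sqr ?nnegrE ?rnorm_ge0 ?(ltW e0) //.
  exact: le_trans (q2le k) he.
have ble k : n (tau - phi (l k)) <= 2 * d k ^+ 2.
  by rewrite -rnorm_1Bconj //; have [_ h _] := bounds k; move: (d k) h => e; lra.
have small (e c : R) : 0 < e -> 0 < c -> \forall k \near \oo, c * d k <= e.
  move=> e0 c0; have := inv_nat_small (divr_gt0 e0 c0); apply: filterS => k.
  by rewrite ltr_pdivlMr // mulrC => /ltW.
apply: (@DW_point_of_sequence tau s l 2 2) => //.
- apply/cvg_pairP; split; apply/cvg_rnormP => e e0;
    apply: filterS (small _ _ (divr_gt0 e0 (ltr0n _ 2)) ltr01) => k; rewrite mul1r => hk.
    rewrite /l /= -{1}[tau]mul1r -mulrBl rnormM tau1 mulr1.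
    rewrite -(rmorph1 (real_complex R)) -rmorphB rnorm_real ger0_norm; have := dd k; have := d0 k; lra.
  rewrite /l /= -{1}[s]mul1r -mulrBl rnormM.
  rewrite -(rmorph1 (real_complex R)) -rmorphB rnorm_real ger0_norm; last by have := d0 k; lra.
  have := d0 k; have := rnorm_ge0 s; move: (d k) (n s) s1 hk => a b; nra.
- move=> k; rewrite julia_quotient_le ?nl; last by have := dd k; lra.
  have := rnormBB tau (phi (l k)); rewrite tau1; have := ble k; lra.
- apply/cvg_rnormP => e e0.
  apply: filterS (small _ _ (divr_gt0 e0 (ltr0n _ 2)) ltr01) => k; rewrite mul1r => hk.
  by apply: (le_lt_trans (ble k)); have := dd k; have := d0 k; lra.
- by move=> k; apply: (le_trans (ple k)); have := d12 k; lra.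
- by move=> k; apply: qle => //; have := d12 k; lra.
- move=> e e0; apply: filterS (small _ _ e0 ltr01) => k; rewrite mul1r => hk.
  by apply: (le_trans (ple k)); rewrite lerD2l.
- move=> e e0; apply: filterS (small _ _ (exprn_gt0 2 e0) (ltr0n _ 4)) => k hk.
  exact: qle.
Qed.

(** * Iteration of slices *)

Section Iteration.
Hypothesis phi_cont : forall l, unit_ball l -> phi @ l --> phi l.
Variables (tau : C) (x : M).
Hypotheses (tau1 : n tau = 1) (x1 : rnorm x <= 1) (hx : represents tau tau x).
Hypothesis phi_neq_fst : ~ {in unit_ball, phi =1 fst}.

(** The translation constant is nonzero because a zero constant would make [phi]
    the first projection; this excludes fixed points at the same time. *)
Lemma horodisk_translation l0 : unit_ball l0 ->
    n (tau - phi l0) ^+ 2 * (1 - n l0.1 ^+ 2) =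
    n (tau - l0.1) ^+ 2 * (1 - n (phi l0) ^+ 2) ->
  exists2 B : R[i], B != 0 & phi l0 != l0.1 /\ forall l, unit_ball l ->
    (1 - phi l * (tau : R[i])^*)^-1 = (1 - l.1 * (tau : R[i])^*)^-1 + B :> R[i].
Proof.
move=> hl0 heq; have := horodisk_equality_translation ip_norm phi_disk model tau1 hx x1 hl0.
rewrite !rnorm_1Bconj // => /(_ heq).
set B := (_ - _ : R[i]) => trans.
have B0 : B != 0.
  apply/eqP => B0; apply: phi_neq_fst => l /set_mem hl.
  have := trans l hl; rewrite B0 addr0 => /invr_inj.
  move=> /(congr1 (fun z => 1 - z)); rewrite !subKr => /(congr1 (fun z => z * tau)).
  by rewrite -!mulrA [_^* * tau]mulrC mul_conjE tau1 expr1n !mulr1.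
exists B => //; split=> //; apply: contra_neq B0 => e.
by rewrite /B e subrr.
Qed.

Lemma no_fixed_point l : unit_ball l -> phi l != l.1.
Proof.
move=> hl; apply/eqP => e; have [|B _ [/eqP]] := horodisk_translation hl; by rewrite e.
Qed.

Variable mu : C.
Hypothesis mu1 : unit_ball mu.
Local Notation f := (fun z : C => phi (z, mu)).

Let slice (z : C) : unit_ball z -> unit_ball ((z, mu) : C * C).
Proof. by move=> /unit_ballE hz; apply/bidiskP; split=> //=; apply/unit_ballE. Qed.

Lemma iter_unit_ball k z : unit_ball z -> unit_ball (iter k f z).
Proof. by move=> hz; elim: k => [|k IH] //=; exact/phi_disk/slice. Qed.

(** The level sets of [horo] in the disk are the horocycles at [tau]. *)
Let horo (z : C) : R := n (tau - z) ^+ 2 / (1 - n z ^+ 2).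

Let horo_ge0 z : unit_ball z -> 0 <= horo z.
Proof.
by move=> /unit_ballE hz; rewrite divr_ge0 ?sqr_ge0 ?ltW ?disk_sqr_lt1.
Qed.

Let horo_le z : unit_ball z -> horo (f z) <= horo z.
Proof.
move=> hz; have hl := slice hz.
have := wolff_horodisk ip_norm model hx x1 hl.
rewrite !rnorm_1Bconj //= => h.
have z1 : 0 < 1 - n z ^+ 2 by apply/disk_sqr_lt1/unit_ballE.
have fz1 : 0 < 1 - n (phi (z, mu)) ^+ 2 by apply/disk_sqr_lt1/unit_ballE/phi_disk.
by rewrite /horo ler_pdivrMr // mulrAC ler_pdivlMr.
Qed.

Let translation_iterates_cvg (B : R[i]) (z : C) : B != 0 -> unit_ball z ->
  (forall l, unit_ball l -> (1 - phi l * (tau : R[i])^*)^-1 =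
    (1 - l.1 * (tau : R[i])^*)^-1 + B :> R[i]) ->
  iter k f z @[k --> \oo] --> tau.
Proof.
move=> B0 hz trans.
have it k : (1 - iter k f z * (tau : R[i])^*)^-1 =
    (1 - z * (tau : R[i])^*)^-1 + B *+ k :> R[i].
  elim: k => [|k IH] /=; first by rewrite mulr0n addr0.
  by rewrite (trans _ (slice (iter_unit_ball k hz))) /= IH mulrSr addrA.
apply/cvg_rnormP => e e0.
have nB : 0 < n B.
  by rewrite lt_def rnorm_ge0 andbT; apply: contra_neq B0; exact: rnorm0_eq0.
have [N hN] := ex_nat_gt ((e^-1 + n (1 - z * (tau : R[i])^*)^-1) / n B).
exists N => // k /= Nk; rewrite -rnorm_1Bconj //.
have b0 : 0 < n (1 - iter k f z * (tau : R[i])^*).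
  by rewrite rnorm_1Bconj_gt0 //; apply/unit_ballE/iter_unit_ball.
rewrite -ltf_pV2 ?posrE // -rnormV it.
move: hN; rewrite ltr_pdivrMr // => hN.
have : n (B *+ k) <= n ((1 - z * (tau : R[i])^*)^-1 + B *+ k) + n (1 - z * (tau : R[i])^*)^-1.
  by rewrite -{1}[B *+ k](addKr (1 - z * (tau : R[i])^*)^-1) addrC rnormB.
have -> : n (B *+ k) = k%:R * n B.
  exact: (rnormMn B k).
have : N%:R * n B <= k%:R * n B by rewrite ler_pM2r // ler_nat.
move=> h1 h2; rewrite -(ltrD2r (n (1 - z * (tau : R[i])^*)^-1)).
by apply: lt_le_trans hN _; apply: le_trans h1 h2.
Qed.

Let horo_cvg (F : set_system nat) {PF : ProperFilter F} (g : nat -> C) (w : C) :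
  unit_ball w -> g @ F --> w -> horo (g k) @[k --> F] --> horo w.
Proof.
move=> w1 gw; have sq (h : nat -> C) (a : C) : h @ F --> a ->
    (n (h k) ^+ 2) @[k --> F] --> n a ^+ 2.
  move=> ha; under eq_fun do rewrite expr2.
  by rewrite expr2; apply: cvgM; exact: cvg_rnorm.
apply: cvgM; first by apply: sq; apply: cvgB; [exact: cvg_cst|exact: gw].
apply: cvgV; first by rewrite gt_eqF //; apply/disk_sqr_lt1/unit_ballE.
by apply: cvgB; [exact: cvg_cst|exact: sq].
Qed.

(** If no horocycle is touched, a cluster point of an orbit inside the disk
    would be a point at which the horodisk inequality is an equality. *)
Let strict_iterates_cvg (z : C) : unit_ball z ->
  (forall w, unit_ball w -> horo (f w) < horo w) ->
  iter k f z @[k --> \oo] --> tau.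
Proof.
move=> hz strict; pose zk k := iter k f z.
have zb k : unit_ball (zk k) by exact: iter_unit_ball.
have hmono : nonincreasing_seq (fun k => horo (zk k)).
  by apply/nonincreasing_seqP => k; exact: horo_le.
have hcvg : cvgn (fun k => horo (zk k)).
  apply: nonincreasing_is_cvgn => //.
  by exists 0 => _ [k _ <-]; exact: horo_ge0.
apply/cvg_rnormP => e e0; apply: contrapT => hne.
have PF : ProperFilter (within [set k | e <= n (tau - zk k)] \oo).
  apply: Build_ProperFilter_ex => P hP; apply: contrapT => hP0; apply: hne.
  apply: (@filterS _ \oo _ (fun k => e <= n (tau - zk k) -> P k)) hP => k hk.
  by rewrite ltNge; apply/negP => ek; apply: hP0; exists k; apply: hk.
have [U [UU sU]] := ultraFilterLemma PF.
have sU' : \oo `<=` U by move=> A hA; apply: sU; apply: filterS hA => k ? _.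
have UA : \forall k \near U, e <= n (tau - zk k) by apply: sU; apply: nearW.
have [p hp] : exists p : C, forall d : R, 0 < d -> \forall k \near U, n (p - zk k) < d.
  apply: (@ultra_complex_limit _ _ _ _ zk 1) => k; apply: ltW.
  by apply/unit_ballE.
have zp : zk k @[k --> U] --> p by apply/cvg_rnormP.
have h0 : 0 < horo z.
  apply: le_lt_trans (strict _ hz); apply/horo_ge0.
  by have := zb 1%N.
have c1 : (1 - n (zk k) ^+ 2) @[k --> U] --> 1 - n p ^+ 2.
  apply: cvgB; first exact: cvg_cst.
  under eq_fun do rewrite expr2.
  by rewrite expr2; apply: cvgM; exact: cvg_rnorm.
have h1 : e ^+ 2 / horo z <= 1 - n p ^+ 2.
  apply: (cvgr_to_ge c1); apply: filterS UA => k ek.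
  have d0 : 0 < 1 - n (zk k) ^+ 2 by apply/disk_sqr_lt1/unit_ballE.
  rewrite ler_pdivrMr // mulrC.
  apply: (@le_trans _ _ (n (tau - zk k) ^+ 2)).
    by rewrite ler_sqr ?nnegrE ?rnorm_ge0 ?(ltW e0).
  by rewrite -ler_pdivrMr //; exact: (hmono 0%N k).
have p1 : unit_ball p.
  apply/unit_ballE; rewrite -(@expr_lt1 _ 2) ?rnorm_ge0 // -subr_gt0.
  apply: lt_le_trans h1.
  by rewrite divr_gt0 // exprn_gt0.
pose h := lim (horo (zk k) @[k --> \oo]).
have lim1 : horo (zk k) @[k --> U] --> h by move=> A /hcvg; exact: sU'.
have lim2 : horo (zk k.+1) @[k --> U] --> h.
  have : horo (zk k.+1) @[k --> \oo] --> h by exact: (cvg_subsequence leqnSn hcvg).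
  by move=> c A /c; exact: sU'.
have pz : (zk k, mu) @[k --> U] --> (p, mu).
  by apply/cvg_pairP; split; [exact: zp|exact: cvg_cst].
have fzp : zk k.+1 @[k --> U] --> f p.
  exact: (cvg_comp _ _ pz (phi_cont (slice p1))).
have fp1 : unit_ball (f p) by exact/phi_disk/slice.
have e1 : horo p = h by exact: (cvg_unique (@norm_hausdorff _ R) (horo_cvg p1 zp) lim1).
have e2 : horo (f p) = h by exact: (cvg_unique (@norm_hausdorff _ R) (horo_cvg fp1 fzp) lim2).
by have := strict p p1; rewrite e1 e2 ltxx.
Qed.

(** Either the horodisk inequality is strict on the whole slice, or equality at
    one point makes the slice a translation of a half-plane. *)
Lemma represents_denjoy_wolff : denjoy_wolff_point f tau.
Proof.
split=> [z hz|| z hz].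
- exact/eqP/(no_fixed_point (slice hz)).
- by rewrite rnormE tau1.
- have [strict|] := pselect (forall w, unit_ball w -> horo (f w) < horo w).
    exact: strict_iterates_cvg.
  move=> /existsNP[w /not_implyP[hw /negP]]; rewrite -leNgt => hle.
  have heq : horo (f w) = horo w by apply/eqP; rewrite eq_le horo_le.
  have hl := slice hw.
  have w0 : 1 - n w ^+ 2 != 0 by rewrite gt_eqF //; apply/disk_sqr_lt1/unit_ballE.
  have fw0 : 1 - n (phi (w, mu)) ^+ 2 != 0.
    by rewrite gt_eqF //; apply/disk_sqr_lt1/unit_ballE/phi_disk.
  have [|B B0 [_ trans]] := horodisk_translation hl.
    by move/eqP: heq; rewrite /horo /= eqr_div // => /eqP.
  exact: (translation_iterates_cvg B0 hz trans).
Qed.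

End Iteration.

(** Along the orbit of [0], which tends to the circle, infinitely many steps
    do not decrease the modulus; these points form a sequence with Julia
    quotient at most [1]. *)
Lemma denjoy_wolff_DW_point (tau : C) :
  denjoy_wolff_point (fun z : C => phi (z, 0)) tau ->
  left_typeI_DW_point ip phi M1 M2 u (tau, 0).
Proof.
move=> [_ tau1' it]; have tau1 : n tau = 1 by apply: complexI; rewrite -rnormE tau1'.
have b0 : unit_ball (0 : C) by apply/unit_ballE; rewrite rnorm0.
pose z k := iter k (fun z : C => phi (z, 0)) 0.
have slice (w : C) : unit_ball w -> unit_ball ((w, 0) : C * C).
  by move=> /unit_ballE hw; apply/bidiskP; split=> //=; rewrite rnorm0.
have zb k : unit_ball (z k) by elim: k => [|k IH] //=; exact/phi_disk/slice.
have zt : z k @[k --> \oo] --> tau by exact: it.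
have z1 k : n (z k) < 1 by apply/unit_ballE.
have nz : n (z k) @[k --> \oo] --> (1 : R) by rewrite -tau1; exact: cvg_rnorm.
have often N : exists k, (N <= k)%N /\ n (z k) <= n (z k.+1).
  apply: contrapT => none.
  have mono k : (N <= k)%N -> n (z k) <= n (z N).
    elim: k => [|k IH]; first by rewrite leqn0 => /eqP->.
    rewrite leq_eqVlt => /orP[/eqP<-//|]; rewrite ltnS => Nk.
    apply: le_trans (IH Nk); rewrite leNgt; apply/negP => hk.
    by apply: none; exists k; split=> //; exact: ltW.
  have h : 1 <= n (z N).
    apply: (cvgr_to_le nz); exists N => // k /=; exact: mono.
  by have := z1 N; rewrite ltNge h.
have [k hk] := choice often.
have ksub N : (N <= k N)%N by case: (hk N).
have kS N : (N <= (k N).+1)%N by rewrite ltnW // ltnS.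
have diag N : 1 - n (z (k N).+1) ^+ 2 =
    (1 - n (z (k N)) ^+ 2) * rnorm (p (z (k N), 0)) ^+ 2 + rnorm (q (z (k N), 0)) ^+ 2.
  by have := model_diag ip_norm model (slice _ (zb (k N))); rewrite /= rnorm0 expr0n subr0 mul1r.
have step N : n (z (k N)) ^+ 2 <= n (z (k N).+1) ^+ 2.
  by rewrite ler_sqr ?nnegrE ?rnorm_ge0 //; case: (hk N).
have p1 N : rnorm (p (z (k N), 0)) <= 1.
  have h := disk_sqr_lt1 (z1 (k N)).
  rewrite -(@expr_le1 _ 2) ?rnorm_ge0 // -(ler_pM2l h) mulr1.
  apply: (@le_trans _ _ (1 - n (z (k N).+1) ^+ 2)).
    by rewrite diag lerDl sqr_ge0.
  by rewrite lerD2l lerN2.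
have q2 N : rnorm (q (z (k N), 0)) ^+ 2 <= 1 - n (z (k N).+1) ^+ 2.
  by rewrite diag lerDr mulr_ge0 ?sqr_ge0 // ltW // disk_sqr_lt1.
have nzk : n (z (k N).+1) @[N --> \oo] --> (1 : R).
  exact: (cvg_subsequence kS nz).
apply: (@DW_point_of_sequence tau 0 (fun N => (z (k N), 0)) 1 1) => //.
- by rewrite rnorm0.
- by move=> N; exact: slice.
- apply/cvg_pairP; split; last exact: cvg_cst.
  exact: (cvg_subsequence ksub zt).
- move=> N; rewrite julia_quotient_le rnorm_pair rnorm0 (max_idPl (rnorm_ge0 _)) //.
  by rewrite mul1r lerD2l lerN2; case: (hk N).
- exact: (cvg_subsequence kS zt).
- move=> N; rewrite -(@expr_le1 _ 2) ?rnorm_ge0 //; apply: (le_trans (q2 N)).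
  by rewrite gerBl sqr_ge0.
- by move=> e e0; apply: nearW => N; apply: (le_trans (p1 N)); rewrite lerDl ltW.
- move=> e e0.
  have h : \forall N \near \oo, 1 - e ^+ 2 / 2 <= n (z (k N).+1).
    by apply: (cvgr_ge 1 nzk); rewrite ltrBlDr ltrDl divr_gt0 // exprn_gt0.
  apply: filterS h => N h; rewrite -ler_sqr ?nnegrE ?rnorm_ge0 ?(ltW e0) //.
  apply: (le_trans (q2 N)); have := z1 (k N).+1; have := rnorm_ge0 (z (k N).+1).
  by move: h; move: (n _) (e ^+ 2) => a b; nra.
Qed.

(** * Directional derivatives *)

Section Directional.
Variables (tau s : C) (x : M) (m N : R).
Hypotheses (tau1 : n tau = 1) (s1 : n s <= 1) (x1 : rnorm x <= 1).
Hypothesis hx : represents tau tau x.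
Hypotheses (N0 : 0 < N) (m1 : 1 <= m) (Nm : N <= m).

Let path (t : R) : C * C := ((1 - t)%:C%C * tau, (1 - N * t)%:C%C * s).
Local Notation a t := (ip (p (path t)) x : C).

Let m0 : 0 < m. Proof. exact: lt_le_trans ltr01 m1. Qed.

(** One constant serves both coordinates of the path: the first one is the case
    [K = 1] and [k = 1], the second one moves at speed [K = N] and has
    [k = n s ^+ 2]. The constant is that of the extreme case [K = m] and [k = 1],
    slightly enlarged. *)
Lemma path_coordinate_bound (t r K k : R) :
    0 < t -> 0 < r -> m * t <= 1 -> m * r <= 1 -> 0 < K -> K <= m -> 0 <= k -> k <= 1 ->
  (1 - k * ((1 - K * t) * (1 - K * r))) ^+ 2 <=
  (t + r) ^+ 2 / (t * (2 - m * t) * (r * (2 - m * r))) *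
    ((1 - k * (1 - K * t) ^+ 2) * (1 - k * (1 - K * r) ^+ 2)).
Proof.
move=> t0 r0 mt mr K0 Km k0 k1.
have Kt : K * t <= m * t by rewrite ler_pM2r.
have Kr : K * r <= m * r by rewrite ler_pM2r.
have Kt0 : 0 < K * t by rewrite mulr_gt0.
have Kr0 : 0 < K * r by rewrite mulr_gt0.
set D := t * (2 - m * t) * (r * (2 - m * r)).
have D0 : 0 < D by rewrite /D !mulr_gt0 // subr_gt0; lra.
set X := 1 - k * (1 - K * t) ^+ 2; set Y := 1 - k * (1 - K * r) ^+ 2.
rewrite mulrAC ler_pdivlMr //.
have -> : (1 - k * ((1 - K * t) * (1 - K * r))) ^+ 2 = X * Y + k * (K ^+ 2 * (t - r) ^+ 2).
  by rewrite /X /Y; ring.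
have sqle (y : R) : 0 < y -> y <= 1 -> k * (1 - y) ^+ 2 <= (1 - y) ^+ 2.
  by move=> y0 y1; rewrite -[leRHS]mul1r ler_wpM2r ?sqr_ge0.
have Xge : K * (t * (2 - m * t)) <= X.
  have := sqle _ Kt0 (le_trans Kt mt); rewrite /X => h.
  have : K * t * (K * t) <= K * t * (m * t) by rewrite ler_pM2l.
  lra.
have Yge : K * (r * (2 - m * r)) <= Y.
  have := sqle _ Kr0 (le_trans Kr mr); rewrite /Y => h.
  have : K * r * (K * r) <= K * r * (m * r) by rewrite ler_pM2l.
  lra.
have XY : K ^+ 2 * D <= X * Y.
  have -> : K ^+ 2 * D = K * (t * (2 - m * t)) * (K * (r * (2 - m * r))).
    by rewrite /D; ring.
  by apply: ler_pM => //; rewrite ltW // !mulr_gt0 // subr_gt0; lra.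
have D4 : D <= 4 * (t * r).
  have -> : 4 * (t * r) = (t * 2) * (r * 2) by ring.
  have mt0 : 0 < m * t by rewrite mulr_gt0.
  have mr0 : 0 < m * r by rewrite mulr_gt0.
  apply: ler_pM; rewrite ?mulr_ge0 ?(ltW t0) ?(ltW r0) ?subr_ge0 //; try lra.
    by rewrite ler_pM2l //; lra.
  by rewrite ler_pM2l //; lra.
have KD0 : 0 <= K ^+ 2 * D by rewrite mulr_ge0 ?sqr_ge0 // ltW.
have h1 : (t - r) ^+ 2 * (K ^+ 2 * D) <= ((t + r) ^+ 2 - D) * (X * Y).
  by apply: ler_pM => //; rewrite ?sqr_ge0 //; move: D4; lra.
have h2 : k * (K ^+ 2 * (t - r) ^+ 2) * D <= (t - r) ^+ 2 * (K ^+ 2 * D).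
  have -> : k * (K ^+ 2 * (t - r) ^+ 2) * D = k * ((t - r) ^+ 2 * (K ^+ 2 * D)) by ring.
  by rewrite -[leRHS]mul1r ler_wpM2r // mulr_ge0 ?sqr_ge0.
move: h1 h2; lra.
Qed.

Lemma rnorm_real_mul_conj (al be : R) (z : C) :
  n (1 - (al%:C%C * z) * (be%:C%C * z : R[i])^*) ^+ 2 = (1 - n z ^+ 2 * (al * be)) ^+ 2.
Proof.
have -> : 1 - (al%:C%C * z) * (be%:C%C * z : R[i])^* = (1 - n z ^+ 2 * (al * be))%:C%C :> R[i].
  rewrite rmorphM /= (_ : (be%:C%C)^* = be%:C%C :> R[i]); last first.
    by apply: conj_Creal; apply/complex_realP; exists be.
  have -> : (1 - n z ^+ 2 * (al * be))%:C%C = 1 - z * z^* * (al%:C%C * be%:C%C) :> R[i].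
    rewrite mul_conjE -2!(rmorphM (real_complex R)) -(rmorph1 (real_complex R)).
    by rewrite -(rmorphB (real_complex R)).
  by ring.
by rewrite rnorm_real real_normK ?num_real.
Qed.

Let small (t : R) : 0 < t -> m * t <= 1 -> [/\ t <= 1, 0 < N * t & N * t <= 1].
Proof.
move=> t0 mt; split; last by rewrite (le_trans _ mt) // ler_pM2r.
  by apply: le_trans mt; rewrite -[leLHS]mul1r ler_pM2r.
by rewrite mulr_gt0.
Qed.

Lemma path_fst t : 0 < t -> m * t <= 1 -> n (path t).1 = 1 - t.
Proof.
move=> t0 mt; have [t1 _ _] := small t0 mt.
by rewrite /= rnormM tau1 mulr1 rnorm_real ger0_norm // subr_ge0.
Qed.

Lemma path_snd t : 0 < t -> m * t <= 1 -> n (path t).2 = (1 - N * t) * n s.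
Proof.
move=> t0 mt; have [_ _ t1] := small t0 mt.
by rewrite /= rnormM rnorm_real ger0_norm // subr_ge0.
Qed.

Lemma path_unit_ball t : 0 < t -> m * t <= 1 -> unit_ball (path t).
Proof.
move=> t0 mt; have [t1 Nt0 Nt1] := small t0 mt.
apply/bidiskP; rewrite path_fst // path_snd //; split; first by lra.
apply: (@le_lt_trans _ _ (1 - N * t)); last by lra.
by rewrite -[leRHS]mulr1 ler_wpM2l // subr_ge0.
Qed.

Lemma path_ell t : 1 - (path t).1 * (tau : R[i])^* = t%:C%C :> R[i].
Proof.
have tt : tau * (tau : R[i])^* = 1 by rewrite mul_conjE tau1 expr1n.
by rewrite /= -mulrA tt mulr1 -(rmorph1 (real_complex R)) -rmorphB opprB addrCA subrr addr0.
Qed.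

Lemma path_value t : 0 < t -> m * t <= 1 ->
  1 - phi (path t) * (tau : R[i])^* = t%:C%C * a t :> R[i].
Proof. by move=> t0 mt; rewrite (hx (path_unit_ball t0 mt)) path_ell. Qed.

Lemma path_schwarz_pick t r : 0 < t -> 0 < r -> m * t <= 1 -> m * r <= 1 ->
  n (1 - phi (path t) * (phi (path r))^*) ^+ 2 <=
  (t + r) ^+ 2 / (t * (2 - m * t) * (r * (2 - m * r))) *
    ((1 - n (phi (path t)) ^+ 2) * (1 - n (phi (path r)) ^+ 2)).
Proof.
move=> t0 r0 mt mr.
have sq (al : R) (z : C) : n (al%:C%C * z) ^+ 2 = n z ^+ 2 * al ^+ 2.
  by rewrite rnormM exprMn rnorm_real real_normK ?num_real // mulrC.
apply: (schwarz_pick ip_norm model (path_unit_ball t0 mt) (path_unit_ball r0 mr)).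
- rewrite divr_ge0 ?sqr_ge0 // ltW // !mulr_gt0 // subr_gt0; lra.
- rewrite /= rnorm_real_mul_conj !sq tau1 expr1n.
  have := path_coordinate_bound t0 r0 mt mr ltr01 m1 ler01 (lexx 1).
  by rewrite !mul1r.
- rewrite /= rnorm_real_mul_conj !sq.
  apply: path_coordinate_bound => //; first exact: sqr_ge0.
  by rewrite expr_le1 // rnorm_ge0.
Qed.

Lemma path_defect t : 0 < t -> m * t <= 1 ->
  1 - n (phi (path t)) ^+ 2 = 2 * t * complex.Re (a t) - t ^+ 2 * n (a t) ^+ 2.
Proof.
move=> t0 mt; have tt : (tau : R[i])^* * tau = 1 by rewrite mulrC mul_conjE tau1 expr1n.
have -> : n (phi (path t)) = n (1 - t%:C%C * a t).
  by rewrite -(path_value t0 mt) subKr rnormM rnorm_conj tau1 mulr1.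
rewrite !rnorm_sqr; case: (a t) => y z /=; ring.
Qed.

Lemma path_bounds t : 0 < t -> m * t <= 1 ->
  [/\ (1 - n (phi (path t)) ^+ 2) / (2 * t) <= complex.Re (a t),
      (2 - t) * n (a t) <= 2 & n (a t) <= 2].
Proof.
move=> t0 mt; have [t1 _ _] := small t0 mt.
have at2 : (2 - t) * n (a t) <= 2.
  have hb := path_unit_ball t0 mt.
  have e1 : n (1 - (path t).1 * (tau : R[i])^*) = 1 - (1 - t).
    by rewrite path_ell rnorm_real gtr0_norm // opprB addrCA subrr addr0.
  have [|h _ _] := radial_bounds ip_norm phi_disk model tau1 hx x1 hb _ (path_fst t0 mt) e1.
    by rewrite subr_ge0.
  apply: le_trans h; have -> : 1 + (1 - t) = 2 - t by ring.
  apply: ler_wpM2l; first by rewrite subr_ge0; lra.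
  apply: (le_trans (cauchy_schwarz ip_norm _ _)).
  by rewrite -[leRHS]mulr1 ler_wpM2l ?rnorm_ge0.
split => //; last by have := rnorm_ge0 (a t); nra.
rewrite ler_pdivrMr ?mulr_gt0 // path_defect //.
have : 0 <= t ^+ 2 * n (a t) ^+ 2 by rewrite mulr_ge0 ?sqr_ge0.
lra.
Qed.

(** A lower bound for the Julia quotient at the parameter [t] in terms of the
    parameter [r]. The number [6] adds up the errors [2 t] and [4 t] of the two
    terms by which the kernel differs from the defect at [r]. *)
Let g (r t : R) : R :=
  (r * n (a r) - 6 * t) ^+ 2 * ((2 - m * t) * (2 - m * r)) / (4 * (t + r) ^+ 2 * n (a r)).

(** The two-point inequality between the parameters [t] and [r], solved for
    the Julia quotient at [t]. The condition on [t] makes the lower bound for the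
    kernel nonnegative, so that it can be squared. *)
Lemma path_lower_bound t r : 0 < t -> 0 < r -> m * t <= 1 -> m * r <= 1 ->
  6 * t <= r * n (a r) -> g r t <= (1 - n (phi (path t)) ^+ 2) / (2 * t).
Proof.
move=> t0 r0 mt mr htr.
have A0 : 0 < n (a r) by exact: (cara_gt0 phi_disk tau1 hx (path_unit_ball r0 mr)).
have [_ _ at2] := path_bounds t0 mt; have [yr _ ar2] := path_bounds r0 mr.
have [r1 _ _] := small r0 mr.
have lower : r * n (a r) - 6 * t <= n (1 - phi (path t) * (phi (path r))^*).
  have tt : tau * (tau : R[i])^* = 1 by rewrite mul_conjE tau1 expr1n.
  rewrite (one_sub_mul_unimodular (phi (path t)) ((phi (path r))^*) tt).
  have -> : 1 - (phi (path r))^* * tau = (r%:C%C * a r)^* :> R[i].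
    by rewrite -(path_value r0 mr) rmorphB rmorph1 rmorphM /= conjCK.
  rewrite (path_value t0 mt); set z : C := t%:C%C * a t; set w : C := (r%:C%C * a r)^*.
  have nz : n z <= 2 * t.
    by rewrite rnormM rnorm_real gtr0_norm // mulrC ler_pM2r.
  have nw : n w = r * n (a r) by rewrite rnorm_conj rnormM rnorm_real gtr0_norm.
  have nw2 : n w <= 2 by rewrite nw; have := rnorm_ge0 (a r); nra.
  have : n w <= n (z + w - z * w) + n z + n (z * w).
    have e : w = (z + w - z * w) - z + z * w by ring.
    rewrite {1}e.
    apply: (le_trans (rnormD _ _)); rewrite lerD2r; exact: rnormB.
  have : n (z * w) <= 2 * t * 2.
    by rewrite rnormM; apply: ler_pM; rewrite ?rnorm_ge0.
  by rewrite nw; lra.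
have key := path_schwarz_pick t0 r0 mt mr.
rewrite /g ler_pdivrMr; last by rewrite !mulr_gt0 // addr_gt0.
have dt : 0 < 2 - m * t by lra.
have dr : 0 < 2 - m * r by lra.
have {}yr : 1 - n (phi (path r)) ^+ 2 <= 2 * r * n (a r).
  move: yr; rewrite ler_pdivrMr ?mulr_gt0 // => yr; apply: (le_trans yr).
  by rewrite mulrC ler_pM2l ?mulr_gt0 // Re_le_rnorm.
set E := 1 - n (phi (path t)) ^+ 2 in key *.
have E0 : 0 < E by apply/disk_sqr_lt1/unit_ballE/phi_disk/path_unit_ball.
have h : (r * n (a r) - 6 * t) ^+ 2 <=
    (t + r) ^+ 2 / (t * (2 - m * t) * (r * (2 - m * r))) * (E * (2 * r * n (a r))).
  apply: (@le_trans _ _ (n (1 - phi (path t) * (phi (path r))^*) ^+ 2)).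
    by rewrite ler_sqr ?nnegrE ?rnorm_ge0 // subr_ge0.
  apply: (le_trans key); apply: ler_wpM2l.
    by rewrite divr_ge0 ?sqr_ge0 // ltW // !mulr_gt0.
  by rewrite ler_pM2l.
apply: (le_trans (ler_wpM2r _ h)); first by rewrite ltW // mulr_gt0.
rewrite le_eqVlt; apply/orP; left; apply/eqP; field.
by rewrite !gt_eqF.
Qed.

Let g_cvg r : 0 < r -> m * r <= 1 ->
  g r t @[t --> 0^'+] --> n (a r) * (2 - m * r) / 2.
Proof.
move=> r0 mr; have A0 : 0 < n (a r) by exact: (cara_gt0 phi_disk tau1 hx (path_unit_ball r0 mr)).
have idc : (t : R) @[t --> 0^'+] --> (0 : R) by apply: cvg_at_right_filter; exact: cvg_id.
have lin (c d : R) : (c - d * t) @[t --> 0^'+] --> c.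
  have h : (d * t) @[t --> 0^'+] --> d * 0 by apply: cvgM; [exact: cvg_cst|exact: idc].
  by rewrite mulr0 in h; rewrite -[X in _ --> X]subr0; apply: cvgB; [exact: cvg_cst|exact: h].
have -> : n (a r) * (2 - m * r) / 2 =
    (r * n (a r)) ^+ 2 * (2 * (2 - m * r)) / (4 * (0 + r) ^+ 2 * n (a r)).
  by rewrite add0r; field; rewrite !gt_eqF.
apply: cvgM.
  apply: cvgM; last by apply: cvgM; [exact: lin|exact: cvg_cst].
  by under eq_fun do rewrite expr2; rewrite expr2; apply: cvgM; exact: lin.
apply: cvgV; first by rewrite add0r gt_eqF // !mulr_gt0.
apply: cvgM; last exact: cvg_cst.
apply: cvgM; first exact: cvg_cst.
have tr : (t + r) @[t --> 0^'+] --> 0 + r by apply: cvgD; [exact: idc|exact: cvg_cst].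
by under eq_fun do rewrite expr2; rewrite expr2; apply: cvgM; exact: tr.
Qed.

Let near_path (e : R) : 0 < e ->
  \forall t \near 0^'+, [/\ 0 < t, m * t <= 1 & t <= e].
Proof.
move=> e0; near=> t; have t0 : 0 < t by near: t; exact: nbhs_right_gt.
split=> //; first by rewrite -ler_pdivlMl // mulr1; near: t; apply: nbhs_right_le; rewrite invr_gt0.
by near: t; exact: nbhs_right_le.
Unshelve. all: by end_near.
Qed.

(** Julia's theorem along the path: [L] is the supremum over [r] of the limits
    [n (a r) * (2 - m * r) / 2] of [g r] at [0]. For small [t], the real part of
    [a t] exceeds [g r t], which is close to [L] for a good choice of [r], and the
    modulus of [a t] is at most [L * 2 / (2 - m * t)]. *)
Lemma path_limit : exists2 L : R, 0 < L <= 1 &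
  a t @[t --> 0^'+] --> (L%:C%C : C).
Proof.
pose S := [set v : R | exists2 r, 0 < r /\ m * r <= 1 & v = n (a r) * (2 - m * r) / 2].
have SE r : 0 < r -> m * r <= 1 -> S (n (a r) * (2 - m * r) / 2) by exists r.
have r0 : 0 < m^-1 by rewrite invr_gt0.
have mr0 : m * m^-1 <= 1 by rewrite divff // gt_eqF.
have supS : has_sup S.
  split; first by exists (n (a m^-1) * (2 - m * m^-1) / 2); exact: SE.
  exists 2 => _ [r [h0 h1] ->]; have [_ _ h2] := path_bounds h0 h1.
  have : 0 < m * r by rewrite mulr_gt0.
  by move: h1 h2 (rnorm_ge0 (a r)); move: (m * r) (n (a r)) => b c; nra.
pose L := sup S.
have Lub r : 0 < r -> m * r <= 1 -> n (a r) * (2 - m * r) / 2 <= L.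
  by move=> h0 h1; apply: sup_upper_bound supS _ _; exact: SE.
have L0 : 0 < L.
  apply: lt_le_trans (Lub _ r0 mr0).
  have := cara_gt0 phi_disk tau1 hx (path_unit_ball r0 mr0).
  by rewrite divff ?gt_eqF // => h; rewrite divr_gt0 // mulr_gt0 //; lra.
have lower (e : R) : 0 < e ->
    \forall t \near 0^'+, L - e <= complex.Re (a t).
  move=> e0; have e2 : 0 < e / 2 by rewrite divr_gt0.
  have [v [r [h0 h1] ->] hv] := sup_adherent e2 supS.
  have A0 : 0 < n (a r) by exact: (cara_gt0 phi_disk tau1 hx (path_unit_ball h0 h1)).
  have hg : \forall t \near 0^'+, n (a r) * (2 - m * r) / 2 - e / 2 <= g r t.
    by apply: (cvgr_ge _ (g_cvg h0 h1)); rewrite ltrBlDr ltrDl.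
  have rA : 0 < r * n (a r) / 6 by rewrite divr_gt0 // mulr_gt0.
  apply: filterS (filterI hg (near_path rA)) => t [h2 [t0 mt tA]].
  have [h3 _ _] := path_bounds t0 mt; apply: le_trans h3.
  apply: le_trans (path_lower_bound t0 h0 mt h1 _).
    by apply: le_trans h2; move: hv; rewrite -/L; lra.
  by move: tA; rewrite ler_pdivlMr // mulrC.
have upper (e : R) : 0 < e -> \forall t \near 0^'+, n (a t) <= L + e.
  move=> e0; apply: filterS (near_path (divr_gt0 e0 m0)) => t [t0 mt te].
  have [_ _ h2] := path_bounds t0 mt; have := Lub t t0 mt.
  have : m * t <= e by rewrite mulrC -ler_pdivlMr.
  have : 0 < m * t by rewrite mulr_gt0.
  by move: h2 (rnorm_ge0 (a t)); move: (m * t) (n (a t)) => b c; nra.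
have L1 : L <= 1.
  apply/ler_addgt0Pl => e e0; have e2 : 0 < e / 2 by rewrite divr_gt0.
  have [t [h1 [t0 mt te]]] := near_ex2 (lower _ e2) (near_path e2).
  have [_ h2 h3] := path_bounds t0 mt.
  have h4 := le_trans h1 (Re_le_rnorm (a t)).
  by move: h2 h3 h4 te; move: (n (a t)) => c; nra.
exists L; first by rewrite L0.
apply/cvg_rnormP => e e0; pose d := Num.min 1 (e ^+ 2 / (2 * (4 * L + 1))).
have L4 : 0 < 2 * (4 * L + 1) by lra.
have d0 : 0 < d by rewrite lt_min ltr01 /= divr_gt0 // exprn_gt0.
have [d1 d2] : d <= 1 /\ d <= e ^+ 2 / (2 * (4 * L + 1)).
  by split; rewrite ge_min lexx ?orbT.
apply: filterS (filterI (lower _ d0) (upper _ d0)) => t [h1 h2].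
rewrite -ltr_sqr ?nnegrE ?rnorm_ge0 ?(ltW e0) //.
have -> : n (L%:C%C - a t) ^+ 2 = n (a t) ^+ 2 - 2 * L * complex.Re (a t) + L ^+ 2.
  by rewrite !rnorm_sqr; case: (a t) => y z /=; ring.
have h3 : n (a t) ^+ 2 <= (L + d) ^+ 2.
  by rewrite ler_sqr ?nnegrE ?rnorm_ge0 // addr_ge0 // ltW.
have h4 : L * (L - d) <= L * complex.Re (a t) by rewrite ler_pM2l.
have h5 : d * d <= d * 1 by rewrite ler_pM2l.
move: d2; rewrite ler_pdivlMr // => d2.
have final (A2 Ra E l b : R) : A2 <= (l + b) ^+ 2 -> l * (l - b) <= l * Ra ->
    b * b <= b * 1 -> b * (2 * (4 * l + 1)) <= E -> 0 < E ->
    A2 - 2 * l * Ra + l ^+ 2 < E by move=> ? ? ? ? ?; nra.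
exact: final h3 h4 h5 d2 (exprn_gt0 2 e0).
Qed.

End Directional.

Lemma ReB (y z : C) : complex.Re (y - z) = complex.Re y - complex.Re z.
Proof. by case: y; case: z. Qed.

Lemma unimodular_sub (tau z : C) : n tau = 1 ->
  z - tau = - tau * (1 - z * (tau : R[i])^*).
Proof.
move=> tau1; have tt : tau * (tau : R[i])^* = 1 by rewrite mul_conjE tau1 expr1n.
have -> : - tau * (1 - z * (tau : R[i])^*) = z * (tau * (tau : R[i])^*) - tau by ring.
by rewrite tt mulr1.
Qed.

Lemma path_point (tau s : C) (N t : R) :
  ((tau, s) : C * C) - t%:C%C *: (tau, s * N%:C%C) =
  ((1 - t)%:C%C * tau, (1 - N * t)%:C%C * s).
Proof.
have -> : (1 - t)%:C%C * tau = tau - t%:C%C * tau.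
  by rewrite rmorphB rmorph1 mulrBl mul1r.
have -> : (1 - N * t)%:C%C * s = s - t%:C%C * (s * N%:C%C).
  by rewrite rmorphB rmorph1 mulrBl mul1r rmorphM /=; congr (_ - _); ring.
by [].
Qed.

Lemma near0_pos (e : R) : 0 < e -> \forall t \near 0^'+, 0 < t <= e.
Proof.
move=> e0; near=> t; apply/andP; split.
  by near: t; exact: nbhs_right_gt.
by near: t; exact: nbhs_right_le.
Unshelve. all: by end_near.
Qed.

Lemma represents_dirderiv (tau s : C) (x : M) (N L : R) :
    n tau = 1 -> n s <= 1 -> represents tau tau x -> 0 < N ->
    (ip (p ((1 - t)%:C%C * tau, (1 - N * t)%:C%C * s)) x : C) @[t --> 0^'+] --> (L%:C%C : C) ->
  is_dirderiv phi (tau, s) (tau, s * N%:C%C) (- tau * L%:C%C).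
Proof.
move=> tau1 s1 hx N0 aL; exists tau; first exact: (represents_nt_limit tau1 tau1 hx).
pose m := Num.max 1 N; have [m1 Nm] : 1 <= m /\ N <= m by rewrite /m !le_max !lexx orbT.
have m0 : 0 < m by exact: lt_le_trans ltr01 m1.
have tt : tau * (tau : R[i])^* = 1 by rewrite mul_conjE tau1 expr1n.
have c : (- tau * ip (p ((1 - t)%:C%C * tau, (1 - N * t)%:C%C * s)) x : C)
    @[t --> 0^'+] --> (- tau * L%:C%C : C).
  by apply: cvgM; [exact: cvg_cst|exact: aL].
apply: cvg_trans c; apply: near_eq_cvg.
have mi : 0 < m^-1 by rewrite invr_gt0.
apply: filterS (near0_pos mi) => t /andP[t0]; rewrite -[leRHS]mul1r ler_pdivlMr // mulrC => mt.
have := path_value tau1 s1 hx N0 m1 Nm t0 mt; rewrite -path_point.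
set l := (_, _) - _ => hv; have t0' : t%:C%C != 0 :> R[i] by rewrite (inj_eq (@complexI _) _ 0) gt_eqF.
by rewrite (unimodular_sub _ tau1) hv /GRing.scale /= mulrCA mulKf.
Qed.

(** The arithmetic of the next lemma, with slope [K] and [e = 1 / K]: the weight
    of [Q] is at least [K * t], and the right hand side is of order [t]. *)
Lemma slow_path_estimate (t e K S P Q : R) :
    0 < t -> t <= e ^+ 2 -> 0 < e -> e <= 2^-1 -> K * e = 1 -> 0 <= P -> 0 <= Q ->
    0 <= S -> S <= 1 ->
    (1 - (1 - t) ^+ 2) * P + (1 - (1 - K * t) ^+ 2 * S) * Q <= 2 * t * (1 + e) ->
  P <= 1 + 3 * e /\ Q <= 3 * e.
Proof.
move=> t0 te e0 e1 Ke P0 Q0 S0 S1 h.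
have e2 : e ^+ 2 <= e / 2 by rewrite expr2 ler_pM2l.
have K0 : 0 < K by rewrite -(pmulr_lgt0 _ e0) Ke.
have Kt : K * t <= e by rewrite -[leRHS]mul1r -Ke -mulrA -expr2 ler_pM2l.
have Kt0 : 0 < K * t by rewrite mulr_gt0.
have w : K * t <= 1 - (1 - K * t) ^+ 2 * S.
  have : (1 - K * t) ^+ 2 * S <= (1 - K * t) ^+ 2 * 1 by rewrite ler_wpM2l ?sqr_ge0.
  nra.
have hQ : K * t * Q <= (1 - (1 - K * t) ^+ 2 * S) * Q by rewrite ler_wpM2r.
have tP : 0 <= (1 - (1 - t) ^+ 2) * P by rewrite mulr_ge0 //; nra.
have KQ : 0 <= K * t * Q by rewrite mulr_ge0 // ltW.
split.
  have hP : t * ((2 - t) * P) <= t * (2 * (1 + e)) by lra.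
  rewrite ler_pM2l // in hP; nra.
have hQ' : t * (K * Q) <= t * (2 * (1 + e)) by lra.
rewrite ler_pM2l // in hQ'.
have : e * (K * Q) <= e * (2 * (1 + e)) by rewrite ler_pM2l.
rewrite mulrA [e * K]mulrC Ke mul1r; nra.
Qed.

(** On a path of slope [N] the bound on the derivative gives
    [1 - |phi|^2 <= 2 t (1 + e)] for small [t]. In the model identity on the
    diagonal the weight of [|q|^2] is at least [N t], so [|q|^2] is of order
    [1 / N], and the weight of [|p|^2] is about [2 t], so [|p|] is almost at most
    [1]. A diagonal choice of [t] for [N = 2, 3, ...] gives the sequence. *)
Lemma dirderiv_DW_point (tau s : C) :
    n tau = 1 -> n s <= 1 -> nt_limit phi (tau, s) tau ->
    (forall N : R, 0 < N -> exists2 d : C,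
       is_dirderiv phi (tau, s) (tau, s * N%:C%C) d & (d / - tau : R[i]) <= 1) ->
  left_typeI_DW_point ip phi M1 M2 u (tau, s).
Proof.
move=> tau1 s1 nt der.
have aux1 (e : R) : e <= 2^-1 -> 1 + 3 * e <= 2 ^+ 2 by move=> ?; lra.
have aux2 (e : R) : e <= 2^-1 -> 3 * e <= 2 ^+ 2 by move=> ?; lra.
have aux3 (a t e : R) : a < 1 -> 0 <= a -> t * e <= t * 2^-1 ->
    1 - a ^+ 2 <= 2 * t * (1 + e) -> 1 - a <= 4 * t by move=> ? ? ? ?; nra.
have aux4 (d e : R) : 0 < e -> d * 3 < e -> 1 + 3 * d <= (1 + e) ^+ 2.
  by move=> ? ?; nra.
have half1 : 2^-1 <= 1 :> R by rewrite invf_le1 // ler1n.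
have taus : rnorm ((tau, s) : C * C) = 1 by rewrite rnorm_pair tau1; apply/max_idPl.
have tau0 : tau != 0 by apply/eqP => e; move: tau1 (@oner_neq0 R); rewrite e rnorm0 => <-; rewrite eqxx.
pose pt (N t : R) : C * C := ((1 - t)%:C%C * tau, (1 - N * t)%:C%C * s).
(* The difference quotient, divided by [- tau]. *)
pose c (N t : R) : C := (t%:C%C)^-1 * (1 - phi (pt N t) * (tau : R[i])^*).
have cE N t : 0 < t -> 1 - phi (pt N t) * (tau : R[i])^* = t%:C%C * c N t :> R[i].
  by move=> t0; rewrite /c mulVKf // (inj_eq (@complexI _) _ 0) gt_eqF.
have near_c (N e : R) : 0 < N -> 0 < e -> \forall t \near 0^'+,
    complex.Re (c N t) <= 1 + e /\ n (tau - phi (pt N t)) <= e.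
  move=> N0 e0; have [d [l nl cv] hd] := der N N0.
  rewrite (nt_limit_unique taus nl nt) in cv.
  pose y : C := d / - tau.
  have y1 : complex.Re y <= 1 by move: hd; rewrite lecE => /andP[].
  have ye0 : 0 < e / (n y + e) by rewrite divr_gt0 // ltr_wpDl // rnorm_ge0.
  have h1 : \forall t \near 0^'+,
      n (d - (t%:C%C)^-1 *: (phi ((tau, s) - t%:C%C *: (tau, s * N%:C%C)) - tau)) < e.
    exact: (cvg_rnormP _ _).1 cv e e0.
  apply: filterS (filterI h1 (near0_pos ye0)) => t [+ /andP[t0 tye]].
  rewrite path_point -/(pt N t) (unimodular_sub _ tau1) (cE N t t0).
  have -> : (t%:C%C)^-1 *: (- tau * (t%:C%C * c N t)) = - tau * c N t :> C.
    by rewrite /GRing.scale /= mulrCA mulKf // (inj_eq (@complexI _) _ 0) gt_eqF.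
  have -> : d = - tau * y by rewrite /y mulrC divfK // oppr_eq0.
  rewrite -mulrBr rnormM rnormN tau1 mul1r => hy; split.
    have := Re_le_rnorm (c N t - y); rewrite rnormC.
    rewrite ReB.
    rewrite lerBlDr => h; apply: (le_trans h); rewrite addrC.
    exact: lerD y1 (ltW hy).
  rewrite -rnorm_1Bconj // cE // rnormM rnorm_real gtr0_norm //.
  move: tye; rewrite ler_pdivlMr ?ltr_wpDl ?rnorm_ge0 // => tye.
  apply: le_trans tye; rewrite ler_pM2l //.
  have := rnormBB (c N t) y; rewrite rnormC lerBlDr => h.
  by apply: (le_trans h); rewrite addrC; exact: lerD (lexx _) (ltW hy).
have pick (k : nat) : exists t : R, [/\ 0 < t, t <= k.+2%:R^-1 ^+ 2,
    complex.Re (c k.+2%:R t) <= 1 + k.+2%:R^-1 & n (tau - phi (pt k.+2%:R t)) <= k.+2%:R^-1].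
  have e0 : 0 < k.+2%:R^-1 :> R by rewrite invr_gt0.
  have [t [[h1 h2] /andP[h3 h4]]] := near_ex2 (near_c _ _ (ltr0Sn R k.+1) e0) (near0_pos (exprn_gt0 2 e0)).
  by exists t.
have [t ht] := choice pick.
pose K (k : nat) : R := k.+2%:R; pose d k : R := (K k)^-1.
have K1 k : 1 <= K k by rewrite ler1n.
have K0 k : 0 < K k by exact: lt_le_trans ltr01 (K1 k).
have d0 k : 0 < d k by rewrite invr_gt0.
have Kd k : K k * d k = 1 by rewrite divff // gt_eqF.
have d12 k : d k <= 2^-1 by rewrite lef_pV2 ?posrE // ler_nat.
have t0 k : 0 < t k by case: (ht k).
have td k : t k <= d k ^+ 2 by case: (ht k).
have Kt k : K k * t k <= d k.
  by rewrite -[leRHS]mul1r -(Kd k) -mulrA -expr2 ler_pM2l.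
have Kt1 k : K k * t k <= 1 by exact: (le_trans (Kt k) (le_trans (d12 k) half1)).
pose l k := pt (K k) (t k).
have lb k : unit_ball (l k) := path_unit_ball tau1 s1 (K0 k) (K1 k) (lexx _) (t0 k) (Kt1 k).
have l1 k : n (l k).1 = 1 - t k := path_fst s tau1 (K0 k) (K1 k) (lexx _) (t0 k) (Kt1 k).
have l2 k : n (l k).2 = (1 - K k * t k) * n s := path_snd tau s (K0 k) (K1 k) (lexx _) (t0 k) (Kt1 k).
have tKt k : t k <= K k * t k by rewrite -[leLHS]mul1r ler_pM2r.
have nl k : rnorm (l k) = 1 - t k.
  rewrite [l k]surjective_pairing rnorm_pair l1 l2; apply/max_idPl.
  apply: (@le_trans _ _ (1 - K k * t k)); last by rewrite lerD2l lerN2.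
  by rewrite -[leRHS]mulr1 ler_wpM2l // subr_ge0.
have defect k : 1 - n (phi (l k)) ^+ 2 <= 2 * t k * (1 + d k).
  have tt : (tau : R[i])^* * tau = 1 by rewrite mulrC mul_conjE tau1 expr1n.
  have -> : n (phi (l k)) = n (1 - (t k)%:C%C * c (K k) (t k)).
    by rewrite -(cE _ _ (t0 k)) subKr rnormM rnorm_conj tau1 mulr1.
  have [_ _ + _] := ht k; rewrite -/(K k) -/(d k) => hc.
  have -> : 1 - n (1 - (t k)%:C%C * c (K k) (t k)) ^+ 2 =
      2 * t k * complex.Re (c (K k) (t k)) - t k ^+ 2 * n (c (K k) (t k)) ^+ 2.
    by rewrite !rnorm_sqr; case: (c (K k) (t k)) => y z /=; ring.
  apply: (@le_trans _ _ (2 * t k * complex.Re (c (K k) (t k)))).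
    by rewrite gerBl mulr_ge0 ?sqr_ge0.
  by rewrite ler_pM2l // mulr_gt0.
have est k : rnorm (p (l k)) ^+ 2 <= 1 + 3 * d k /\ rnorm (q (l k)) ^+ 2 <= 3 * d k.
  apply: (@slow_path_estimate (t k) (d k) (K k) (n s ^+ 2)); rewrite ?sqr_ge0 //.
    by rewrite expr_le1 // rnorm_ge0.
  have := model_diag ip_norm model (lb k); rewrite l1 l2 exprMn => <-.
  exact: defect.
have sqle (y B : R) : 0 <= y -> 0 <= B -> y ^+ 2 <= B ^+ 2 -> y <= B.
  by move=> y0 B0; rewrite ler_sqr ?nnegrE.
have small (e : R) : 0 < e -> \forall k \near \oo, d k < e by exact: inv_nat_small.
have phik k : n (tau - phi (l k)) <= d k by case: (ht k).
apply: (@DW_point_of_sequence tau s l 2 4) => //.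
- apply/cvg_pairP; split; apply/cvg_rnormP => e e0; apply: filterS (small _ e0) => k de; rewrite /l /pt /=.
    rewrite -{1}[tau]mul1r -mulrBl rnormM tau1 mulr1 -(rmorph1 (real_complex R)) -rmorphB.
    rewrite rnorm_real opprB addrCA subrr addr0 gtr0_norm //.
    by apply: (le_lt_trans (tKt k)); apply: (le_lt_trans (Kt k)).
  rewrite -{1}[s]mul1r -mulrBl rnormM -(rmorph1 (real_complex R)) -rmorphB.
  rewrite rnorm_real opprB addrCA subrr addr0 gtr0_norm ?mulr_gt0 //.
  apply: le_lt_trans de; apply: le_trans (Kt k).
  by rewrite -[leRHS]mulr1 ler_wpM2l // mulr_ge0 // ltW.
- move=> k; rewrite julia_quotient_le ?nl; last by rewrite gtrBl.
  have f1 : n (phi (l k)) < 1 by apply/unit_ballE/phi_disk.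
  rewrite subKr; apply: (aux3 _ _ (d k) f1 (rnorm_ge0 _) _ (defect k)).
  by rewrite ler_pM2l.
- apply/cvg_rnormP => e e0; apply: filterS (small _ e0) => k; exact: le_lt_trans.
- move=> k; apply: sqle; rewrite ?rnorm_ge0 //; have [h _] := est k.
  exact: (le_trans h (aux1 _ (d12 k))).
- move=> k; apply: sqle; rewrite ?rnorm_ge0 //; have [_ h] := est k.
  exact: (le_trans h (aux2 _ (d12 k))).
- move=> e e0; apply: filterS (small _ (divr_gt0 e0 (ltr0n R 3))) => k.
  rewrite ltr_pdivlMr // => de; have [h _] := est k.
  apply: sqle; rewrite ?rnorm_ge0 ?addr_ge0 ?(ltW e0) //; exact: (le_trans h (aux4 _ _ e0 de)).
- move=> e e0; apply: filterS (small _ (divr_gt0 (exprn_gt0 2 e0) (ltr0n R 3))) => k.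
  rewrite ltr_pdivlMr // => de; have [_ h] := est k.
  by apply: sqle; rewrite ?rnorm_ge0 ?(ltW e0) //; apply: (le_trans h); rewrite mulrC ltW.
Qed.

(** The arithmetic of the next lemma: with [L] the limit of the values [A] on the
    radius, the residual [E - (1 - (1 - t) ^+ 2) * (A ^+ 2 / L)] is small compared
    to the defect of the radial point. The factor [L] makes the conclusion
    polynomial. *)
Lemma sharp_estimate (L t b eta A E : R) :
    0 < L -> 0 < t -> t <= b -> t <= 2^-1 -> 0 <= A -> A <= 2 ->
    E <= A * (2 * t) -> (L - b) * A <= A ^+ 2 -> b * (2 * L + 4) <= eta * L ->
  0 <= L * (eta * (1 - (1 - t) ^+ 2) - (E - (1 - (1 - t) ^+ 2) * (A ^+ 2 / L))).
Proof.
move=> L0 t0 tb t1 A0 A2 hE hA hb.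
have -> : L * (eta * (1 - (1 - t) ^+ 2) - (E - (1 - (1 - t) ^+ 2) * (A ^+ 2 / L))) =
    L * eta * t * (2 - t) - L * E + t * (2 - t) * A ^+ 2.
  by field; rewrite gt_eqF.
have h1 : L * E <= L * (A * (2 * t)) by rewrite ler_pM2l.
have h2 : t * (2 - t) * ((L - b) * A) <= t * (2 - t) * A ^+ 2.
  by rewrite ler_wpM2l // mulr_ge0 ?(ltW t0) //; lra.
have b0 : 0 <= b by rewrite (le_trans _ tb) // ltW.
have h3 : t * A <= b * 2 by apply: ler_pM => //; exact: ltW.
have h4 : L * (t * A) <= L * (b * 2) by rewrite ler_pM2l.
have h5 : b * A <= b * 2 by rewrite ler_wpM2l.
have h6 : 0 <= t * (b * A) by rewrite !mulr_ge0 // ltW.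
have eL : 0 <= eta * L by apply: le_trans hb; rewrite mulr_ge0 //; lra.
have h7 : eta * L * 1 <= eta * L * (2 - t) by rewrite ler_wpM2l //; lra.
have h8 : 0 <= t * (L * eta * (2 - t) - 2 * L * A + (2 - t) * ((L - b) * A)).
  by rewrite mulr_ge0 ?(ltW t0) //; lra.
by move: h1 h2 h8; lra.
Qed.

(** All representing vectors have the same inner products with [p l], as the
    representation determines them. The one obtained as a weak limit of [u] along
    the radius is in addition a limit of the vectors [p l] against itself, so that
    its squared norm is the limit [L] of these inner products; this is what makes
    the residuals on the radius small. *)
Lemma sharp_representation (tau : C) (x : M) :
    n tau = 1 -> rnorm x <= 1 -> represents tau tau x ->
  exists y : M, [/\ 0 < rnorm y, rnorm y <= 1, represents tau tau y &
    forall eta : R, 0 < eta -> exists r : R,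
      [/\ 0 <= r, r < 1,
          1 - n (phi (r%:C%C * tau, 0 : C)) ^+ 2 -
          (1 - n (r%:C%C * tau) ^+ 2) *
            (n (ip (p (r%:C%C * tau, 0 : C)) y) ^+ 2 / rnorm y ^+ 2) <=
            eta * (1 - r ^+ 2) &
          rnorm y ^+ 2 <= 2 * n (ip (p (r%:C%C * tau, 0 : C)) y)]].
Proof.
move=> tau1 x1 hx; have s1 : n (0 : C) <= 1 by rewrite rnorm0.
pose l (t : R) : C * C := ((1 - t)%:C%C * tau, (1 - 1 * t)%:C%C * 0).
have lE t : l t = ((1 - t)%:C%C * tau, 0 : C) by rewrite /l mulr0.
have [L /andP[L0 L1] aL] := path_limit tau1 s1 x1 hx ltr01 (lexx 1) (lexx 1).
rewrite -/l in aL.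
pose d (k : nat) : R := k.+2%:R^-1.
have d0 k : 0 < d k by rewrite invr_gt0.
have d12 k : d k <= 2^-1 by rewrite lef_pV2 ?posrE // ler_nat.
have d1 k : 1 * d k <= 1 by rewrite mul1r; have := d12 k; lra.
have small (e : R) : 0 < e -> \forall k \near \oo, d k < e by exact: inv_nat_small.
pose lk k := l (d k).
have lb k : unit_ball (lk k) := path_unit_ball tau1 s1 ltr01 (lexx 1) (lexx 1) (d0 k) (d1 k).
have l1 k : n (lk k).1 = 1 - d k := path_fst 0 tau1 ltr01 (lexx 1) (lexx 1) (d0 k) (d1 k).
have l2 k : n (lk k).2 = 0 by rewrite /lk lE rnorm0.
have ell k : n (1 - (lk k).1 * (tau : R[i])^*) = 1 - (1 - d k).
  by rewrite /lk /l path_ell // rnorm_real gtr0_norm // opprB addrCA subrr addr0.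
have r0 k : 0 <= 1 - d k by have := d12 k; lra.
have bounds k := radial_bounds ip_norm phi_disk model tau1 hx x1 (lb k) (r0 k) (l1 k) (ell k).
have sqle (y B : R) : 0 <= y -> 0 <= B -> y ^+ 2 <= B ^+ 2 -> y <= B.
  by move=> y0 B0; rewrite ler_sqr ?nnegrE.
have ple k : rnorm (p (lk k)) <= 1 + d k.
  have [h _ _] := bounds k; have := rnorm_ge0 (p (lk k)); move: h (d0 k) (d12 k).
  by move: (rnorm (p (lk k))) (d k) => P e; nra.
have q2le k : rnorm (q (lk k)) ^+ 2 <= 4 * d k.
  by have [_ _] := bounds k; rewrite l2 expr0n subr0 mul1r; move: (d k) => e; lra.
have phik k : n (tau - phi (lk k)) <= 2 * d k.
  by rewrite -rnorm_1Bconj //; have [_ h _] := bounds k; move: (d k) h => e; lra.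
have pB k : rnorm (p (lk k)) <= 2 by apply: (le_trans (ple k)); have := d12 k; lra.
have qB k : rnorm (q (lk k)) <= 2.
  apply: sqle; rewrite ?rnorm_ge0 //; apply: (le_trans (q2le k)); have := d12 k; lra.
have p1 (e : R) : 0 < e -> \forall k \near \oo, rnorm (p (lk k)) <= 1 + e.
  move=> e0; apply: filterS (small e e0) => k de; apply: (le_trans (ple k)).
  by rewrite lerD2l ltW.
have q0 (e : R) : 0 < e -> \forall k \near \oo, rnorm (q (lk k)) <= e.
  move=> e0; apply: filterS (small _ (divr_gt0 (exprn_gt0 2 e0) (ltr0n R 4))) => k.
  rewrite ltr_pdivlMr // => de; apply: sqle; rewrite ?rnorm_ge0 ?(ltW e0) //.
  by apply: (le_trans (q2le k)); rewrite mulrC ltW.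
have [k [hk [v [hv v1 v2]]]] := face_sequence_weak_limit pB qB p1 q0.
have phil : phi (lk m) @[m --> \oo] --> tau.
  apply/cvg_rnormP => e e0; apply: filterS (small _ (divr_gt0 e0 (ltr0n R 2))) => m.
  by rewrite ltr_pdivlMr // => de; apply: (le_lt_trans (phik m)); rewrite mulrC.
have lt : lk m @[m --> \oo] --> (tau, 0 : C).
  apply/cvg_rnormP => e e0; apply: filterS (small e e0) => m de.
  rewrite /lk lE.
  have -> : ((tau, 0) : C * C) - ((1 - d m)%:C%C * tau, 0 : C) = ((d m)%:C%C * tau, 0).
    rewrite (_ : (d m)%:C%C * tau = tau - (1 - d m)%:C%C * tau); last first.
      by rewrite rmorphB rmorph1; ring.
    by congr pair; rewrite subr0.
  by rewrite rnorm_pair rnorm0 rnormM tau1 mulr1 rnorm_real gtr0_norm // (max_idPl _) // ltW.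
set y := oproj ip M1 v in v1.
have hy : represents tau tau y.
  exact: (weak_limit_represents (fun m => lb (k m)) (cvg_subsequence hk lt) (cvg_subsequence hk phil) hv v2).
have tne (t : R) : 0 < t -> 1 - (l t).1 * (tau : R[i])^* != 0.
  by move=> t0; rewrite path_ell // (inj_eq (@complexI _) _ 0) gt_eqF.
have ayE t : 0 < t -> 1 * t <= 1 -> ip (p (l t)) y = ip (p (l t)) x.
  move=> t0 tt1; have lt1 := path_unit_ball tau1 s1 ltr01 (lexx 1) (lexx 1) t0 tt1.
  by apply: (mulfI (tne t t0)); rewrite -hx // -hy.
have dk : d (k m) @[m --> \oo] --> (0 : R)^'+.
  move=> A [e /= e0 hA]; have [K _ hK] := small e e0; exists K => // m /= Km.
  apply: hA => //=; rewrite sub0r normrN gtr0_norm //.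
  exact: (hK (k m) (leq_trans Km (hk m))).
have akL : (ip (p (lk (k m))) y : C) @[m --> \oo] --> (L%:C%C : C).
  rewrite (_ : (fun m => ip (p (lk (k m))) y : C) = (fun m => ip (p (l (d (k m)))) x : C)); last first.
    by apply/funext => m; rewrite /lk ayE.
  exact: (cvg_comp _ _ dk aL).
have Y2 : rnorm y ^+ 2 = L.
  apply: complexI; rewrite -(ip_sqr ip_norm).
  have -> : ip y y = ip v y by rewrite [RHS]ipC -(ip_oproj v v dec) -ipC.
  have c2 : (ip (u (lk (k m))) y : C) @[m --> \oo] --> (ip v y : C) by exact: hv.
  have e2 m : ip (u (lk (k m))) y = ip (p (lk (k m))) y.
    by rewrite ipC -(ip_oproj v (u (lk (k m))) dec) -ipC.
  rewrite (_ : (fun m => ip (u (lk (k m))) y : C) = (fun m => ip (p (lk (k m))) y : C)) in c2.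
    exact: (cvg_unique (@norm_hausdorff _ C) c2 akL).
  by apply/funext => m; rewrite e2.
exists y; have y0 : 0 < rnorm y.
  by rewrite lt_def rnorm_ge0 andbT; apply/eqP => y0; move: Y2 L0; rewrite y0 expr0n /= => <-; rewrite ltxx.
split=> // eta eta0; rewrite Y2.
pose b := Num.min (L / 2) (eta * L / (2 * L + 4)).
have L4 : 0 < 2 * L + 4 by lra.
have b0 : 0 < b by rewrite lt_min !divr_gt0 // mulr_gt0.
have [b1 b2] : b <= L / 2 /\ b <= eta * L / (2 * L + 4).
  by split; rewrite ge_min lexx ?orbT.
have b12 : 0 < Num.min b 2^-1 by rewrite lt_min b0 /= invr_gt0.
have h1 : \forall t \near 0^'+, n (L%:C%C - ip (p (l t)) x) < b.
  exact: (cvg_rnormP _ _).1 aL b b0.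
have [t [h2 /andP[t0 tb]]] := near_ex2 h1 (near0_pos b12).
have [tb1 tb2] : t <= b /\ t <= 2^-1 by move: tb; rewrite le_min => /andP.
have tt1 : 1 * t <= 1 by lra.
have [h3 _ h4] := path_bounds tau1 s1 x1 hx ltr01 (lexx 1) (lexx 1) t0 tt1.
rewrite -/(l t) -(ayE t t0 tt1) in h2 h3 h4.
have hr := Re_le_rnorm (ip (p (l t)) y : C).
exists (1 - t); rewrite -lE; split; [lra|lra| |].
  have -> : n ((1 - t)%:C%C * tau) = 1 - t.
    by rewrite rnormM tau1 mulr1 rnorm_real ger0_norm //; lra.
  move: h3; rewrite ler_pdivrMr ?mulr_gt0 // => h3.
  have h5 : L - b <= n (ip (p (l t)) y).
    have := rnormBB (L%:C%C : C) (ip (p (l t)) y : C).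
    by rewrite rnorm_real gtr0_norm // => h; have := le_trans h (ltW h2); lra.
  have b2' : b * (2 * L + 4) <= eta * L by move: b2; rewrite ler_pdivlMr.
  rewrite -subr_ge0 -(pmulr_rge0 _ L0).
  have h6 : complex.Re (ip (p (l t)) y) * (2 * t) <= n (ip (p (l t)) y) * (2 * t).
    by rewrite ler_pM2r // mulr_gt0.
  have {h6}h3 := le_trans h3 h6.
  have AL : (L - b) * n (ip (p (l t)) y) <= n (ip (p (l t)) y) ^+ 2.
    by rewrite expr2 ler_pM2r // (lt_le_trans _ h5) // subr_gt0; lra.
  have A0 := rnorm_ge0 (ip (p (l t)) y : C).
  exact: (sharp_estimate L0 t0 tb1 tb2 A0 h4 h3 AL b2').
have := rnormBB (L%:C%C : C) (ip (p (l t)) y : C).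
rewrite rnorm_real gtr0_norm // => h; have := le_trans h (ltW h2).
by move: (n (ip (p (l t)) y)) => A; lra.
Qed.

(** * The angular derivative and the limit of the directional derivatives *)

Section Sharp.
Variables (tau : C) (y : M).
Hypotheses (tau1 : n tau = 1) (y0 : 0 < rnorm y) (y1 : rnorm y <= 1).
Hypothesis hy : represents tau tau y.
Hypothesis radial : forall eta : R, 0 < eta -> exists r : R,
  [/\ 0 <= r, r < 1,
      1 - n (phi (r%:C%C * tau, 0 : C)) ^+ 2 -
      (1 - n (r%:C%C * tau) ^+ 2) *
        (n (ip (p (r%:C%C * tau, 0 : C)) y) ^+ 2 / rnorm y ^+ 2) <=
        eta * (1 - r ^+ 2) &
      rnorm y ^+ 2 <= 2 * n (ip (p (r%:C%C * tau, 0 : C)) y)].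

Let limit (eps A c : R) : 0 < eps -> 0 < A -> 0 < c ->
  exists delta kappa : R, [/\ 0 < delta, 0 < kappa &
    forall l, unit_ball l -> n (tau - l.1) <= delta -> n (ip (p l) y) <= A ->
      n (tau - l.1) <= c * (1 - n l.1 ^+ 2) ->
      n (tau - l.1) <= kappa * (1 - n l.2 ^+ 2) ->
      n (ip (p l) y - (rnorm y ^+ 2)%:C%C) <= eps].
Proof.
move=> e0 A0 c0.
have [delta [kappa [d0 k0 h]]] := cara_limit ip_norm phi_disk model tau1 hy y0 e0 A0 c0 radial.
exists delta, kappa; split=> // l hl; rewrite -!(rnorm_1Bconj _ tau1); exact: h.
Qed.

(** The difference quotient of the slice is [ip (p l) y], and [cara_limit] applies:
    [c] is given by the region of approach, and the condition on the second
    coordinate holds near [tau] because that coordinate is fixed. *)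
Lemma angular_derivative (mu : C) : unit_ball mu ->
  is_angular_derivative (fun z : C => phi (z, mu)) tau (rnorm y ^+ 2)%:C%C.
Proof.
move=> /unit_ballE mu1.
have slice (z : C) : unit_ball z -> unit_ball ((z, mu) : C * C).
  by move=> /unit_ballE hz; apply/bidiskP; split.
have quot (S : set C) : approaches_nt S tau ->
    (ip (p (z, mu)) y : C) @[z --> within S (nbhs tau)] --> ((rnorm y ^+ 2)%:C%C : C).
  move=> [Sb Scl [c c0 Sc]]; have FF := within_nbhs_proper Scl.
  apply/cvg_rnormP => e e0; have e2 : 0 < e / 2 by rewrite divr_gt0.
  have A0 : 0 < 2 * c * rnorm y ^+ 2 by rewrite mulr_gt0 ?exprn_gt0 // mulr_gt0.
  have [delta [kappa [d0 k0 h]]] := limit e2 A0 c0.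
  have km : 0 < kappa * (1 - n mu ^+ 2) by rewrite mulr_gt0 // disk_sqr_lt1.
  have near_tau : \forall z \near nbhs tau, n (tau - z) < Num.min delta (kappa * (1 - n mu ^+ 2)).
    by apply/nbhs_rnormP; exists (Num.min delta (kappa * (1 - n mu ^+ 2))); rewrite // lt_min d0.
  apply: filterS near_tau => z; rewrite lt_min => /andP[zd zk] Sz.
  have hz := Sb _ Sz; have z1 : n z < 1 by apply/unit_ballE.
  have zc : n (tau - z) <= c * (1 - n z) by exact: Sc.
  have zc2 : n (tau - z) <= c * (1 - n z ^+ 2).
    apply: (le_trans zc); rewrite ler_pM2l // lerD2l lerN2 expr2.
    by rewrite -[leRHS]mulr1 ler_wpM2l ?rnorm_ge0 // ltW.
  have aA : n (ip (p (z, mu)) y) <= 2 * c * rnorm y ^+ 2.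
    apply: (nontangential_cara_bound ip_norm phi_disk model tau1 hy (slice z hz)).
    by rewrite rnorm_1Bconj.
  have := h (z, mu) (slice z hz) (ltW zd) aA zc2 (ltW zk).
  by rewrite rnormC => hh; apply: (le_lt_trans hh); rewrite ltr_pdivrMr // ltr_pMr // ltr1n.
have value z : unit_ball z -> phi (z, mu) - tau = (z - tau) * ip (p (z, mu)) y :> R[i].
  move=> hz; rewrite (unimodular_sub _ tau1) (unimodular_sub z tau1) (hy (slice z hz)) /=.
  by rewrite mulrA.
have ne z : unit_ball z -> z - tau != 0.
  move=> /unit_ballE hz; rewrite subr_eq0; apply/eqP => e.
  by move: hz; rewrite e tau1 ltxx.
exists tau; split; first by rewrite rnormE tau1.
- move=> S hS; have [Sb Scl _] := hS; have FF := within_nbhs_proper Scl.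
  have c1 : ((z - tau) * ip (p (z, mu)) y + tau : C) @[z --> within S (nbhs tau)] --> (tau : C).
    rewrite -[X in _ --> X]add0r; apply: cvgD; last exact: cvg_cst.
    rewrite -(mul0r (rnorm y ^+ 2)%:C%C); apply: cvgM; last exact: quot.
    rewrite -(subrr tau); apply: cvgB; last exact: cvg_cst.
    by apply: cvg_within_filter; exact: cvg_id.
  apply: cvg_trans c1; apply: near_eq_cvg; apply: (@filterS _ (nbhs tau)) (filterT) => z _ Sz.
  by rewrite -value ?subrK //; exact: Sb.
- move=> S hS; have [Sb Scl _] := hS; have FF := within_nbhs_proper Scl.
  apply: cvg_trans (quot S hS); apply: near_eq_cvg; apply: (@filterS _ (nbhs tau)) (filterT) => z _ Sz.
  by rewrite value ?[_ * ip _ _]mulrC ?mulfK //; [exact: ne (Sb _ Sz)|exact: Sb].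
Qed.

(** On the path of slope [N] the second coordinate [z] satisfies
    [1 - |z|^2 >= N t], so [cara_limit] applies to the points of the path once [N]
    exceeds [1 / kappa]; this confines the limits [L N] for all such [N]. *)
Lemma dirderiv_limit (s : C) : n s <= 1 -> exists2 D : R -> C,
  forall N : R, 0 < N -> is_dirderiv phi (tau, s) (tau, s * N%:C%C) (D N) &
  D N @[N --> +oo%R] --> (- tau * (rnorm y ^+ 2)%:C%C : C).
Proof.
move=> s1; pose l (N t : R) : C * C := ((1 - t)%:C%C * tau, (1 - N * t)%:C%C * s).
have aux1 (t : R) : 0 < t -> t <= 1 -> t <= 1 - (1 - t) ^+ 2 by move=> ? ?; nra.
have aux2 (a b : R) : 0 < a -> a <= 1 -> b <= (1 - a) ^+ 2 * 1 -> a <= 1 - b.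
  by move=> ? ? ?; nra.
have ex N : exists L : R, 0 < N -> (ip (p (l N t)) y : C) @[t --> 0^'+] --> (L%:C%C : C).
  have [N0|N0] := ltP 0 N; last by exists 0.
  have m1 : 1 <= Num.max 1 N by rewrite le_max lexx.
  have Nm : N <= Num.max 1 N by rewrite le_max lexx orbT.
  by have [L _ hL] := path_limit tau1 s1 y1 hy N0 m1 Nm; exists L.
have [L hL] := choice ex.
exists (fun N => - tau * (L N)%:C%C).
  by move=> N N0; exact: (represents_dirderiv tau1 s1 hy N0 (hL N N0)).
apply: cvgM; first exact: cvg_cst.
apply/cvg_rnormP => e e0; have e2 : 0 < e / 2 by rewrite divr_gt0.
have e4 : 0 < e / 4 by rewrite divr_gt0.
have [delta [kappa [d0 k0 h]]] := limit e2 (ltr0n R 2) ltr01.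
near=> N.
have N1 : 1 <= N by near: N; apply: nbhs_pinfty_ge; exact: num_real.
have Nk : 1 <= kappa * N.
  by rewrite -ler_pdivrMl // mulr1; near: N; apply: nbhs_pinfty_ge; exact: num_real.
have N0 : 0 < N by exact: lt_le_trans ltr01 N1.
have h1 : \forall t \near 0^'+, n ((L N)%:C%C - ip (p (l N t)) y) < e / 4.
  exact: (cvg_rnormP _ _).1 (hL N N0) _ e4.
have N0' : 0 < N^-1 by rewrite invr_gt0.
have [t [h2 [/andP[t0 td] /andP[_ tN]]]] :=
  near_ex2 h1 (filterI (near0_pos d0) (near0_pos N0')).
have Nt : N * t <= 1 by rewrite mulrC -ler_pdivlMr // div1r.
have lb : unit_ball (l N t) := path_unit_ball tau1 s1 N0 N1 (lexx _) t0 Nt.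
have l1 : n (l N t).1 = 1 - t := path_fst s tau1 N0 N1 (lexx _) t0 Nt.
have l2 : n (l N t).2 = (1 - N * t) * n s := path_snd tau s N0 N1 (lexx _) t0 Nt.
have t1 : t <= 1 by apply: le_trans Nt; rewrite -[leLHS]mul1r ler_pM2r.
have ell : n (tau - (l N t).1) = t.
  by rewrite -(rnorm_1Bconj _ tau1) path_ell // rnorm_real gtr0_norm.
have [_ _ aA] := path_bounds tau1 s1 y1 hy N0 N1 (lexx _) t0 Nt.
have h3 : n (ip (p (l N t)) y - (rnorm y ^+ 2)%:C%C) <= e / 2.
  apply: h => //; rewrite ell //.
    by rewrite l1 mul1r; exact: aux1.
  rewrite l2; apply: (@le_trans _ _ (kappa * (N * t))).
    by rewrite mulrA -[leLHS]mul1r ler_pM2r.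
  rewrite ler_pM2l // exprMn.
  have Nt0 : 0 < N * t by rewrite mulr_gt0.
  apply: (aux2 _ _ Nt0 Nt); rewrite ler_wpM2l ?sqr_ge0 //.
  by rewrite expr_le1 ?rnorm_ge0.
have -> : (rnorm y ^+ 2)%:C%C - (L N)%:C%C =
    - (ip (p (l N t)) y - (rnorm y ^+ 2)%:C%C) - ((L N)%:C%C - ip (p (l N t)) y) :> C.
  by ring.
apply: (le_lt_trans (rnormB _ _)); rewrite rnormN.
apply: (le_lt_trans (lerD h3 (ltW h2))).
by rewrite [ltRHS]splitr ltrD2l ltr_pM2l // ltf_pV2 ?posrE // ltr_nat.
Unshelve. all: by end_near.
Qed.

End Sharp.

(** * The equivalences *)

Section Equivalences.
Hypothesis phi_cont : forall l, unit_ball l -> phi @ l --> phi l.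
Variable tau : C.
Hypotheses (tau1 : `|tau| = 1) (phi_neq_fst : ~ {in unit_ball, phi =1 fst}).

Let dir_cond (s : C) : Prop :=
  [/\ B_point phi (tau, s), nt_limit phi (tau, s) tau &
      forall t : R, 0 < t -> exists2 d : C,
        is_dirderiv phi (tau, s) (tau, s * t%:C%C) d & (d / - tau : R[i]) <= 1].
Let some_DW_point := exists2 s : C, `|s| <= 1 & left_typeI_DW_point ip phi M1 M2 u (tau, s).
Let all_DW_points := forall s : C, `|s| <= 1 -> left_typeI_DW_point ip phi M1 M2 u (tau, s).
Let typeI := left_typeI phi /\
  forall mu : C, unit_ball mu -> denjoy_wolff_point (fun z => phi (z, mu)) tau.
Let some_dir_cond := exists2 s : C, `|s| <= 1 & dir_cond s.
Let all_dir_conds := forall s : C, `|s| <= 1 -> dir_cond s.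

Let ntau : n tau = 1.
Proof. by apply: complexI; rewrite -rnormE tau1. Qed.

Let norm_le1 (s : C) : `|s| <= 1 -> n s <= 1.
Proof. by rewrite rnormE -(rmorph1 (real_complex R)) lecR. Qed.

Let norm0_le1 : `|0 : C| <= 1 :> R[i].
Proof. by rewrite normr0 ler01. Qed.

Let some_representation : some_DW_point -> exists2 x, rnorm x <= 1 & represents tau tau x.
Proof. by case=> s _; exact: DW_point_represents. Qed.

Let dir_cond_DW_point s : `|s| <= 1 -> dir_cond s -> left_typeI_DW_point ip phi M1 M2 u (tau, s).
Proof. by move=> /norm_le1 s1 [_ nt der]; exact: dirderiv_DW_point. Qed.

Let representation_dir_cond x s : rnorm x <= 1 -> represents tau tau x ->
  `|s| <= 1 -> dir_cond s.
Proof.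
move=> x1 hx /norm_le1 s1; have [_ _ B nt _] := represents_DW_point ntau s1 x1 hx.
split=> // N N0.
have m1 : 1 <= Num.max 1 N by rewrite le_max lexx.
have Nm : N <= Num.max 1 N by rewrite le_max lexx orbT.
have [L /andP[_ L1] aL] := path_limit ntau s1 x1 hx N0 m1 Nm.
exists (- tau * L%:C%C); first exact: (represents_dirderiv ntau s1 hx N0 aL).
have tau0 : - tau != 0.
  by rewrite oppr_eq0; apply/eqP => e; move: tau1; rewrite e normr0 => /eqP; rewrite eq_sym oner_eq0.
by rewrite mulrAC divff // mul1r -(rmorph1 (real_complex R)) lecR.
Qed.

Let typeI_DW_point : typeI -> some_DW_point.
Proof.
case=> _ dw; exists 0; first exact: norm0_le1.
by apply: denjoy_wolff_DW_point; apply: dw; apply/unit_ballE; rewrite rnorm0.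
Qed.

Let some_to_all : some_DW_point -> all_DW_points.
Proof.
by move=> /some_representation[x x1 hx] s /norm_le1 s1; exact: (represents_DW_point ntau s1 x1 hx).
Qed.

Let all_to_some : all_DW_points -> some_DW_point.
Proof. by move=> h; exists 0; [exact: norm0_le1|apply: h; exact: norm0_le1]. Qed.

Let some_dir_to_DW : some_dir_cond -> some_DW_point.
Proof. by move=> [s s1 h]; exists s => //; exact: dir_cond_DW_point. Qed.

Let some_to_all_dir : some_DW_point -> all_dir_conds.
Proof. by move=> /some_representation[x x1 hx] s s1; exact: (representation_dir_cond x1 hx). Qed.

Let all_to_some_dir : all_dir_conds -> some_dir_cond.
Proof. by move=> h; exists 0; [exact: norm0_le1|apply: h; exact: norm0_le1]. Qed.

Lemma left_typeI_equivalences :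
  [<-> some_DW_point; all_DW_points; typeI; some_dir_cond; all_dir_conds].
Proof.
tfae.
- exact: some_to_all.
- move=> /all_to_some/some_representation[x x1 hx].
  have dw (mu : C) : unit_ball mu -> denjoy_wolff_point (fun z => phi (z, mu)) tau.
    by move=> mu1; exact: (represents_denjoy_wolff phi_cont ntau x1 hx phi_neq_fst mu1).
  by split=> //; split=> //; exists tau.
- by move=> /typeI_DW_point/some_to_all_dir/all_to_some_dir.
- by move=> /some_dir_to_DW/some_to_all_dir.
- by move=> /all_to_some_dir/some_dir_to_DW.
Qed.

Lemma left_typeI_derivatives :
  [\/ some_DW_point, all_DW_points, typeI | some_dir_cond \/ all_dir_conds] ->
  forall mu : C, unit_ball mu -> exists2 a : C,
    is_angular_derivative (fun z => phi (z, mu)) tau a &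
    forall s : C, `|s| <= 1 -> exists2 D : R -> C,
      forall t : R, 0 < t -> is_dirderiv phi (tau, s) (tau, s * t%:C%C) (D t) &
      D t @[t --> +oo%R] --> (- tau * a : C).
Proof.
move=> h; have {h} : some_DW_point.
  case: h => [//|/all_to_some//|/typeI_DW_point//|[/some_dir_to_DW//|]].
  by move=> /all_to_some_dir/some_dir_to_DW.
move=> /some_representation[x x1 hx] mu mu1.
have [y [y0 y1 hy radial]] := sharp_representation ntau x1 hx.
exists (rnorm y ^+ 2)%:C%C; first exact: angular_derivative.
by move=> s /norm_le1; exact: dirderiv_limit.
Qed.

End Equivalences.

End Face.

(** * The second variable *)

Section Tilde.
Context {R : realType}.
Local Notation C := (Cplx R).
Implicit Types (phi : C * C -> C).

Lemma tilde_swap phi : tilde phi \o swap = phi.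
Proof. by apply/funext => l; rewrite /tilde /= -surjective_pairing. Qed.

Lemma B_point_tilde phi (a b : C) : B_point (tilde phi) (a, b) <-> B_point phi (b, a).
Proof.
split=> [/B_point_swap|/B_point_swap]; last exact.
by rewrite tilde_swap.
Qed.

Lemma nt_limit_tilde phi (a b w : C) :
  nt_limit (tilde phi) (a, b) w <-> nt_limit phi (b, a) w.
Proof.
split=> [/nt_limit_swap|/nt_limit_swap]; last exact.
by rewrite tilde_swap.
Qed.

Lemma is_dirderiv_tilde phi (a b a' b' d : C) :
  is_dirderiv (tilde phi) (a, b) (a', b') d <-> is_dirderiv phi (b, a) (b', a') d.
Proof.
split=> [/is_dirderiv_swap|/is_dirderiv_swap]; last exact.
by rewrite tilde_swap.
Qed.

Lemma continuous_tilde phi :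
  (forall l, unit_ball l -> phi @ l --> phi l) ->
  forall l, unit_ball l -> tilde phi @ l --> tilde phi l.
Proof.
move=> h l l1 A hA; have := nbhs_swap (h (swap l) ((swap_unit_ball l).2 l1) A hA).
by rewrite swapK.
Qed.

End Tilde.
Theorem theorem2p9 (R : realType) (M : completeNormedModType R[i])
    (ip : {dot M for Num.conj}) (M1 M2 : set M)
    (u : Cplx R * Cplx R -> M) (phi : Cplx R * Cplx R -> Cplx R)
    (phi_hol : holomorphic_on unit_ball phi)
    (phi_disk : forall l, unit_ball l -> unit_ball (phi l))
    (phi_model : is_model ip phi M1 M2 u) :
  (forall tau1 : Cplx R, `|tau1| = 1 -> ~ {in unit_ball, phi =1 fst} ->
    let dir_cond (s : Cplx R) :=
      [/\ B_point phi (tau1, s), nt_limit phi (tau1, s) tau1 &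
          forall t : R, 0 < t -> exists2 d : Cplx R,
            is_dirderiv phi (tau1, s) (tau1, s * t%:C%C) d &
            (d / - tau1 : R[i]) <= 1] in
    let i := exists2 s : Cplx R, `|s| <= 1 &
      left_typeI_DW_point ip phi M1 M2 u (tau1, s) in
    let ii := forall s : Cplx R, `|s| <= 1 ->
      left_typeI_DW_point ip phi M1 M2 u (tau1, s) in
    let iii := left_typeI phi /\
      forall mu : Cplx R, unit_ball mu ->
        denjoy_wolff_point (fun z => phi (z, mu)) tau1 in
    let iv := exists2 s : Cplx R, `|s| <= 1 & dir_cond s in
    let v := forall s : Cplx R, `|s| <= 1 -> dir_cond s in
    [<-> i; ii; iii; iv; v] /\
    ([\/ i, ii, iii | iv \/ v] ->
      forall mu : Cplx R, unit_ball mu ->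
      exists2 a : Cplx R,
        is_angular_derivative (fun z => phi (z, mu)) tau1 a &
        forall s : Cplx R, `|s| <= 1 ->
        exists2 D : R -> Cplx R,
          forall t : R, 0 < t ->
            is_dirderiv phi (tau1, s) (tau1, s * t%:C%C) (D t) &
          D t @[t --> +oo%R] --> (- tau1 * a : Cplx R)))
  /\
  (forall tau2 : Cplx R, `|tau2| = 1 -> ~ {in unit_ball, phi =1 snd} ->
    let dir_cond (s : Cplx R) :=
      [/\ B_point phi (s, tau2), nt_limit phi (s, tau2) tau2 &
          forall t : R, 0 < t -> exists2 d : Cplx R,
            is_dirderiv phi (s, tau2) (s * t%:C%C, tau2) d &
            (d / - tau2 : R[i]) <= 1] in
    let i := exists2 s : Cplx R, `|s| <= 1 &
      right_typeI_DW_point ip phi M1 M2 u (s, tau2) in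
    let ii := forall s : Cplx R, `|s| <= 1 ->
      right_typeI_DW_point ip phi M1 M2 u (s, tau2) in
    let iii := right_typeI phi /\
      forall l : Cplx R, unit_ball l ->
        denjoy_wolff_point (fun z => phi (l, z)) tau2 in
    let iv := exists2 s : Cplx R, `|s| <= 1 & dir_cond s in
    let v := forall s : Cplx R, `|s| <= 1 -> dir_cond s in
    [<-> i; ii; iii; iv; v] /\
    ([\/ i, ii, iii | iv \/ v] ->
      forall l : Cplx R, unit_ball l ->
      exists2 a : Cplx R,
        is_angular_derivative (fun z => phi (l, z)) tau2 a &
        forall s : Cplx R, `|s| <= 1 ->
        exists2 D : R -> Cplx R,
          forall t : R, 0 < t ->
            is_dirderiv phi (s, tau2) (s * t%:C%C, tau2) (D t) &
          D t @[t --> +oo%R] --> (- tau2 * a : Cplx R))).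
Proof.
have [hilbert dec _ model] := phi_model.
have phi_cont l : unit_ball l -> phi @ l --> phi l.
  by move=> /phi_hol/differentiable_continuous.
split=> [tau1 tau1E neq|tau2 tau2E neq].
  split; first exact: (left_typeI_equivalences hilbert dec phi_disk model phi_cont tau1E neq).
  exact: (left_typeI_derivatives hilbert dec phi_disk model tau1E).
have model' l m : unit_ball l -> unit_ball m ->
    1 - tilde phi l * (tilde phi m)^* =
    (1 - l.1 * (m.1)^*) * ip (oproj ip M2 (tilde u l)) (oproj ip M2 (tilde u m)) +
    (1 - l.2 * (m.2)^*) * ip (oproj ip M1 (tilde u l)) (oproj ip M1 (tilde u m)) :> R[i].
  by move=> /swap_unit_ball l1 /swap_unit_ball m1; rewrite [RHS]addrC; exact: (model (swap l) (swap m)).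
have disk' l : unit_ball l -> unit_ball (tilde phi l).
  by move=> /swap_unit_ball; exact: phi_disk.
have neq' : ~ {in unit_ball, tilde phi =1 fst}.
  move=> h; apply: neq => l; rewrite inE => l1.
  have := h (swap l); rewrite inE => /(_ ((swap_unit_ball l).2 l1)).
  by rewrite /tilde /= -surjective_pairing.
have dec' := orthogonal_decomposition_sym dec.
have cont' := continuous_tilde phi_cont.
move=> dir_cond.
have dir_condE : dir_cond = fun s : Cplx R =>
    [/\ B_point (tilde phi) (tau2, s), nt_limit (tilde phi) (tau2, s) tau2 &
        forall t : R, 0 < t -> exists2 d : Cplx R,
          is_dirderiv (tilde phi) (tau2, s) (tau2, s * t%:C%C) d &
          (d / - tau2 : R[i]) <= 1].
  apply/funext => s; apply/propext.
  have dirE t d := is_dirderiv_tilde phi tau2 s tau2 (s * t%:C%C) d.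
  split=> -[B nt D]; split.
  - exact/B_point_tilde.
  - exact/nt_limit_tilde.
  - by move=> t /D[d hd d1]; exists d; [exact: (iffRL (dirE t d) hd)|exact: d1].
  - exact/(B_point_tilde phi).
  - exact/(nt_limit_tilde phi).
  - by move=> t /D[d hd d1]; exists d; [exact: (iffLR (dirE t d) hd)|exact: d1].
clearbody dir_cond; subst dir_cond => i ii iii iv v.
split; first exact: (left_typeI_equivalences hilbert dec' disk' model' cont' tau2E neq').
move=> h l l1.
have [a ha D] := left_typeI_derivatives hilbert dec' disk' model' tau2E h l1.
exists a; first exact: ha.
move=> s /D[d hd lim]; exists d; last exact: lim.
by move=> t t0; exact: (iffLR (is_dirderiv_tilde phi _ _ _ _ _) (hd t t0)).
Qed.
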